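(* Let $m=n=1$, $g\in V_f$, $h\in V_s$. A simple relaxation oscillation $\mathcal{A}$ of the singular fast-slow system given by $\{g,h\}$ is persistent if the fast-slow system is persistent under global singular equivalence.
   Context: Setting. Consider fast-slow systems $\epsilon\dot x=g(x,y)$, $\dot y=h(x,y)$ in the singular limit $\epsilon\to 0$, with one fast variable $x$ and one slow variable $y$; only systems with bounded global attractors are considered. Fix compact regions (intervals) $M\subset\mathbb{R}$ (for $x$) and $N\subset\mathbb{R}$ (for $y$) with nonempty interior and outward normals $m(x)$ and $n(y)$. All sets below are considered inside $M\times N$. $V_f$ is the set of $g\in C^\infty(\mathbb{R}^2,\mathbb{R})$ such that $g(x,y)\,m(x)<0$ for all $(x,y)\in\partial M\times N$, and such that for all $(x,y)\in M\times\partial N$, $g(x,y)=0$ implies $g_x(x,y)\neq0$. $V_s$ is the set of $h\in C^\infty(\mathbb{R}^2,\mathbb{R})$ with $h(x,y)\,n(y)<0$ for all $(x,y)\in M\times\partial N$. Reduced (slow) equations: $0=g(x,y)$, $\dot y=h(x,y)$. Layer (fast) equations: $x'=g(x,y)$, $y'=0$. Critical set $\mathcal{C}[g]=\{g=0\}$; $\mathcal{C}_{att}[g]=\{p\in\mathcal{C}[g]:g_x(p)<0\}$, with closure $\overline{\mathcal{C}_{att}}[g]$; fold set $\mathcal{F}[g]=\{p\in\mathcal{C}[g]:g_x(p)=0\}$. With $\pi(x,y)=y$ and $\Pi(p)=\{q\in\mathcal{F}[g]:\pi(q)=\pi(p)\}$, the set of degenerate folds is $\mathcal{D}[g]=\{p\in\mathcal{F}[g]: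 g_y(p)=0\text{ or }g_{xx}(p)=0\text{ or }|\Pi(p)|\ge2\}$. Slow segments: a continuous curve $s_k:[0,1]\to M\times N$ is a slow segment if, up to a continuous monotonic increasing reparametrisation $\theta$, it is a trajectory of the reduced equations. It has slow time duration $T_k>0$ if it can be parametrised by $\theta(s)=s/T_k$ with $s\in[0,T_k]$ slow time; if not, and if $\theta(0)=\theta(1)$ (the segment is trivial), then $T_k=0$; otherwise $T_k=\infty$. Relaxation oscillation: a sequence $\mathcal{A}=\{s_k(\theta):\theta\in[0,1]\}_{k=0}^{d-1}$ of slow segments such that either $\mathcal{A}$ is a loop entirely within $\overline{\mathcal{C}_{att}}[g]$ (then $d=1$ and $s_0(1)=s_0(0)$), or for each $k$ (mod $d$): $s_k(\theta)\in\overline{\mathcal{C}_{att}}[g]$ for all $\theta\in(0,1)$, and there is a trajectory $\phi$ of the fast system with $\alpha$-limit $s_k(1)$ and $\omega$-limit $s_{k+1}(0)$. Its slow period is $\mathcal{P}(\mathcal{A})=\sum_{k=0}^{d-1}T_k$. Simple relaxation oscillation ($m=n=1$): $\mathcal{A}$ is simple if (i) $\mathcal{P}(\mathcal{A})$ is finite; (ii) $s_k(\theta)\in\mathcal{C}_{att}[g]$ for all $\theta\in[0,1)$ and all $k$; (iii) either $s_k(1)\in\mathcal{F}[g]\setminus\mathcal{D}[g]$ (for every $k$), or $d=1$ and $s_0(1)=s_0(0)$. A simple relaxation oscillation undergoes bifurcation if it ceases to be simple under perturbation of the singular fast-slow system; otherwise it is persistent. Global singular equivalence: $\{g,h\}$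 is globally singularly equivalent to $\{\tilde g,\tilde h\}$ on $M\times N$ (both in $V_f\times V_s$) if $\tilde g(x,y)=S(x,y)g(X(x,y),Y(y))$ for all $(x,y)\in M\times N$ and $\tilde h(x,y)=T(x,y)h(X(x,y),Y(y))$ for all $(x,y)\in\mathcal{C}[\tilde g]$, where $(x,y)\mapsto(X(x,y),Y(y))$ is a diffeomorphism of $M\times N$ and $S,T$ are smooth and positive on $M\times N$. The system is persistent under global singular equivalence if it is its own universal unfolding, i.e. for every smooth unfolding $(G,H)(x,y,\lambda)$, $\lambda\in\mathbb{R}^r$, with $(G,H)(\cdot,\cdot,0)=(g,h)$, there is a neighbourhood $W$ of $0$ such that $\{G(\cdot,\cdot,\lambda),H(\cdot,\cdot,\lambda)\}$ is globally singularly equivalent to $\{g,h\}$ for all $\lambda\in W$. *)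

(* Defs.v *)
From HB Require Import structures.
From mathcomp Require Import all_boot all_order all_algebra.
From mathcomp Require Import all_classical all_reals all_analysis.

Set Implicit Arguments.
Unset Strict Implicit.
Unset Printing Implicit Defensive.

Import Order.TTheory GRing.Theory Num.Theory.
Import numFieldNormedType.Exports.

Local Open Scope classical_set_scope.
Local Open Scope ring_scope.

(* [Ck k f]: f has iterated directional derivatives up to order k,
   all of order < k differentiable and all of order k continuous. *)

Fixpoint Ck (R : realType) (V W : normedModType R) (k : nat) (f : V -> W)
    {struct k} : Prop :=
  match k with
  | 0%N => continuous f
  | k'.+1 => (forall x, differentiable f x) /\
             (forall v, Ck k' (fun x => 'D_v f x))
  end.

Definition smooth (R : realType) (V W : normedModType R) (f : V -> W) : Prop :=
  forall k, Ck k f.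

(* Smooth functions on a closed set are the restrictions of smooth functions
   on the whole space. *)
Definition smooth_on (R : realType) (V W : normedModType R)
    (D : set V) (f : V -> W) : Prop :=
  exists F : V -> W, smooth F /\ (forall p, D p -> F p = f p).

(* The window M x N, with M = [xlo, xhi] for the fast variable and
   N = [ylo, yhi] for the slow one. *)

Record window (R : realType) := Window {
  xlo : R; xhi : R; ylo : R; yhi : R;
  xlo_lt_xhi : xlo < xhi;
  ylo_lt_yhi : ylo < yhi }.

Definition fast_range (R : realType) (K : window R) : set R :=
  [set x | xlo K <= x <= xhi K].

Definition slow_range (R : realType) (K : window R) : set R :=
  [set y | ylo K <= y <= yhi K].

Definition rect (R : realType) (K : window R) : set (R * R) :=
  fast_range K `*` slow_range K.

(* Outward normal of [a, b]: -1 at a, +1 at b (only used at the end points). *)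
Definition outward_normal (R : realType) (a b x : R) : R :=
  (x == b)%:R - (x == a)%:R.

Definition partial_x (R : realType) (g : R * R -> R) (p : R * R) : R :=
  'D_((1, 0) : R * R) g p.

Definition partial_y (R : realType) (g : R * R -> R) (p : R * R) : R :=
  'D_((0, 1) : R * R) g p.

Definition V_f (R : realType) (K : window R) (g : R * R -> R) : Prop :=
  [/\ smooth g,
      (forall x y, [set xlo K; xhi K] x -> slow_range K y ->
         g (x, y) * outward_normal (xlo K) (xhi K) x < 0)
    & (forall x y, fast_range K x -> [set ylo K; yhi K] y ->
         g (x, y) = 0 -> partial_x g (x, y) != 0)].

Definition V_s (R : realType) (K : window R) (h : R * R -> R) : Prop :=
  smooth h /\
  (forall x y, fast_range K x -> [set ylo K; yhi K] y ->
     h (x, y) * outward_normal (ylo K) (yhi K) y < 0).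

Definition critical_set (R : realType) (K : window R) (g : R * R -> R) :
    set (R * R) :=
  [set p | rect K p /\ g p = 0].

Definition critical_att (R : realType) (K : window R) (g : R * R -> R) :
    set (R * R) :=
  [set p | critical_set K g p /\ partial_x g p < 0].

Definition fold_set (R : realType) (K : window R) (g : R * R -> R) :
    set (R * R) :=
  [set p | critical_set K g p /\ partial_x g p = 0].

Definition fold_fibre (R : realType) (K : window R) (g : R * R -> R)
    (p : R * R) : set (R * R) :=
  [set q | fold_set K g q /\ q.2 = p.2].

Definition degenerate_folds (R : realType) (K : window R) (g : R * R -> R) :
    set (R * R) :=
  [set p | fold_set K g p /\
     [\/ partial_y g p = 0, partial_x (partial_x g) p = 0
       | (`I_2 #<= fold_fibre K g p)%card]].

(* Trajectories on a time interval I of 0 = g(x,y), y' = h(x,y).  The fast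
   component is only required to be continuous, since it need not be
   differentiable at a fold.  On a closed end of I the one-sided equation for y
   follows from continuity. *)
Definition slow_trajectory (R : realType) (K : window R) (g h : R * R -> R)
    (I : set R) (gamma : R -> R * R) : Prop :=
  [/\ {within I, continuous gamma},
      (forall t, I t -> critical_set K g (gamma t))
    & (forall t, I° t ->
         is_derive t (1 : R) (fun u => (gamma u).2) (h (gamma t)))].

Definition fast_trajectory (R : realType) (K : window R) (g : R * R -> R)
    (phi : R -> R * R) : Prop :=
  forall t, [/\ rect K (phi t),
    is_derive t (1 : R) (fun u => (phi u).1) (g (phi t))
  & is_derive t (1 : R) (fun u => (phi u).2) 0].

(* sigma maps the curve parameter theta to slow time.  Only the open interval
   ]0, 1[ is reparametrised, so that end points may be reached in infinite
   time; monotonicity is weak, so that trivial (constant) segments qualify. *)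
Definition slow_segment (R : realType) (K : window R) (g h : R * R -> R)
    (s : R -> R * R) : Prop :=
  [/\ {within `[0, 1], continuous s},
      (forall th, 0 <= th <= 1 -> rect K (s th))
    & exists (sigma : R -> R) (gamma : R -> R * R),
      [/\ {within `]0, 1[, continuous sigma},
          (forall th1 th2, 0 < th1 -> th1 <= th2 -> th2 < 1 ->
             sigma th1 <= sigma th2),
          slow_trajectory K g h (sigma @` `]0, 1[) gamma
        & forall th, 0 < th < 1 -> s th = gamma (sigma th)]].

(* Up to reparametrisation, s is traversed in slow time [0, tau], tau > 0. *)
Definition traversed_in (R : realType) (K : window R) (g h : R * R -> R)
    (s : R -> R * R) (tau : R) : Prop :=
  0 < tau /\
  exists (sigma : R -> R) (gamma : R -> R * R),
    [/\ {within `[0, 1], continuous sigma} /\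
          (forall th1 th2, 0 <= th1 -> th1 <= th2 -> th2 <= 1 ->
             sigma th1 <= sigma th2),
        sigma 0 = 0 /\ sigma 1 = tau,
        slow_trajectory K g h `[0, tau] gamma
      & forall th, 0 <= th <= 1 -> s th = gamma (sigma th)].

Definition trivial_segment (R : realType) (s : R -> R * R) : Prop :=
  forall th, 0 <= th <= 1 -> s th = s 0.

(* A relation, because the duration of a segment resting at an equilibrium is
   not unique: every positive number qualifies. *)
Definition slow_duration (R : realType) (K : window R) (g h : R * R -> R)
    (s : R -> R * R) (T : \bar R) : Prop :=
  (exists tau : R, traversed_in K g h s tau /\ T = tau%:E) \/
  ((forall tau : R, ~ traversed_in K g h s tau) /\
   ((trivial_segment s /\ T = 0%E) \/ (~ trivial_segment s /\ T = +oo%E))).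

(* The alpha- and omega-limits are single points, i.e. the fast trajectory phi
   converges at both ends; [ordS k] is k + 1 mod d. *)
Definition relaxation_oscillation (R : realType) (K : window R)
    (g h : R * R -> R) (d : nat) (A : 'I_d -> R -> R * R) : Prop :=
  [/\ (0 < d)%N,
      (forall k, slow_segment K g h (A k))
    & (d = 1%N /\
       (forall k, A k 1 = A k 0 /\
          forall th, 0 <= th <= 1 -> closure (critical_att K g) (A k th)))
      \/
      (forall k,
         (forall th, 0 < th < 1 -> closure (critical_att K g) (A k th)) /\
         exists phi : R -> R * R,
           [/\ fast_trajectory K g phi,
               phi t @[t --> -oo] --> A k 1
             & phi t @[t --> +oo] --> A (ordS k) 0])].

Definition slow_period (R : realType) (K : window R) (g h : R * R -> R)
    (d : nat) (A : 'I_d -> R -> R * R) (P : \bar R) : Prop :=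
  exists T : 'I_d -> \bar R,
    (forall k, slow_duration K g h (A k) (T k)) /\ P = (\sum_(k < d) T k)%E.

Definition simple_oscillation (R : realType) (K : window R)
    (g h : R * R -> R) (d : nat) (A : 'I_d -> R -> R * R) : Prop :=
  [/\ relaxation_oscillation K g h A,
      (exists P : \bar R, slow_period K g h A P /\ P \is a fin_num),
      (forall k th, 0 <= th < 1 -> critical_att K g (A k th))
    & (forall k, (fold_set K g `\` degenerate_folds K g) (A k 1)) \/
      (d = 1%N /\ forall k, A k 1 = A k 0)].

Definition unfolding (R : realType) (g h : R * R -> R) (r : nat)
    (G H : (R * R) * 'rV[R]_r -> R) : Prop :=
  [/\ smooth G, smooth H
    & (forall p, G (p, 0) = g p) /\ (forall p, H (p, 0) = h p)].

(* A simple oscillation A is persistent if it survives as a simple oscillation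
   under every perturbation: all nearby members of any smooth unfolding have a
   simple oscillation, with as many segments, uniformly close to A. *)
Definition persistent_oscillation (R : realType) (K : window R)
    (g h : R * R -> R) (d : nat) (A : 'I_d -> R -> R * R) : Prop :=
  forall (r : nat) (G H : (R * R) * 'rV[R]_r -> R), unfolding g h G H ->
  forall eps : R, 0 < eps ->
  \forall lambda \near nbhs (0 : 'rV[R]_r),
    exists B : 'I_d -> R -> R * R,
      simple_oscillation K (fun p => G (p, lambda)) (fun p => H (p, lambda)) B
      /\ (forall k th, 0 <= th <= 1 -> `|B k th - A k th| < eps).

Definition diffeomorphism_of (R : realType) (V : normedModType R)
    (D : set V) (Phi : V -> V) : Prop :=
  exists Psi : V -> V,
    [/\ smooth_on D Phi, smooth_on D Psi,
        (forall p, D p -> D (Phi p) /\ D (Psi p))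
      & (forall p, D p -> Psi (Phi p) = p /\ Phi (Psi p) = p)].

Definition globally_singularly_equivalent (R : realType) (K : window R)
    (g h gt ht : R * R -> R) : Prop :=
  [/\ V_f K g /\ V_s K h, V_f K gt /\ V_s K ht &
  exists (X : R * R -> R) (Y : R -> R) (S T : R * R -> R),
    let Phi := fun p : R * R => (X p, Y p.2) in
    [/\ diffeomorphism_of (rect K) Phi,
        smooth_on (rect K) S /\ (forall p, rect K p -> 0 < S p),
        smooth_on (rect K) T /\ (forall p, rect K p -> 0 < T p),
        (forall p, rect K p -> gt p = S p * g (Phi p))
      & (forall p, critical_set K gt p -> ht p = T p * h (Phi p))]].

Definition persistent_system (R : realType) (K : window R)
    (g h : R * R -> R) : Prop :=
  forall (r : nat) (G H : (R * R) * 'rV[R]_r -> R), unfolding g h G H ->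
  \forall lambda \near nbhs (0 : 'rV[R]_r),
    globally_singularly_equivalent K
      (fun p => G (p, lambda)) (fun p => H (p, lambda)) g h.

(* Main.v *)
(** Write a perturbed system as G(x, y, l), H(x, y, l) with parameter l near 0.

    If the oscillation is a closed slow curve on the attracting sheet, it is a single
    point (y is monotone along it unless it rests at an equilibrium), and a nearby
    attracting zero of G on the same fibre replaces it.

    Otherwise every segment ends at a nondegenerate fold.  The only role of
    persistence of the system is to give h <> 0 at folds: the map
    (g - x g_x, g_x, h) from the window to R^3 is Lipschitz, so its image misses
    arbitrarily small (a, b, c), i.e. g - a - b x has no fold in the window where
    h - c vanishes, and an equivalence would carry such a fold over from (g, h).
    With h <> 0 at both ends and, by uniqueness for the slow flow, in between, each
    segment is traversed with y strictly monotone, so it can be continued by the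
    implicit function theorem, uniformly up to the fold, with y affinely rescaled
    and time recomputed from H.  Folds, landing points and the sign of G between them
    persist as well, which gives the perturbed jumps. *)

Require Import Defs.
From HB Require Import structures.
From mathcomp Require Import all_boot all_order all_algebra.
From mathcomp Require Import all_classical all_reals all_analysis.
From mathcomp Require Import ring lra.

Set Implicit Arguments.
Unset Strict Implicit.
Unset Printing Implicit Defensive.

Import Order.TTheory GRing.Theory Num.Theory.
Import numFieldNormedType.Exports.

Local Open Scope classical_set_scope.
Local Open Scope ring_scope.

(** * Calculus on the line *)

Section real_functions.
Context {R : realType}.
Implicit Types (f df u k : R -> R) (a b c x y : R).

(** A fold where h vanishes can still be reached in finite slow time, yet a small change of h may
    put an equilibrium on the attracting branch just before it and block the segment; this is the
    situation that persistence of the system has to exclude.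

    The implicit function theorem breaks down at the end of each segment, exactly where the curve
    must be followed. What survives there is elementary: G_xx <> 0 makes G strictly convex or
    concave in x, so a fibre carries at most one attracting zero near the fold, and it carries one
    on the side where G_xx G_y (y - f_y) < 0, f being the perturbed fold. Existence comes from
    intermediate values and uniqueness from mean values. Both use only continuity in the parameter,
    so the local lemmas allow any topological space of parameters. Reflections of x and of y cut
    down the sign cases.

    A fold with h = 0 is three equations in two unknowns, which is why counting grid points can
    replace Sard's theorem. *)

Lemma is_derive_continuous f x (d : R) : is_derive x (1 : R) f d -> {for x, continuous f}.
Proof. by case=> fx _; apply/differentiable_continuous/derivable1_diffP. Qed.

Lemma mvt f df a b : a < b ->
  (forall x, a <= x <= b -> is_derive x (1 : R) f (df x)) ->
  exists c, a < c < b /\ f b - f a = df c * (b - a).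
Proof.
move=> ab fd; have [||c] := @MVT R f df a b ab.
- by move=> x /[!in_itv]/= /andP[ax xb]; apply: fd; rewrite !ltW.
- apply: derivable_within_continuous => x /[!in_itv]/= xab.
  by case: (fd x xab).
- by rewrite in_itv/= => cab e; exists c.
Qed.

Lemma ivt_decr f a b : a < b -> continuous f -> 0 < f a -> f b < 0 ->
  exists c, a < c < b /\ f c = 0.
Proof.
move=> ab fc fa fb.
have [||c] := @IVT R f a b 0 (ltW ab).
- exact: continuous_subspaceT.
- by rewrite ge_min le_max (ltW fa) (ltW fb) orbT.
rewrite /= in_itv/= => /andP[ac cb] fc0; exists c; split=> //.
rewrite !lt_neqAle ac cb !andbT; apply/andP; split; apply/eqP => E.
  by move: fa; rewrite E fc0 ltxx.
by move: fb; rewrite -E fc0 ltxx.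
Qed.

(** Integrating from -n gives a primitive on ]-n, +oo[ only. Normalised to vanish at 0, these
    primitives agree wherever two of them are defined, and they are glued over n. *)
Lemma primitive f : continuous f ->
  exists F : R -> R, forall x, is_derive x (1 : R) F (f x).
Proof.
move=> fc.
pose J (n : nat) (x : R) := (\int[lebesgue_measure]_(t in `[- n%:R, x]) f t)%R.
have JD (n : nat) x : - n%:R < x -> is_derive x (1 : R) (J n) (f x).
  move=> nx.
  have /continuous_FTC1_closed : x < x + 1 by rewrite ltrDl.
  move=> /(_ f (- n%:R)) [|//||].
  - apply: continuous_compact_integrable; first exact: segment_compact.
    exact: continuous_subspaceT.
  - exact: fc.
  - by move=> /derivableP Jd; rewrite derive1E => E; rewrite -E.
pose P (n : nat) x := J n x - J n 0.
have PE (n m : nat) x : - n%:R < x -> - m%:R < x -> (0 < n)%N -> (0 < m)%N ->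
    P n x = P m x.
  wlog x0 : n m x / 0 <= x.
    have [x0 /(_ n m x x0)//|x0 _] := leP 0 x.
    move=> nx mx n0 m0.
    have [|c [_]] := @mvt (fun z => J n z - J m z) (fun z => f z - f z) x 0 x0.
      move=> z /andP[xz z0]; apply: is_deriveB; apply: JD; exact: lt_le_trans xz.
    by rewrite subrr mul0r /P; lra.
  rewrite le_eqVlt in x0; have [/eqP <-|{}x0] := orP x0; first by rewrite /P !subrr.
  move=> nx mx n0 m0.
  have [|c [_]] := @mvt (fun z => J n z - J m z) (fun z => f z - f z) 0 x x0.
    move=> z /andP[xz z0]; apply: is_deriveB; apply: JD; apply: lt_le_trans xz.
      by rewrite oppr_lt0 ltr0n.
    by rewrite oppr_lt0 ltr0n.
  by rewrite subrr mul0r /P; lra.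
(* An integer above |x|, so x lies in the domain of [P (N x)]. For z near x, [P (N z)] and [P (N x)]
   agree at z, so the derivative can be taken with the index frozen at x. *)
pose N x := (Num.truncn `|x|).+1.
have NP x : - (N x)%:R < x.
  rewrite ltrNl; apply: le_lt_trans (truncnS_gt _).
  by rewrite -normrN ler_norm.
exists (fun x => P (N x) x) => x.
have PD : is_derive x (1 : R) (P (N x)) (f x).
  by rewrite -[f x]subr0; apply: is_deriveB; apply: JD.
apply: near_eq_is_derive PD.
near=> z; apply: PE => //.
near: z; exact: lt_nbhsr.
Unshelve. all: by end_near. Qed.

(* The time map, a primitive of 1/k, is onto R because k is bounded above. *)
Lemma ode_line k K s0 : continuous k -> (forall s, 0 < k s <= K) ->
  exists s r : R -> R,
    [/\ forall t, is_derive t (1 : R) s (k (s t)), continuous r,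
        cancel s r, cancel r s & {homo s : x y / x < y} /\ s 0 = s0].
Proof.
move=> kc kb.
have k0 x : 0 < k x by case/andP: (kb x).
have K0 : 0 < K by case/andP: (kb 0) => a b; exact: lt_le_trans b.
have [|F0 F0d] := @primitive (fun x => (k x)^-1).
  by move=> x; apply: continuousV; [rewrite gt_eqF|exact: kc].
pose F x := F0 x - F0 s0.
have Fd x : is_derive x (1 : R) F (k x)^-1.
  by rewrite -[_^-1]subr0; apply: is_deriveB.
have Fc : continuous F by move=> x; exact: is_derive_continuous (Fd x).
have Finc x y : x < y -> (y - x) / K <= F y - F x.
  move=> xy; have [c [_ ->]] := @mvt F (fun x => (k x)^-1) x y xy.
  rewrite mulrC ler_pM2r ?subr_gt0// lef_pV2 ?posrE//.
  by case/andP: (kb c).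
have Flt x y : x < y -> F x < F y.
  move=> xy; rewrite -subr_gt0; apply: lt_le_trans (Finc _ _ xy).
  by rewrite divr_gt0// subr_gt0.
have Fsurj t : exists x, F x = t.
  (* [F] has slope at least 1/K, so a move of [M] away from [s0] changes it by at least |t| + 1. *)
  pose M := K * (`|t| + 1).
  have M0 : 0 < M by rewrite mulr_gt0// ltr_wpDl.
  have Fs0 : F s0 = 0 by rewrite /F subrr.
  have hi : `|t| + 1 <= F (s0 + M).
    have := @Finc s0 (s0 + M); rewrite ltrDl Fs0 => /(_ M0).
    by rewrite addrC addKr subr0 /M mulrC mulKf// gt_eqF.
  have lo : F (s0 - M) <= - (`|t| + 1).
    have := @Finc (s0 - M) s0; rewrite ltrBlDr ltrDl Fs0 => /(_ M0).
    by rewrite opprB addrC subrK sub0r /M mulrC mulKf ?gt_eqF// lerNr.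
  have tl := ler_norm t; have := ler_norm (- t); rewrite normrN => tr.
  have [|||x _ Fx] := @IVT R F (s0 - M) (s0 + M) t; last by exists x.
  - by lra.
  - exact: continuous_subspaceT.
  - by rewrite ge_min le_max; apply/andP; split; apply/orP; [left|right]; lra.
have /choice[s Fs] := Fsurj.
have Finj : injective F.
  move=> x y e; have [xy|yx|//] := ltgtP x y.
    by have := Flt _ _ xy; rewrite e ltxx.
  by have := Flt _ _ yx; rewrite e ltxx.
have sF : cancel F s by move=> x; apply: Finj; rewrite Fs.
exists s, F; split=> //.
- move=> t; rewrite -{1}[t]Fs -[X in is_derive _ _ _ X]invrK.
  apply: (@is_derive_inverse R F).
  + by near=> z; exact: sF.
  + by near=> z; exact: Fc.
  + by rewrite invr_eq0 gt_eqF.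
- split.
  + move=> x y xy; rewrite ltNge; apply/negP; rewrite le_eqVlt => /orP[/eqP e|].
      by move: xy; rewrite -(Fs x) -(Fs y) e ltxx.
    by move=> /Flt; rewrite !Fs ltNge (ltW xy).
  + by rewrite -{1}(subrr (F0 s0)) -/(F s0) sF.
Unshelve. all: by end_near. Qed.

End real_functions.

(** * Heteroclinic orbits of scalar equations *)

Section heteroclinic.
Context {R : realType}.
Implicit Types (u du : R -> R) (a b : R).

(** The solution of p' = (p - a)(b - p)/(b - a) with p(0) = (a + b)/2; it serves as a chart of ]a,
    b[ by the whole line. *)
Let logistic a b (s : R) : R := (b + a * expR (- s)) / (1 + expR (- s)).

Let logistic_btw a b s : a < b -> a < logistic a b s < b.
Proof.
move=> ab; rewrite /logistic; have E0 := expR_gt0 (- s).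
by rewrite ltr_pdivlMr ?ltr_pdivrMr ?addr_gt0//; apply/andP; split; nra.
Qed.

Let is_derive_logistic a b s : a < b ->
  is_derive s (1 : R) (logistic a b)
    ((logistic a b s - a) * (b - logistic a b s) / (b - a)).
Proof.
move=> ab; have E0 := expR_gt0 (- s); rewrite /logistic.
have ne : 1 + expR (- s) != 0 by rewrite gt_eqF// addr_gt0.
apply: is_derive_eq.
rewrite /GRing.scale/=; field.
by rewrite ne subr_eq0 gt_eqF.
Qed.

Let logistic_surj a b z : a < z < b -> exists s, logistic a b s = z.
Proof.
move=> /andP[az zb]; exists (- ln ((b - z) / (z - a))).
rewrite /logistic opprK lnK; last by rewrite posrE divr_gt0 ?subr_gt0.
by field; rewrite subr_eq0 gt_eqF//=; apply/eqP; lra.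
Qed.

Let logistic_incr a b s t : a < b -> s < t -> logistic a b s < logistic a b t.
Proof.
move=> ab st; have [c [_ E]] := @mvt R (logistic a b) _ s t st
  (fun s _ => is_derive_logistic s ab).
rewrite -subr_gt0 E mulr_gt0 ?subr_gt0// divr_gt0 ?subr_gt0//.
by have /andP[h1 h2] := logistic_btw c ab; rewrite mulr_gt0// subr_gt0.
Qed.

(** In the logistic chart the two equilibria go to infinity and the equation becomes s' = k(s).
    Since u vanishes at both ends and has bounded derivative on [a, b], k is bounded, so [ode_line]
    gives a solution for all times that runs through the whole line; back in ]a, b[ it tends to a
    and to b. *)
Let heteroclinic_incr u du a b : a < b -> continuous du ->
  (forall x, is_derive x (1 : R) u (du x)) ->
  u a = 0 -> u b = 0 -> (forall x, a < x < b -> 0 < u x) ->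
  exists phi : R -> R,
    [/\ forall t, is_derive t (1 : R) phi (u (phi t)),
        forall t, a < phi t < b,
        phi t @[t --> -oo] --> a & phi t @[t --> +oo] --> b].
Proof.
move=> ab duc ud ua ub u0.
have uc : continuous u by move=> x; exact: is_derive_continuous (ud x).
have [c _ cmax] : exists2 c, c \in `[a, b]%R &
    forall t, t \in `[a, b]%R -> `|du t| <= `|du c|.
  apply: EVT_max; first exact: ltW.
  apply: continuous_subspaceT => x.
  by apply: continuous_comp; [exact: duc|exact: norm_continuous].
pose L := `|du c|.
have uL x : a < x < b -> u x <= L * (x - a) /\ u x <= L * (b - x).
  move=> /andP[ax xb]; split.
    have [y [/andP[ay yx]]] := @mvt R u du a x ax (fun z _ => ud z).
    rewrite ua subr0 => ->; rewrite ler_pM2r ?subr_gt0//.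
    by apply: le_trans (ler_norm _) _; apply: cmax; rewrite in_itv/=; lra.
  have [y [/andP[ay yx]]] := @mvt R u du x b xb (fun z _ => ud z).
  rewrite ub sub0r => /eqP; rewrite eqr_oppLR => /eqP ->.
  rewrite -mulNr ler_pM2r ?subr_gt0//.
  apply: le_trans (ler_norm _) _; rewrite normrN.
  by apply: cmax; rewrite in_itv/=; lra.
pose psi := logistic a b.
have psib s : a < psi s < b := logistic_btw s ab.
have psid s := is_derive_logistic s ab.
have psic : continuous psi by move=> x; exact: is_derive_continuous (psid x).
pose k s := u (psi s) * (b - a) / ((psi s - a) * (b - psi s)).
(* 2 L bounds k: write u (b - a) = u (x - a) + u (b - x) and bound u by L (b - x) in the first term,
   by L (x - a) in the second. *)
have [|s|s [r [sd rc sr rs [sinc _]]]] := @ode_line R k (2 * L + 1) 0.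
- move=> s; have /andP[h1 h2] := psib s.
  apply: cvgM.
    by apply: cvgM; [apply: continuous_comp; [exact: psic|exact: uc]|exact: cvg_cst].
  apply: cvgV; first by rewrite mulf_neq0// subr_eq0 ?gt_eqF// lt_eqF.
  apply: cvgM; first by apply: cvgB; [exact: psic|exact: cvg_cst].
  by apply: cvgB; [exact: cvg_cst|exact: psic].
- have /andP[h1 h2] := psib s; have u1 := u0 _ (psib s).
  have D0 : 0 < (psi s - a) * (b - psi s) by rewrite mulr_gt0 ?subr_gt0.
  rewrite /k divr_gt0 ?mulr_gt0 ?subr_gt0//= ler_pdivrMr//.
  by have [] := uL _ (psib s); nra.
exists (psi \o s); split.
- move=> t /=.
  have -> : u (psi (s t)) =
      ((psi (s t) - a) * (b - psi (s t)) / (b - a)) * k (s t).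
    have /andP[h1 h2] := psib (s t); rewrite /k; field.
    by rewrite !subr_eq0 !gt_eqF.
  exact: is_derive1_comp.
- by move=> t; exact: psib.
- apply/cvgrPdist_lt => e e0.
  (* The minimum with the midpoint keeps the target inside ]a, b[, where the chart is onto. *)
  have [|s1 s1E] := @logistic_surj a b (Num.min (a + e / 2) ((a + b) / 2)).
    by rewrite lt_min gt_min; apply/andP; split; [apply/andP; split|apply/orP; right]; lra.
  exists (r s1); split; first exact: num_real.
  move=> t tr /=.
  have /(logistic_incr ab) : s t < s1 by rewrite -(rs s1); exact: sinc.
  rewrite s1E lt_min -/(psi (s t)) => /andP[h _].
  by have /andP[h1 h2] := psib (s t); rewrite distrC gtr0_norm ?subr_gt0//; lra.
- apply/cvgrPdist_lt => e e0.
  have [|s1 s1E] := @logistic_surj a b (Num.max (b - e / 2) ((a + b) / 2)).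
    by rewrite lt_max gt_max; apply/andP; split; [apply/orP; right|apply/andP; split]; lra.
  exists (r s1); split; first exact: num_real.
  move=> t tr /=.
  have /(logistic_incr ab) : s1 < s t by rewrite -(rs s1); exact: sinc.
  rewrite s1E gt_max -/(psi (s t)) => /andP[h _].
  by have /andP[h1 h2] := psib (s t); rewrite gtr0_norm ?subr_gt0//; lra.
Qed.

(** (x - a)(x - b) < 0 says that x lies strictly between a and b in either order, and (b - a) u(x) >
    0 that u points from a to b there. This form is compatible with the reflection of x, which
    settles the case b < a. *)
Lemma heteroclinic u du a b : a != b -> continuous du ->
  (forall x, is_derive x (1 : R) u (du x)) ->
  u a = 0 -> u b = 0 ->
  (forall x, (x - a) * (x - b) < 0 -> 0 < (b - a) * u x) ->
  exists phi : R -> R,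
    [/\ forall t, is_derive t (1 : R) phi (u (phi t)),
        forall t, (phi t - a) * (phi t - b) < 0,
        phi t @[t --> -oo] --> a & phi t @[t --> +oo] --> b].
Proof.
move=> ab duc ud ua ub u0; rewrite neq_lt in ab; have [{}ab|{}ab] := orP ab.
  have [|phi [phid phib pa pb]] := @heteroclinic_incr u du a b ab duc ud ua ub.
    move=> x /andP[ax xb]; have := u0 x; rewrite pmulr_rgt0 ?subr_gt0//.
    by apply; rewrite nmulr_llt0 ?subr_gt0 ?subr_lt0.
  exists phi; split=> // t; have /andP[h1 h2] := phib t.
  by rewrite nmulr_llt0 ?subr_gt0 ?subr_lt0.
have [||||||phi [phid phib pa pb]] :=
    @heteroclinic_incr (fun x => - u (- x)) (du \o -%R) (- a) (- b).
- by rewrite ltrN2.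
- by move=> x; apply: continuous_comp; [exact: oppr_continuous|exact: duc].
- move=> x /=; rewrite -[du (- x)]opprK; apply: is_deriveN.
  by rewrite -mulrN1; apply: (@is_derive1_comp _ u -%R).
- by rewrite opprK ua oppr0.
- by rewrite opprK ub oppr0.
- move=> x /andP[ax xb]; have := u0 (- x); rewrite nmulr_rgt0 ?subr_lt0//.
  by rewrite oppr_gt0; apply; nra.
exists (fun t => - phi t); split.
- move=> t; have := is_deriveN (phid t); rewrite opprK; exact.
- by move=> t; have /andP[] := phib t; nra.
- by rewrite -[a]opprK; exact: cvgN.
- by rewrite -[b]opprK; exact: cvgN.
Qed.

End heteroclinic.

(** * Two-dimensional families and their folds *)

Section product_continuity.
Context {T U V : topologicalType}.

Lemma for_continuous_pair (f : T -> U) (g : T -> V) t :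
  {for t, continuous f} -> {for t, continuous g} ->
  {for t, continuous (fun z => (f z, g z))}.
Proof. by move=> fc gc; apply: cvg_pair; [exact: fc|exact: gc]. Qed.

Lemma for_continuous_fst (f : T -> U * V) t :
  {for t, continuous f} -> {for t, continuous (fun z => (f z).1)}.
Proof. by move=> fc; apply: (cvg_comp _ _ fc); exact: cvg_fst. Qed.

Lemma for_continuous_snd (f : T -> U * V) t :
  {for t, continuous f} -> {for t, continuous (fun z => (f z).2)}.
Proof. by move=> fc; apply: (cvg_comp _ _ fc); exact: cvg_snd. Qed.

Lemma for_continuous_id (t : T) : {for t, continuous (fun z : T => z)}.
Proof. exact: cvg_id. Qed.

Lemma for_continuous_cst (u : U) (t : T) : {for t, continuous (fun _ : T => u)}.
Proof. exact: cvg_cst. Qed.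

Lemma continuous_of_for (F : U -> V) (f : T -> U) t :
  continuous F -> {for t, continuous f} -> {for t, continuous (fun z => F (f z))}.
Proof. by move=> Fc fc; apply: (cvg_comp _ _ fc); exact: Fc. Qed.

End product_continuity.

Ltac solve_continuous :=
  repeat first
  [ apply: for_continuous_id | apply: for_continuous_cst
  | apply: for_continuous_pair | apply: for_continuous_fst
  | apply: for_continuous_snd
  | apply: continuousN | apply: continuousD | apply: continuousM ].

(** Separates a radius in the state from a neighbourhood in the parameter. The local statements
    below have this shape, so that one radius serves all parameters near [l0]. *)
Lemma nbhs_box (R : realType) (V : normedModType R) (T : topologicalType)
    (P : V * T -> Prop) (p0 : V) (l0 : T) :
  (\forall q \near (p0, l0), P q) ->
  exists2 d : R, 0 < d & \forall l \near l0, forall p, `|p - p0| < d -> P (p, l).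
Proof.
move=> [[/= U W] [/nbhs_ballP[d /= d0 dU] Wl]] UW; exists d => //.
apply: filterS Wl => l Wl p pd; apply: UW; split=> //=; apply: dU.
by rewrite -ball_normE /ball_/= distrC.
Qed.

Lemma near_pos (R : realType) (T : topologicalType) (F : T -> R) (q : T) :
  {for q, continuous F} -> 0 < F q -> \forall z \near q, 0 < F z.
Proof. by move=> Fc Fq; apply: (cvgr_gt (F q) Fc). Qed.

Lemma near_neg (R : realType) (T : topologicalType) (F : T -> R) (q : T) :
  {for q, continuous F} -> F q < 0 -> \forall z \near q, F z < 0.
Proof. by move=> Fc Fq; apply: (cvgr_lt (F q) Fc). Qed.

(** The tube lemma: compactness of [a, b] makes the neighbourhood of [t0] independent of x. *)
Lemma segment_near (R : realType) (T : topologicalType) (a b : R) (t0 : T)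
    (P : R -> T -> Prop) :
  (forall x, a <= x <= b -> \forall q \near (x, t0), P q.1 q.2) ->
  \forall t \near t0, forall x, a <= x <= b -> P x t.
Proof.
move=> H; have /compact_near_coveringP := @segment_compact R a b.
move=> /(_ T (nbhs t0) (fun t x => P x t) _).
have h : forall x, `[a, b]%classic x ->
    \forall x' \near x & i \near nbhs t0, P x' i.
  by move=> x /=; rewrite in_itv/= => /H.
by move=> /(_ h); apply: filterS => t h' x xab; apply: h'; rewrite /= in_itv.
Qed.

Lemma norm_lt_pair (R : realType) (V W : normedModType R) (p q : V * W) (e : R) :
  `|p - q| < e <-> `|p.1 - q.1| < e /\ `|p.2 - q.2| < e.
Proof.
by rewrite prod_normE/= gt_max; split=> [/andP[]|[-> ->]].
Qed.

Section C2_family.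
Context {R : realType} {L : topologicalType}.
Implicit Types G Gx Gy Gxx : (R * R) * L -> R.

(** Derivatives are carried as explicit functions, jointly continuous in state and parameter. The
    parameter is never differentiated, which leaves [L] a bare topological space. *)
Record C2_family G Gx Gy Gxx : Prop := {
  C2_contG : continuous G;
  C2_contGx : continuous Gx;
  C2_contGy : continuous Gy;
  C2_contGxx : continuous Gxx;
  C2_dx : forall x y l, is_derive x (1 : R) (fun u => G ((u, y), l)) (Gx ((x, y), l));
  C2_dy : forall x y l, is_derive y (1 : R) (fun v => G ((x, v), l)) (Gy ((x, y), l));
  C2_dxx : forall x y l, is_derive x (1 : R) (fun u => Gx ((u, y), l)) (Gxx ((x, y), l)) }.

Definition flip_x (q : (R * R) * L) : (R * R) * L := ((- q.1.1, q.1.2), q.2).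
Definition flip_y (q : (R * R) * L) : (R * R) * L := ((q.1.1, - q.1.2), q.2).

Lemma continuous_flip_x : continuous flip_x.
Proof. by move=> q; solve_continuous. Qed.

Lemma continuous_flip_y : continuous flip_y.
Proof. by move=> q; solve_continuous. Qed.

Lemma is_derive_compN (f : R -> R) (x d : R) :
  is_derive (- x) (1 : R) f d -> is_derive x (1 : R) (fun z => f (- z)) (- d).
Proof. by move=> fd; rewrite -mulrN1; apply: (@is_derive1_comp _ f -%R). Qed.

(** [G] is negated along with x, so that [Gx], and with it attraction, is preserved while [Gxx] and
    [Gy] change sign; a nondegenerate fold may thus be assumed to have [Gxx] > 0. *)
Lemma C2_family_flip_x G Gx Gy Gxx : C2_family G Gx Gy Gxx ->
  C2_family (fun q => - G (flip_x q)) (Gx \o flip_x)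
    (fun q => - Gy (flip_x q)) (fun q => - Gxx (flip_x q)).
Proof.
case=> c cx cy cxx dx dy dxx.
have cf := continuous_flip_x.
split.
- by move=> q; apply: cvgN; apply: continuous_comp; [exact: cf|exact: c].
- by move=> q; apply: continuous_comp; [exact: cf|exact: cx].
- by move=> q; apply: cvgN; apply: continuous_comp; [exact: cf|exact: cy].
- by move=> q; apply: cvgN; apply: continuous_comp; [exact: cf|exact: cxx].
- move=> x y l /=; rewrite -[Gx _]opprK; apply: is_deriveN.
  exact: (@is_derive_compN (fun u => G ((u, y), l))).
- by move=> x y l /=; apply: is_deriveN; exact: (dy (- x) y l).
- move=> x y l /=; exact: (@is_derive_compN (fun u => Gx ((u, y), l))).
Qed.

(** Here only [Gy] changes sign, which normalises it independently of [Gxx]. *)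
Lemma C2_family_flip_y G Gx Gy Gxx : C2_family G Gx Gy Gxx ->
  C2_family (G \o flip_y) (Gx \o flip_y)
    (fun q => - Gy (flip_y q)) (Gxx \o flip_y).
Proof.
case=> c cx cy cxx dx dy dxx.
have cf := continuous_flip_y.
split.
- by move=> q; apply: continuous_comp; [exact: cf|exact: c].
- by move=> q; apply: continuous_comp; [exact: cf|exact: cx].
- by move=> q; apply: cvgN; apply: continuous_comp; [exact: cf|exact: cy].
- by move=> q; apply: continuous_comp; [exact: cf|exact: cxx].
- by move=> x y l; exact: (dx x (- y) l).
- move=> x y l /=; exact: (@is_derive_compN (fun u => G ((x, u), l))).
- by move=> x y l /=; exact: (dxx x (- y) l).
Qed.

Lemma C2_along_x (F : (R * R) * L -> R) y l : continuous F ->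
  continuous (fun x => F ((x, y), l)).
Proof.
move=> Fc x; by apply: (@continuous_of_for _ _ _ F (fun x => ((x, y), l))) => //; solve_continuous.
Qed.

Lemma C2_along_y (F : (R * R) * L -> R) x l : continuous F ->
  continuous (fun y => F ((x, y), l)).
Proof.
move=> Fc y; by apply: (@continuous_of_for _ _ _ F (fun y => ((x, y), l))) => //; solve_continuous.
Qed.

Lemma C2_along_yl (F : (R * R) * L -> R) x : continuous F ->
  continuous (fun q : R * L => F ((x, q.1), q.2)).
Proof.
move=> Fc q.
by apply: (@continuous_of_for _ _ _ F (fun q : R * L => ((x, q.1), q.2))) => //; solve_continuous.
Qed.

Lemma C2_reassoc (F : (R * R) * L -> R) : continuous F ->
  continuous (fun q : R * (R * L) => F ((q.1, q.2.1), q.2.2)).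
Proof.
move=> Fc q.
by apply: (@continuous_of_for _ _ _ F (fun q : R * (R * L) => ((q.1, q.2.1), q.2.2))) => //; solve_continuous.
Qed.

End C2_family.

(** * Attracting zeros and the branch issuing from a fold *)

Section local_lemmas.
Context {R : realType} {L : topologicalType}.
Implicit Types (G Gx Gy Gxx : (R * R) * L -> R) (p : R * R) (l : L) (a b x y e : R).

Lemma Gx_lt_of_Gxx_gt0 G Gx Gy Gxx a b y l : C2_family G Gx Gy Gxx -> a < b ->
  (forall x, a <= x <= b -> 0 < Gxx ((x, y), l)) -> Gx ((a, y), l) < Gx ((b, y), l).
Proof.
move=> C ab pos; have [c [/andP[ac cb]]] := mvt ab (fun x _ => C2_dxx C x y l).
move=> /eqP; rewrite subr_eq => /eqP ->; rewrite ltrDr mulr_gt0 ?subr_gt0//.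
by apply: pos; rewrite !ltW.
Qed.

(** Convexity in x: between a and x, [Gx] has the sign of the displacement from a, so a is a strict
    minimum of [G] on that stretch. *)
Lemma G_gt0_near_fold G Gx Gy Gxx a x y l : C2_family G Gx Gy Gxx -> x != a ->
  (forall z, Num.min a x <= z <= Num.max a x -> 0 < Gxx ((z, y), l)) ->
  G ((a, y), l) = 0 -> Gx ((a, y), l) = 0 -> 0 < G ((x, y), l).
Proof.
move=> C; rewrite neq_lt => /orP[xa|ax] pos Ga Gxa.
  rewrite min_r ?max_l ?ltW// in pos.
  have [c [/andP[xc ca]]] := mvt xa (fun x _ => C2_dx C x y l).
  rewrite Ga => E.
  have : Gx ((c, y), l) < 0.
    rewrite -Gxa; apply: (Gx_lt_of_Gxx_gt0 C) => // z /andP[cz za].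
    by apply: pos; rewrite za (le_trans (ltW xc)).
  have : 0 < a - x by rewrite subr_gt0.
  by nra.
rewrite min_l ?max_r ?ltW// in pos.
have [c [/andP[ac cx]]] := mvt ax (fun x _ => C2_dx C x y l).
rewrite Ga => E.
have : 0 < Gx ((c, y), l).
  rewrite -Gxa; apply: (Gx_lt_of_Gxx_gt0 C) => // z /andP[az zc].
  by apply: pos; rewrite az (le_trans zc (ltW cx)).
have : 0 < x - a by rewrite subr_gt0.
by nra.
Qed.

(** The implicit function theorem by intermediate values: as [Gx] < 0, the values of [G] at x0 - r
    and x0 + r have opposite signs, and they keep them for nearby (y, l). *)
Lemma attracting_zero_near G Gx Gy Gxx p0 l0 e : C2_family G Gx Gy Gxx ->
  G (p0, l0) = 0 -> Gx (p0, l0) < 0 -> 0 < e ->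
  \forall q \near (p0.2, l0), exists x,
    [/\ `|x - p0.1| < e, G ((x, q.1), q.2) = 0 & Gx ((x, q.1), q.2) < 0].
Proof.
case: p0 => x0 y0 /= C G0 Gx0 e0.
have /nbhs_box[d d0 Hd] : \forall q \near ((x0, y0), l0), Gx q < 0.
  by apply: near_neg => //; exact: C2_contGx C _.
pose r := Num.min d e / 2.
have m0 : 0 < Num.min d e by rewrite lt_min d0 e0.
have r0 : 0 < r by rewrite divr_gt0.
have [rd re] : r < d /\ r < e.
  have : Num.min d e <= d /\ Num.min d e <= e by rewrite !ge_min !lexx orbT.
  by rewrite /r; lra.
have Hl0 := nbhs_singleton Hd.
have Ga : 0 < G ((x0 - r, y0), l0).
  have h : x0 - r < x0 by lra.
  have [c [/andP[c1 c2]]] := mvt h (fun x _ => C2_dx C x y0 l0).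
  have := Hl0 (c, y0); rewrite norm_lt_pair/= subrr normr0 ltr_distl G0 => H.
  have {}H : Gx ((c, y0), l0) < 0 by apply: H; split=> //; lra.
  by nra.
have Gb : G ((x0 + r, y0), l0) < 0.
  have h : x0 < x0 + r by lra.
  have [c [/andP[c1 c2]]] := mvt h (fun x _ => C2_dx C x y0 l0).
  have := Hl0 (c, y0); rewrite norm_lt_pair/= subrr normr0 ltr_distl G0 => H.
  have {}H : Gx ((c, y0), l0) < 0 by apply: H; split=> //; lra.
  by nra.
have cG := C2_contG C.
have Na : \forall q \near (y0, l0), 0 < G ((x0 - r, q.1), q.2).
  by apply: near_pos => //; exact: C2_along_yl.
have Nb : \forall q \near (y0, l0), G ((x0 + r, q.1), q.2) < 0.
  by apply: near_neg => //; exact: C2_along_yl.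
have Nc : \forall q \near (y0, l0),
    forall x, `|x - x0| < d -> Gx ((x, q.1), q.2) < 0.
  exists ([set y | `|y - y0| < d],
          [set l | forall p, `|p - (x0, y0)| < d -> Gx (p, l) < 0]).
    split=> //=; apply/nbhs_ballP; exists d => //= y.
    by rewrite -ball_normE /ball_/= distrC.
  by move=> [y l] [/= hy hl] x hx; apply: hl; rewrite norm_lt_pair.
near=> q.
have qa : 0 < G ((x0 - r, q.1), q.2) by near: q.
have qb : G ((x0 + r, q.1), q.2) < 0 by near: q.
have qc : forall x, `|x - x0| < d -> Gx ((x, q.1), q.2) < 0 by near: q.
have h : x0 - r < x0 + r by lra.
have [c [/andP[c1 c2] Gc]] := ivt_decr h (@C2_along_x _ _ G q.1 q.2 cG) qa qb.
by exists c; split=> //; [|apply: qc]; rewrite ltr_distl; lra.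
Unshelve. all: by end_near. Qed.

(** Near [p0] the condition [Gx] < 0 defines an interval on each fibre: either it holds throughout,
    or [Gx] is monotone in x because [Gxx] <> 0. Between two attracting zeros [G] would then be
    strictly decreasing. The second alternative makes the statement available at folds. *)
Lemma attracting_zero_unique G Gx Gy Gxx p0 l0 : C2_family G Gx Gy Gxx ->
  Gx (p0, l0) < 0 \/ Gxx (p0, l0) != 0 ->
  exists2 d : R, 0 < d & \forall l \near l0, forall x1 x2 y,
    `|x1 - p0.1| < d -> `|x2 - p0.1| < d -> `|y - p0.2| < d ->
    G ((x1, y), l) = 0 -> G ((x2, y), l) = 0 ->
    Gx ((x1, y), l) < 0 -> Gx ((x2, y), l) < 0 -> x1 = x2.
Proof.
case: p0 => x0 y0 /= C hyp.
suff [d d0 Hd] : exists2 d : R, 0 < d & \forall l \near l0, forall x1 x2 x y,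
    `|x1 - x0| < d -> `|x2 - x0| < d -> `|y - y0| < d -> x1 <= x <= x2 ->
    Gx ((x1, y), l) < 0 -> Gx ((x2, y), l) < 0 -> Gx ((x, y), l) < 0.
  exists d => //; near=> l => x1 x2 y.
  have H : forall x1 x2 x y,
    `|x1 - x0| < d -> `|x2 - x0| < d -> `|y - y0| < d -> x1 <= x <= x2 ->
    Gx ((x1, y), l) < 0 -> Gx ((x2, y), l) < 0 -> Gx ((x, y), l) < 0.
    by near: l.
  wlog x12 : x1 x2 / x1 < x2.
    move=> W h1 h2 hy z1 z2 n1 n2.
    by have [x12|x21|//] := ltgtP x1 x2; [|apply/esym]; apply: W.
  move=> h1 h2 hy z1 z2 n1 n2.
  have [c [/andP[c1 c2]]] := mvt x12 (fun x _ => C2_dx C x y l).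
  have : Gx ((c, y), l) < 0 by apply: (H x1 x2) => //; rewrite !ltW.
  by rewrite z1 z2; nra.
case: hyp => [neg|].
  have /nbhs_box[d d0 Hd] : \forall q \near ((x0, y0), l0), Gx q < 0.
    by apply: near_neg => //; exact: C2_contGx C _.
  exists d => //; apply: filterS Hd => l Hl x1 x2 x y.
  rewrite !ltr_distl => h1 h2 hy hx _ _; apply: Hl.
  by rewrite norm_lt_pair/= !ltr_distl; lra.
rewrite neq_lt => /orP[neg|pos].
  have /nbhs_box[d d0 Hd] : \forall q \near ((x0, y0), l0), Gxx q < 0.
    by apply: near_neg => //; exact: C2_contGxx C _.
  exists d => //; apply: filterS Hd => l Hl x1 x2 x y.
  rewrite !ltr_distl => h1 h2 hy /andP[]; rewrite le_eqVlt => /orP[/eqP<-//|hx hx2 n1 n2].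
  have [c [/andP[c1 c2]]] := mvt hx (fun x _ => C2_dxx C x y l).
  have : Gxx ((c, y), l) < 0.
    by apply: Hl; rewrite norm_lt_pair/= !ltr_distl; lra.
  by nra.
have /nbhs_box[d d0 Hd] : \forall q \near ((x0, y0), l0), 0 < Gxx q.
  by apply: near_pos => //; exact: C2_contGxx C _.
exists d => //; apply: filterS Hd => l Hl x1 x2 x y.
rewrite !ltr_distl => h1 h2 hy /andP[hx]; rewrite le_eqVlt => /orP[/eqP->//|hx2 n1 n2].
have [c [/andP[c1 c2]]] := mvt hx2 (fun x _ => C2_dxx C x y l).
have : 0 < Gxx ((c, y), l).
  by apply: Hl; rewrite norm_lt_pair/= !ltr_distl; lra.
by nra.
Unshelve. all: by end_near. Qed.

(** For [Gxx] > 0 the attracting branch lies to the left of the fold. At x0 - r convexity gives [G]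
    > 0; at (f.1, y) the sign hypothesis gives [G] < 0; a zero lies in between, and convexity forces
    [Gx] < 0 there. The side is measured from [f.2] and not from [p0.2], so the branch reaches the
    perturbed fold itself. *)
Let fold_branch_pos G Gx Gy Gxx p0 l0 e : C2_family G Gx Gy Gxx ->
  G (p0, l0) = 0 -> Gx (p0, l0) = 0 -> 0 < Gxx (p0, l0) -> Gy (p0, l0) != 0 ->
  0 < e ->
  exists2 d : R, 0 < d & \forall l \near l0, forall f y,
    `|f - p0| < d -> `|y - p0.2| < d -> G (f, l) = 0 -> Gx (f, l) = 0 ->
    Gy (p0, l0) * (y - f.2) < 0 ->
    exists x, [/\ `|x - p0.1| < e, G ((x, y), l) = 0 & Gx ((x, y), l) < 0].
Proof.
case: p0 => x0 y0 /= C G0 Gx0 Gxx0 Gy0 e0; set k := Gy _ in Gy0 *.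
have /nbhs_box[d d0 Hd] : \forall q \near ((x0, y0), l0), 0 < Gxx q /\ 0 < Gy q * k.
  have A1 : \forall q \near ((x0, y0), l0), 0 < Gxx q.
    by apply: near_pos => //; exact: C2_contGxx C _.
  have A2 : \forall q \near ((x0, y0), l0), 0 < Gy q * k.
    apply: near_pos; last by rewrite -expr2 exprn_even_gt0.
    by apply: continuousM; [exact: C2_contGy C _|exact: cvg_cst].
  exact: filterI A1 A2.
pose r := Num.min d e / 2.
have m0 : 0 < Num.min d e by rewrite lt_min d0 e0.
have r0 : 0 < r by rewrite divr_gt0.
have [rd re] : r < d /\ r < e.
  have : Num.min d e <= d /\ Num.min d e <= e by rewrite !ge_min !lexx orbT.
  by rewrite /r; lra.
have Hl0 := nbhs_singleton Hd.
have Ga : 0 < G ((x0 - r, y0), l0).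
  apply: (G_gt0_near_fold C _ _ G0 Gx0); first by rewrite lt_eqF// gtrBl.
  move=> z; rewrite min_r ?max_l ?gerBl ?(ltW r0)// => hz.
  have [|//] := Hl0 (z, y0); rewrite norm_lt_pair/= subrr normr0 ltr_distl; lra.
have cG := C2_contG C.
have Na : \forall q \near (y0, l0), 0 < G ((x0 - r, q.1), q.2).
  by apply: near_pos => //; exact: C2_along_yl.
have [d1 d10 Hd1] := nbhs_box Na.
exists (Num.min r d1); first by rewrite lt_min r0.
near=> l => -[f1 f2] y; rewrite norm_lt_pair !lt_min/= => -[/andP[f1r _] /andP[f2r _]] /andP[yr yd1] Gf Gxf.
have Hl : forall p, `|p - (x0, y0)| < d -> 0 < Gxx (p, l) /\ 0 < Gy (p, l) * k by near: l.
have Hl1 : forall y, `|y - y0| < d1 -> 0 < G ((x0 - r, y), l) by near: l.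
rewrite !ltr_distl in f1r f2r yr.
move=> ky.
have Gfy : G ((f1, y), l) < 0.
  have [y_lt|lt_y|E] := ltgtP y f2; last by move: ky; rewrite E subrr mulr0 ltxx.
    have [c [/andP[c1 c2]]] := mvt y_lt (fun y _ => C2_dy C f1 y l).
    have [|_] := Hl (f1, c); first by rewrite norm_lt_pair/= !ltr_distl; lra.
    rewrite Gf; set A := Gy _ => Ak E.
    have k0 : 0 < k by nra.
    have : 0 < A by nra.
    by nra.
  have [c [/andP[c1 c2]]] := mvt lt_y (fun y _ => C2_dy C f1 y l).
  have [|_] := Hl (f1, c); first by rewrite norm_lt_pair/= !ltr_distl; lra.
  rewrite Gf; set A := Gy _ => Ak E.
  have k0 : k < 0 by nra.
  have : A < 0 by nra.
  by nra.
have hf : x0 - r < f1 by lra.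
have [z [/andP[z1 z2] Gz]] := ivt_decr hf (@C2_along_x _ _ G y l cG) (Hl1 _ yd1) Gfy.
exists z; split=> //; first by rewrite ltr_distl; lra.
have [c [/andP[c1 c2]]] := mvt z2 (fun x _ => C2_dx C x y l).
rewrite Gz => E.
have : Gx ((z, y), l) < Gx ((c, y), l).
  apply: (Gx_lt_of_Gxx_gt0 C) => // w hw.
  by have [|//] := Hl (w, y); rewrite norm_lt_pair/= !ltr_distl; lra.
by nra.
Unshelve. all: by end_near. Qed.

Lemma norm_flip_x p p0 : `|(- p.1, p.2) - (- p0.1, p0.2)| = `|p - p0|.
Proof. by rewrite !prod_normE/= -opprD normrN. Qed.

Lemma fold_branch G Gx Gy Gxx p0 l0 e : C2_family G Gx Gy Gxx ->
  G (p0, l0) = 0 -> Gx (p0, l0) = 0 -> Gxx (p0, l0) != 0 -> Gy (p0, l0) != 0 ->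
  0 < e ->
  exists2 d : R, 0 < d & \forall l \near l0, forall f y,
    `|f - p0| < d -> `|y - p0.2| < d -> G (f, l) = 0 -> Gx (f, l) = 0 ->
    Gxx (p0, l0) * (Gy (p0, l0) * (y - f.2)) < 0 ->
    exists x, [/\ `|x - p0.1| < e, G ((x, y), l) = 0 & Gx ((x, y), l) < 0].
Proof.
move=> C G0 Gx0 Gxx0 Gy0 e0.
rewrite neq_lt in Gxx0; have [{}Gxx0|{}Gxx0] := orP Gxx0; last first.
  have [d d0 Hd] := fold_branch_pos C G0 Gx0 Gxx0 Gy0 e0.
  exists d => //; apply: filterS Hd => l Hl f y fp yp Gf Gxf.
  by rewrite pmulr_rlt0//; exact: Hl.
have [||||//|d d0 Hd] := @fold_branch_pos _ _ _ _ (- p0.1, p0.2) l0 e (C2_family_flip_x C).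
- by rewrite /flip_x/= opprK -surjective_pairing G0 oppr0.
- by rewrite /flip_x/= opprK -surjective_pairing.
- by rewrite /flip_x/= opprK -surjective_pairing oppr_gt0.
- by rewrite /flip_x/= opprK -surjective_pairing oppr_eq0.
exists d => //; apply: filterS Hd => l Hl f y fp yp Gf Gxf.
rewrite nmulr_rlt0// => s.
have [|||||x []] := Hl (- f.1, f.2) y.
- by rewrite norm_flip_x.
- by [].
- by rewrite /flip_x/= opprK -surjective_pairing Gf oppr0.
- by rewrite /flip_x/= opprK -surjective_pairing.
- by rewrite /flip_x/= opprK -surjective_pairing mulNr oppr_lt0.
rewrite /flip_x/= => h1 /eqP h2 h3; exists (- x); split=> //.
  by rewrite -normrN opprD opprK.
by apply/eqP; rewrite -oppr_eq0.
Qed.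

End local_lemmas.

(** * Position and persistence of folds *)

Section folds.
Context {R : realType} {L : topologicalType}.
Implicit Types (G Gx Gy Gxx : (R * R) * L -> R) (p : R * R) (l : L) (a b x y e : R).

Let zero_side_pos G Gx Gy Gxx p0 l0 : C2_family G Gx Gy Gxx ->
  G (p0, l0) = 0 -> Gx (p0, l0) = 0 -> 0 < Gxx (p0, l0) -> Gy (p0, l0) != 0 ->
  exists2 d : R, 0 < d & forall p, `|p - p0| < d -> G (p, l0) = 0 -> p.2 != p0.2 ->
    Gy (p0, l0) * (p.2 - p0.2) < 0.
Proof.
case: p0 => x0 y0 /= C G0 Gx0 Gxx0 Gy0; set k := Gy _ in Gy0 *.
have /nbhs_box[d d0 Hd] : \forall q \near ((x0, y0), l0), 0 < Gxx q /\ 0 < Gy q * k.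
  have A1 : \forall q \near ((x0, y0), l0), 0 < Gxx q.
    by apply: near_pos => //; exact: C2_contGxx C _.
  have A2 : \forall q \near ((x0, y0), l0), 0 < Gy q * k.
    apply: near_pos; last by rewrite -expr2 exprn_even_gt0.
    by apply: continuousM; [exact: C2_contGy C _|exact: cvg_cst].
  exact: filterI A1 A2.
have Hl0 := nbhs_singleton Hd.
exists d => // -[x y]; rewrite norm_lt_pair/= !ltr_distl => -[hx hy] Gp ny.
have Gxy0 : 0 <= G ((x, y0), l0).
  have [->|nx] := eqVneq x x0; first by rewrite G0.
  apply/ltW/(G_gt0_near_fold C nx _ G0 Gx0) => z hz.
  have [|//] := Hl0 (z, y0); rewrite norm_lt_pair/= subrr normr0; split=> //.
  move: hz; rewrite ge_min le_max ltr_distl => /andP[/orP[]h1 /orP[]h2]; lra.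
have [y_lt|lt_y|E] := ltgtP y y0; last by move: ny; rewrite E eqxx.
  have [c [/andP[c1 c2]]] := mvt y_lt (fun y _ => C2_dy C x y l0).
  have [|_] := Hl0 (x, c); first by rewrite norm_lt_pair/= !ltr_distl; lra.
  rewrite Gp; set A := Gy _ => Ak E.
  have : 0 <= A by nra.
  by nra.
have [c [/andP[c1 c2]]] := mvt lt_y (fun y _ => C2_dy C x y l0).
have [|_] := Hl0 (x, c); first by rewrite norm_lt_pair/= !ltr_distl; lra.
rewrite Gp; set A := Gy _ => Ak E.
have : A <= 0 by nra.
by nra.
Qed.

(** Complements [fold_branch]: if [Gxx] > 0, then [G] >= 0 on the fibre of the fold, so a zero off
    that fibre can only lie where moving in y lowers [G]. This tells from which side a segment
    arrives. *)
Lemma zero_side G Gx Gy Gxx p0 l0 : C2_family G Gx Gy Gxx ->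
  G (p0, l0) = 0 -> Gx (p0, l0) = 0 -> Gxx (p0, l0) != 0 -> Gy (p0, l0) != 0 ->
  exists2 d : R, 0 < d & forall p, `|p - p0| < d -> G (p, l0) = 0 -> p.2 != p0.2 ->
    Gxx (p0, l0) * (Gy (p0, l0) * (p.2 - p0.2)) < 0.
Proof.
move=> C G0 Gx0 Gxx0 Gy0.
rewrite neq_lt in Gxx0; have [{}Gxx0|{}Gxx0] := orP Gxx0; last first.
  have [d d0 Hd] := zero_side_pos C G0 Gx0 Gxx0 Gy0.
  by exists d => // p h1 h2 h3; rewrite pmulr_rlt0//; exact: Hd.
have [||||d d0 Hd] := @zero_side_pos _ _ _ _ (- p0.1, p0.2) l0 (C2_family_flip_x C).
- by rewrite /flip_x/= opprK -surjective_pairing G0 oppr0.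
- by rewrite /flip_x/= opprK -surjective_pairing.
- by rewrite /flip_x/= opprK -surjective_pairing oppr_gt0.
- by rewrite /flip_x/= opprK -surjective_pairing oppr_eq0.
exists d => // p h1 h2 h3; rewrite nmulr_rlt0//.
have := Hd (- p.1, p.2); rewrite norm_flip_x /flip_x/= !opprK -!surjective_pairing h2 oppr0.
by rewrite mulNr oppr_lt0; apply.
Qed.

(* The perturbed fold is where y is maximal on {G <= 0} inside a small box. *)
Let fold_near_pos G Gx Gy Gxx p0 l0 e : C2_family G Gx Gy Gxx ->
  G (p0, l0) = 0 -> Gx (p0, l0) = 0 -> 0 < Gxx (p0, l0) -> 0 < Gy (p0, l0) -> 0 < e ->
  \forall l \near l0, exists p, [/\ `|p - p0| < e, G (p, l) = 0 & Gx (p, l) = 0].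
Proof.
case: p0 => x0 y0 /= C G0 Gx0 Gxx0 Gy0 e0.
have /nbhs_box[d d0 Hd] : \forall q \near ((x0, y0), l0), 0 < Gxx q /\ 0 < Gy q.
  have A1 : \forall q \near ((x0, y0), l0), 0 < Gxx q.
    by apply: near_pos => //; exact: C2_contGxx C _.
  have A2 : \forall q \near ((x0, y0), l0), 0 < Gy q.
    by apply: near_pos => //; exact: C2_contGy C _.
  exact: filterI A1 A2.
pose r := Num.min d e / 2.
have m0 : 0 < Num.min d e by rewrite lt_min d0 e0.
have r0 : 0 < r by rewrite divr_gt0.
have [rd re] : r < d /\ r < e.
  have : Num.min d e <= d /\ Num.min d e <= e by rewrite !ge_min !lexx orbT.
  by rewrite /r; lra.
have {}Hd := nbhs_singleton Hd.
have cG := C2_contG C.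
have pos0 x : `|x - x0| < d -> x != x0 -> 0 < G ((x, y0), l0).
  rewrite ltr_distl => hx nx.
  apply: (G_gt0_near_fold C nx _ G0 Gx0) => z hz.
  have [|//] := Hd (z, y0); rewrite norm_lt_pair/= subrr normr0; split=> //.
  move: hz; rewrite ge_min le_max ltr_distl => /andP[/orP[]h1 /orP[]h2]; lra.
have Ga : 0 < G ((x0 - r, y0), l0).
  by apply: pos0; [rewrite ltr_distl; lra|rewrite lt_eqF// gtrBl].
have Gb : 0 < G ((x0 + r, y0), l0).
  by apply: pos0; [rewrite ltr_distl; lra|rewrite gt_eqF// ltrDl].
have Nab : \forall q \near (y0, l0),
    0 < G ((x0 - r, q.1), q.2) /\ 0 < G ((x0 + r, q.1), q.2).
  have Na : \forall q \near (y0, l0), 0 < G ((x0 - r, q.1), q.2).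
    by apply: near_pos => //; exact: C2_along_yl.
  have Nb : \forall q \near (y0, l0), 0 < G ((x0 + r, q.1), q.2).
    by apply: near_pos => //; exact: C2_along_yl.
  exact: filterI Na Nb.
have [d1 d10 Hd1] := nbhs_box Nab.
pose h := Num.min r d1 / 2.
have hm0 : 0 < Num.min r d1 by rewrite lt_min r0 d10.
have h0 : 0 < h by rewrite divr_gt0.
have [hr hd1] : h < r /\ h < d1.
  have : Num.min r d1 <= r /\ Num.min r d1 <= d1 by rewrite !ge_min !lexx orbT.
  by rewrite /h; lra.
(* The lateral sides (as h < d1) and the top of the box lie in {G > 0}, while [bot] makes {G <= 0}
   nonempty; the highest point of {G <= 0} is therefore on none of these three sides. *)
have top : \forall l \near l0, forall x, x0 - r <= x <= x0 + r ->
    0 < G ((x, y0 + h), l).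
  apply: (@segment_near _ _ _ _ _ (fun x l => 0 < G ((x, y0 + h), l))) => x hx /=.
  apply: near_pos; first exact: (@continuous_of_for _ _ _ G
    (fun q : R * L => ((q.1, y0 + h), q.2)) _ cG ltac:(by solve_continuous)).
  have Gx0' : 0 <= G ((x, y0), l0).
    have [->|nx] := eqVneq x x0; first by rewrite G0.
    by apply/ltW/pos0 => //; rewrite ltr_distl; lra.
  have yh : y0 < y0 + h by lra.
  have [c [/andP[c1 c2]]] := mvt yh (fun y _ => C2_dy C x y l0).
  have [|_] := Hd (x, c); first by rewrite norm_lt_pair/= !ltr_distl; lra.
  by rewrite /=; nra.
have bot : \forall l \near l0, G ((x0, y0 - h), l) < 0.
  have B : \forall q \near ((x0, y0 - h), l0), G q < 0.
    apply: near_neg; first exact: cG.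
    have yh : y0 - h < y0 by lra.
    have [c [/andP[c1 c2]]] := mvt yh (fun y _ => C2_dy C x0 y l0).
    have [|_] := Hd (x0, c); first by rewrite norm_lt_pair/= !ltr_distl; lra.
    by rewrite /= G0; nra.
  have [d2 d20 Hd2] := nbhs_box B.
  by apply: filterS Hd2 => l; apply; rewrite subrr normr0.
near=> l.
have topl : forall x, x0 - r <= x <= x0 + r -> 0 < G ((x, y0 + h), l) by near: l.
have botl : G ((x0, y0 - h), l) < 0 by near: l.
have Hd1l : forall y, `|y - y0| < d1 ->
    0 < G ((x0 - r, y), l) /\ 0 < G ((x0 + r, y), l) by near: l.
have cGl : continuous (fun p : R * R => G (p, l)).
  by move=> p; apply: (@continuous_of_for _ _ _ G (fun p => (p, l))) => //; solve_continuous.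
pose K : set (R * R) := (`[x0 - r, x0 + r] `*` `[y0 - h, y0 + h]) `&`
  [set p | G (p, l) <= 0].
have K0 : K !=set0.
  exists (x0, y0 - h); split; last exact: ltW botl.
  by split; rewrite /= in_itv/=; lra.
have cK : compact K.
  apply: compact_closedI.
    by apply: compact_setX; exact: segment_compact.
  exact: (closed_comp (fun p _ => cGl p) (@closed_le R 0)).
have [|[xs ys] /[!inE]-[[/=]]] := compact_EVT_max (f := snd) K0 cK.
  by apply: continuous_subspaceT => p; exact: cvg_snd.
rewrite !in_itv/= => hxs hys Gs maxi.
have ysh : ys < y0 + h.
  rewrite lt_neqAle; case/andP: (hys) => _ ->; rewrite andbT.
  by apply/eqP => E; have := topl _ hxs; rewrite -E ltNge Gs.
(* A negative value on the fibre of the highest point would survive a small increase of y, against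
   maximality. So [xs] is an interior minimum of [G] on its fibre, with value 0, and [Gx] vanishes
   there. *)
have ge0 x : x0 - r <= x <= x0 + r -> 0 <= G ((x, ys), l).
  move=> hx; rewrite leNgt; apply/negP => Gneg.
  have : \forall y \near ys, G ((x, y), l) < 0.
    by apply: near_neg => //; exact: C2_along_y.
  move=> /nbhs_ballP[d3 /= d30 Hd3].
  pose y := ys + Num.min (d3 / 2) (y0 + h - ys).
  have my : 0 < Num.min (d3 / 2) (y0 + h - ys).
    by rewrite lt_min divr_gt0//= subr_gt0.
  have [m1 m2] : Num.min (d3 / 2) (y0 + h - ys) <= d3 / 2 /\
      Num.min (d3 / 2) (y0 + h - ys) <= y0 + h - ys.
    by rewrite !ge_min !lexx orbT.
  have := maxi (x, y); rewrite inE /=.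
  have -> : (y <= ys) = false by apply/negbTE; rewrite -ltNge /y ltrDl.
  suff h' : K (x, y) by move=> /(_ h').
  split; first by split; rewrite /= in_itv/= /y; lra.
  apply/ltW/Hd3; rewrite -ball_normE /ball_/= /y opprD addNKr normrN gtr0_norm//; lra.
have Gs0 : G ((xs, ys), l) = 0 by apply/le_anti; rewrite Gs ge0.
have hys1 : `|ys - y0| < d1 by rewrite ltr_distl; lra.
have [ga gb] := Hd1l _ hys1.
have xs_int : x0 - r < xs < x0 + r.
  by rewrite !lt_neqAle; case/andP: (hxs) => -> ->; rewrite !andbT; apply/andP; split;
    apply/eqP => E; [move: ga; rewrite E|move: gb; rewrite -E]; rewrite Gs0 ltxx.
exists (xs, ys); split=> //; first by rewrite norm_lt_pair/= !ltr_distl; lra.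
have ab : x0 - r <= x0 + r by lra.
have := @derive1_at_min R (fun x => G ((x, ys), l)) (x0 - r) (x0 + r) xs ab.
case.
- by move=> t _; case: (C2_dx C t ys l).
- by rewrite in_itv.
- by move=> t /[!in_itv]/= /andP[t1 t2]; rewrite Gs0; apply: ge0; rewrite !ltW.
by case: (C2_dx C xs ys l) => _ <-.
Unshelve. all: by end_near. Qed.

Lemma norm_flip_y p p0 : `|(p.1, - p.2) - (p0.1, - p0.2)| = `|p - p0|.
Proof. by rewrite !prod_normE/= -[- p.2 - _]opprD normrN. Qed.

Lemma fold_near G Gx Gy Gxx p0 l0 e : C2_family G Gx Gy Gxx ->
  G (p0, l0) = 0 -> Gx (p0, l0) = 0 -> Gxx (p0, l0) != 0 -> Gy (p0, l0) != 0 -> 0 < e ->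
  \forall l \near l0, exists p, [/\ `|p - p0| < e, G (p, l) = 0 & Gx (p, l) = 0].
Proof.
have W G' Gx' Gy' Gxx' p1 : C2_family G' Gx' Gy' Gxx' ->
  G' (p1, l0) = 0 -> Gx' (p1, l0) = 0 -> 0 < Gxx' (p1, l0) -> Gy' (p1, l0) != 0 -> 0 < e ->
  \forall l \near l0, exists p, [/\ `|p - p1| < e, G' (p, l) = 0 & Gx' (p, l) = 0].
  move=> C G0 Gx0 Gxx0 Gy0 e0.
  rewrite neq_lt in Gy0; have [{}Gy0|{}Gy0] := orP Gy0; last first.
    exact: fold_near_pos C G0 Gx0 Gxx0 Gy0 e0.
  have := @fold_near_pos _ _ _ _ (p1.1, - p1.2) l0 e (C2_family_flip_y C).
  rewrite /flip_y/= opprK -!surjective_pairing oppr_gt0.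
  move=> /(_ G0 Gx0 Gxx0 Gy0 e0); apply: filterS => l [p [h1 h2 h3]].
  exists (p.1, - p.2); split=> //.
  by rewrite -norm_flip_y/= opprK -surjective_pairing.
move=> C G0 Gx0 Gxx0 Gy0 e0.
rewrite neq_lt in Gxx0; have [{}Gxx0|{}Gxx0] := orP Gxx0; last first.
  exact: W C G0 Gx0 Gxx0 Gy0 e0.
have := @W _ _ _ _ (- p0.1, p0.2) (C2_family_flip_x C).
rewrite /flip_x/= opprK -!surjective_pairing oppr_gt0 oppr_eq0 G0 oppr0.
move=> /(_ erefl Gx0 Gxx0 Gy0 e0); apply: filterS => l [p [h1 h2 h3]].
exists (- p.1, p.2); split=> //.
  by rewrite -norm_flip_x/= opprK -surjective_pairing.
by apply/eqP; rewrite -oppr_eq0 h2.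
Qed.

End folds.

(** * Uniqueness of the fold on its fibre, and signs along a jump *)

Section fold_fibres.
Context {R : realType} {L : topologicalType}.
Implicit Types (G Gx Gy Gxx : (R * R) * L -> R) (p : R * R) (l : L) (a b x y e : R).

(** Away from [p0] the fibre carries no common zero of [G] and [Gx], which persists by compactness;
    close to [p0], [Gx] is strictly monotone in x. *)
Lemma fold_fibre_unique G Gx Gy Gxx p0 l0 a b : C2_family G Gx Gy Gxx ->
  Gxx (p0, l0) != 0 ->
  (forall x, a <= x <= b -> G ((x, p0.2), l0) = 0 -> Gx ((x, p0.2), l0) = 0 -> x = p0.1) ->
  exists2 d : R, 0 < d & \forall l \near l0, forall f x, `|f - p0| < d ->
    a <= x <= b -> G (f, l) = 0 -> Gx (f, l) = 0 ->
    G ((x, f.2), l) = 0 -> Gx ((x, f.2), l) = 0 -> x = f.1.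
Proof.
case: p0 => x0 y0 /= C Gxx0 uniq.
have cG := C2_contG C; have cGx := C2_contGx C.
have [d d0 Hd] : exists2 d : R, 0 < d & \forall l \near l0, forall p,
    `|p - (x0, y0)| < d -> Gxx (p, l) != 0.
  apply: (@nbhs_box _ _ _ (fun q => Gxx q != 0)); rewrite neq_lt in Gxx0; have [h|h] := orP Gxx0.
    have : \forall q \near ((x0, y0), l0), Gxx q < 0.
      by apply: near_neg => //; exact: C2_contGxx C _.
    by apply: filterS => q /lt_eqF ->.
  have : \forall q \near ((x0, y0), l0), 0 < Gxx q.
    by apply: near_pos => //; exact: C2_contGxx C _.
  by apply: filterS => q /gt_eqF ->.
have : \forall q \near (y0, l0), forall x, a <= x <= b ->
    G ((x, q.1), q.2) = 0 -> Gx ((x, q.1), q.2) = 0 -> `|x - x0| < d.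
  apply: (@segment_near _ _ _ _ _ (fun x (q : R * L) =>
    G ((x, q.1), q.2) = 0 -> Gx ((x, q.1), q.2) = 0 -> `|x - x0| < d)) => x hx.
  have [E|nx] := eqVneq x x0.
    have : \forall z \near x, `|z - x0| < d.
      apply/nbhs_ballP; exists d => //= z.
      by rewrite E -ball_normE /ball_/= distrC.
    move=> Nx; near=> q => _ _; near: q.
    by exists ([set z | `|z - x0| < d], setT) => //=; [split=> //; exact: filterT|case=> z t []].
  have [g0|g0] := eqVneq (G ((x, y0), l0)) 0; last first.
    have : \forall q \near (x, (y0, l0)), G ((q.1, q.2.1), q.2.2) != 0.
      rewrite neq_lt in g0; have [h|h] := orP g0.
        have : \forall q \near (x, (y0, l0)), G ((q.1, q.2.1), q.2.2) < 0.
          by apply: near_neg => //; exact: C2_reassoc.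
        by apply: filterS => q /lt_eqF ->.
      have : \forall q \near (x, (y0, l0)), 0 < G ((q.1, q.2.1), q.2.2).
        by apply: near_pos => //; exact: C2_reassoc.
      by apply: filterS => q /gt_eqF ->.
    by apply: filterS => q /eqP.
  have {}g0 : Gx ((x, y0), l0) != 0.
    by apply/eqP => g1; move/eqP: nx; apply; exact: uniq.
  have : \forall q \near (x, (y0, l0)), Gx ((q.1, q.2.1), q.2.2) != 0.
    rewrite neq_lt in g0; have [h|h] := orP g0.
      have : \forall q \near (x, (y0, l0)), Gx ((q.1, q.2.1), q.2.2) < 0.
        by apply: near_neg => //; exact: C2_reassoc.
      by apply: filterS => q /lt_eqF ->.
    have : \forall q \near (x, (y0, l0)), 0 < Gx ((q.1, q.2.1), q.2.2).
      by apply: near_pos => //; exact: C2_reassoc.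
    by apply: filterS => q /gt_eqF ->.
  by apply: filterS => q /eqP.
move=> /nbhs_box[d1 d10 Hd1].
exists (Num.min d d1); first by rewrite lt_min d0.
near=> l => -[f1 f2] x; rewrite norm_lt_pair !lt_min/= => -[/andP[f1d _] /andP[f2d f2d1]] hx g1 g2 g3 g4.
have Hdl : forall p, `|p - (x0, y0)| < d -> Gxx (p, l) != 0 by near: l.
have xd : `|x - x0| < d.
  suff H : forall y, `|y - y0| < d1 -> forall x, a <= x <= b ->
    G ((x, y), l) = 0 -> Gx ((x, y), l) = 0 -> `|x - x0| < d by exact: (H f2).
  by near: l.
rewrite !ltr_distl in f1d xd.
have [x_lt|lt_x|//] := ltgtP x f1.
  have [c [/andP[c1 c2]]] := mvt x_lt (fun x _ => C2_dxx C x f2 l).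
  have := Hdl (c, f2); rewrite norm_lt_pair/= !ltr_distl => H.
  rewrite g2 g4 subrr => /esym/eqP; rewrite mulf_eq0 subr_eq0 (gt_eqF x_lt) orbF.
  by rewrite (negbTE (H _))//; rewrite ltr_distl in f2d; lra.
have [c [/andP[c1 c2]]] := mvt lt_x (fun x _ => C2_dxx C x f2 l).
have := Hdl (c, f2); rewrite norm_lt_pair/= !ltr_distl => H.
rewrite g2 g4 subrr => /esym/eqP; rewrite mulf_eq0 subr_eq0 (gt_eqF lt_x) orbF.
by rewrite (negbTE (H _))//; rewrite ltr_distl in f2d; lra.
Unshelve. all: by end_near. Qed.


(** Three zones: next to the fold [G] > 0 by convexity around the perturbed fold; next to the
    landing point because [G] vanishes there and [Gx] < 0; on the segment in between by
    compactness. *)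
Let jump_sign_incr G Gx Gy Gxx p0 x1 l0 : C2_family G Gx Gy Gxx -> p0.1 < x1 ->
  G (p0, l0) = 0 -> Gx (p0, l0) = 0 -> Gxx (p0, l0) != 0 ->
  Gx ((x1, p0.2), l0) < 0 ->
  (forall x, p0.1 < x < x1 -> 0 < G ((x, p0.2), l0)) ->
  exists2 d : R, 0 < d & \forall l \near l0, forall f x1', `|f - p0| < d ->
    `|x1' - x1| < d -> G (f, l) = 0 -> Gx (f, l) = 0 -> G ((x1', f.2), l) = 0 ->
    f.1 < x1' /\ forall x, f.1 < x < x1' -> 0 < G ((x, f.2), l).
Proof.
case: p0 => x0 y0 /= C x01 G0 Gx0 Gxx0 Gx1 btw.
have cG := C2_contG C.
(* Otherwise [G] would be concave at the fold and negative just to its right, where it is assumed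
   positive. *)
have {}Gxx0 : 0 < Gxx ((x0, y0), l0).
  have [//|Gneg|E] := ltgtP 0 (Gxx ((x0, y0), l0)); last by rewrite -E eqxx in Gxx0.
  have /nbhs_box[d d0 /nbhs_singleton Hd] : \forall q \near ((x0, y0), l0), Gxx q < 0.
    by apply: near_neg => //; exact: C2_contGxx C _.
  pose x := Num.min (x0 + d / 2) ((x0 + x1) / 2).
  have [m1 m2] : x <= x0 + d / 2 /\ x <= (x0 + x1) / 2.
    by rewrite !ge_min !lexx orbT.
  have xx0 : x0 < x by rewrite lt_min; apply/andP; split; lra.
  have := btw x; rewrite xx0 (le_lt_trans m2); last by lra.
  move=> /(_ isT); have [c [/andP[c1 c2]]] := mvt xx0 (fun x _ => C2_dx C x y0 l0).
  rewrite G0 => E.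
  have [e [/andP[e1 e2]]] := mvt c1 (fun x _ => C2_dxx C x y0 l0).
  rewrite Gx0 => E'.
  have : Gxx ((e, y0), l0) < 0.
    by apply: Hd; rewrite norm_lt_pair/= !ltr_distl; lra.
  move=> Gxxe; have : Gx ((c, y0), l0) < 0 by nra.
  by nra.
have /nbhs_box[d d0 Hd] : \forall q \near ((x0, y0), l0), 0 < Gxx q.
  by apply: near_pos => //; exact: C2_contGxx C _.
have /nbhs_box[d1 d10 Hd1] : \forall q \near ((x1, y0), l0), Gx q < 0.
  by apply: near_neg => //; exact: C2_contGx C _.
pose m := Num.min (Num.min d d1) (x1 - x0).
have m0 : 0 < m by rewrite !lt_min d0 d10 subr_gt0.
have [[md md1] mx] : (m <= d /\ m <= d1) /\ m <= x1 - x0.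
  by rewrite /m !ge_min !lexx !orbT.
(* A third leaves room for all three zones after each end has moved by less than r/2. *)
pose r := m / 3.
have r0 : 0 < r by rewrite divr_gt0.
have rE : r * 3 = m by rewrite /r; field.
have : \forall q \near (y0, l0), forall x, x0 + r <= x <= x1 - r ->
    0 < G ((x, q.1), q.2).
  apply: (@segment_near _ _ _ _ _ (fun x (q : R * L) => 0 < G ((x, q.1), q.2))) => x hx.
  apply: near_pos; first exact: (C2_reassoc cG).
  by apply: btw => /=; lra.
move=> /nbhs_box[d2 d20 Hd2].
pose s := Num.min (Num.min (r / 2) d2) d.
have [[s1 s2] s3] : (s <= r / 2 /\ s <= d2) /\ s <= d.
  by rewrite /s !ge_min !lexx !orbT.
exists s; first by rewrite !lt_min divr_gt0 ?r0 ?d20.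
near=> l => -[f1 f2] x1'; rewrite norm_lt_pair/= !ltr_distl.
move=> [hf1 hf2] hx1 Gf Gxf Gx1'.
have Hdl : forall p, `|p - (x0, y0)| < d -> 0 < Gxx (p, l) by near: l.
have Hd1l : forall p, `|p - (x1, y0)| < d1 -> Gx (p, l) < 0 by near: l.
have Hd2l : forall y, `|y - y0| < d2 -> forall x, x0 + r <= x <= x1 - r ->
  0 < G ((x, y), l) by near: l.
split; first by lra.
move=> x /andP[xf xx1].
have [xl|xl] := leP x (x0 + r).
  apply: (G_gt0_near_fold C _ _ Gf Gxf); first by rewrite gt_eqF.
  move=> z; rewrite min_l ?max_r ?(ltW xf)// => hz.
  by apply: Hdl; rewrite norm_lt_pair/= !ltr_distl; lra.
have [xr|xr] := leP x (x1 - r).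
  by apply: Hd2l; [rewrite ltr_distl; lra|rewrite (ltW xl)].
have [c [/andP[c1 c2]]] := mvt xx1 (fun x _ => C2_dx C x f2 l).
have : Gx ((c, f2), l) < 0.
  by apply: Hd1l; rewrite norm_lt_pair/= !ltr_distl; lra.
by rewrite Gx1'; nra.
Unshelve. all: by end_near. Qed.

Lemma jump_sign G Gx Gy Gxx p0 x1 l0 : C2_family G Gx Gy Gxx -> p0.1 != x1 ->
  G (p0, l0) = 0 -> Gx (p0, l0) = 0 -> Gxx (p0, l0) != 0 ->
  Gx ((x1, p0.2), l0) < 0 ->
  (forall x, (x - p0.1) * (x - x1) < 0 -> 0 < (x1 - p0.1) * G ((x, p0.2), l0)) ->
  exists2 d : R, 0 < d & \forall l \near l0, forall f x1', `|f - p0| < d ->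
    `|x1' - x1| < d -> G (f, l) = 0 -> Gx (f, l) = 0 -> G ((x1', f.2), l) = 0 ->
    f.1 != x1' /\
    forall x, (x - f.1) * (x - x1') < 0 -> 0 < (x1' - f.1) * G ((x, f.2), l).
Proof.
move=> C; rewrite neq_lt => /orP[ab|ba] G0 Gx0 Gxx0 Gx1 btw.
  have [|d d0 Hd] := jump_sign_incr C ab G0 Gx0 Gxx0 Gx1.
    move=> x hx; have := btw x; rewrite pmulr_rgt0 ?subr_gt0//; apply.
    by rewrite nmulr_llt0 ?subr_gt0 ?subr_lt0; lra.
  exists d => //; apply: filterS Hd => l Hl f x1' hf hx1 h1 h2 h3.
  have [fx pos] := Hl _ _ hf hx1 h1 h2 h3; split; first by rewrite lt_eqF.
  move=> x hx; rewrite pmulr_rgt0 ?subr_gt0//; apply: pos.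
  by apply/andP; split; rewrite ltNge; apply/negP => hh; nra.
have [||||||d d0 Hd] := @jump_sign_incr _ _ _ _ (- p0.1, p0.2) (- x1) l0
    (C2_family_flip_x C).
- by rewrite /= ltrN2.
- by rewrite /flip_x/= opprK -surjective_pairing G0 oppr0.
- by rewrite /flip_x/= opprK -surjective_pairing.
- by rewrite /flip_x/= opprK -surjective_pairing oppr_eq0.
- by rewrite /flip_x/= opprK.
- move=> x /= hx; have := btw (- x); rewrite /flip_x/= nmulr_rgt0 ?subr_lt0// oppr_gt0.
  by apply; nra.
exists d => //; apply: filterS Hd => l Hl f x1' hf hx1 h1 h2 h3.
have [|||||fx pos] := Hl (- f.1, f.2) (- x1').
- by rewrite norm_flip_x.
- by rewrite -opprD normrN.
- by rewrite /flip_x/= opprK -surjective_pairing h1 oppr0.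
- by rewrite /flip_x/= opprK -surjective_pairing.
- by rewrite /flip_x/= opprK h3 oppr0.
move: fx pos => /=; rewrite ltrN2 => fx pos.
split; first by rewrite gt_eqF.
move=> x hx; have := pos (- x); rewrite /flip_x/= opprK nmulr_rgt0 ?subr_lt0// oppr_gt0; apply.
by rewrite !ltrN2; apply/andP; split; rewrite ltNge; apply/negP => hh; nra.
Qed.

End fold_fibres.

(** * Slow and fast flows *)

Section curves.
Context {R : realType}.

(** The projection of the line onto [a, b]; composing with it turns a curve continuous within the
    segment into one continuous on the whole line. *)
Definition clamp (a b t : R) : R := Num.max a (Num.min t b).

Lemma clamp_id a b t : a <= t <= b -> clamp a b t = t.
Proof. by move=> /andP[h1 h2]; rewrite /clamp min_l// max_r. Qed.

Lemma clamp_btw a b t : a <= b -> a <= clamp a b t <= b.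
Proof. by move=> ab; rewrite /clamp le_max lexx ge_max ab ge_min lexx orbT. Qed.

Lemma continuous_clamp a b : continuous (clamp a b).
Proof.
move=> t; apply: (@continuous_max R _ (fun=> a) (fun t : R => Num.min t b)).
  exact: cvg_cst.
by apply: (@continuous_min R _ id (fun=> b)); [exact: cvg_id|exact: cvg_cst].
Qed.

Lemma continuous_comp_clamp (T : topologicalType) (f : R -> T) a b : a <= b ->
  {within `[a, b], continuous f} -> continuous (fun t => f (clamp a b t)).
Proof.
move=> ab fc t.
have ct s : `[a, b]%classic (clamp a b s) by rewrite /= in_itv/= clamp_btw.
have cf : f @ within `[a, b] (nbhs (clamp a b t)) --> f (clamp a b t).
  by rewrite nbhs_subspace_in//; exact: (fc (clamp a b t)).
apply: (cvg_comp _ _ _ cf) => A wA.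
have : \forall s \near nbhs t, `[a, b]%classic (clamp a b s) -> A (clamp a b s).
  exact: (@continuous_clamp a b t _ wA).
by apply: filterS => s; apply.
Qed.

(** At the time [m] where |y - y t0| is largest, the mean value theorem bounds that maximum by C (b
    - a) times itself; as C (b - a) < 1, it is zero. *)
Lemma rest_local (y dy : R -> R) (a b t0 C : R) : a <= t0 <= b -> 0 <= C ->
  (b - a) * C < 1 -> {within `[a, b], continuous y} ->
  (forall t, a < t < b -> is_derive t (1 : R) y (dy t)) ->
  (forall t, a < t < b -> `|dy t| <= C * `|y t - y t0|) ->
  forall t, a <= t <= b -> y t = y t0.
Proof.
move=> /andP[at0 t0b] C0 small yc yd dyb.
have ab := le_trans at0 t0b.
have yc' : {within `[a, b], continuous (fun t => `|y t - y t0|)}.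
  move=> t; apply: (@continuous_comp (subspace `[a, b]) _ _ (fun t => y t - y t0) Num.norm);
    last exact: norm_continuous.
  by apply: cvgB; [exact: yc|exact: cvg_cst].
have [m mab mmax] := EVT_max ab yc'.
have key s t : a <= s -> s < t -> t <= b -> `|y t - y s| <= C * `|y m - y t0| * (b - a).
  move=> as_ st tb.
  have [||c] := @MVT R y dy s t st.
  - by move=> z /[!in_itv]/= /andP[sz zt]; apply: yd; rewrite (le_lt_trans as_ sz) (lt_le_trans zt tb).
  - apply: continuous_subspaceW yc => z /=; rewrite !in_itv/= => /andP[sz zt].
    by rewrite (le_trans as_ sz) (le_trans zt tb).
  rewrite in_itv/= => /andP[sc ct] ->; rewrite normrM.
  have ac : a < c < b by rewrite (le_lt_trans as_ sc) (lt_le_trans ct tb).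
  apply: ler_pM => //.
    apply: (le_trans (dyb _ ac)); rewrite ler_wpM2l//; apply: mmax.
    by rewrite in_itv/= !ltW//; case/andP: ac.
  by rewrite gtr0_norm ?subr_gt0//; lra.
have M0 : `|y m - y t0| = 0.
  move: mab; rewrite in_itv/= => /andP[am mb].
  have : `|y m - y t0| <= C * `|y m - y t0| * (b - a).
    have [mt|tm|<-] := ltgtP m t0; first by rewrite {1}distrC; apply: key.
      exact: key.
    by rewrite subrr normr0 mulr0 mul0r.
  by have := normr_ge0 (y m - y t0); nra.
move=> t tab; apply/eqP; rewrite -subr_eq0 -normr_le0 -M0; apply: mmax.
by rewrite in_itv.
Qed.

(** The set where c takes the value [c t0] is open by the last hypothesis and closed because T is
    Hausdorff; the segment is connected. *)
Lemma locally_constant_segment (T : topologicalType) (c : R -> T) (a b t0 : R) :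
  hausdorff_space T -> {within `[a, b], continuous c} -> a <= t0 <= b ->
  (forall t1, a <= t1 <= b -> c t1 = c t0 ->
    exists2 e : R, 0 < e & forall t, a <= t <= b -> `|t - t1| < e -> c t = c t0) ->
  forall t, a <= t <= b -> c t = c t0.
Proof.
move=> hT cc t0ab loc.
have ab : a <= b by case/andP: t0ab; exact: le_trans.
have ccl := continuous_comp_clamp ab cc.
pose A : set R := `[a, b]%classic.
have AE t : A t <-> a <= t <= b by rewrite /A /= in_itv.
pose B := [set t | A t /\ c t = c t0].
suff BA : B = A.
  by move=> t /AE At; have [] : B t by rewrite BA.
apply: (@segment_connected R a b).
- by exists t0; split=> //; exact/AE.
- exists (interior [set t | A t -> c t = c t0]); first exact: open_interior.
  apply/seteqP; split=> t.
    move=> [At ct]; split=> //.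
    have [e e0 He] := loc t (iffLR (AE t) At) ct.
    apply/nbhs_ballP; exists e => //= s; rewrite -ball_normE /ball_/= distrC => st As.
    by apply: He => //; exact/AE.
  by move=> [At /interior_subset /(_ At)].
- exists ((fun t => c (clamp a b t)) @^-1` [set c t0]).
    apply: closed_comp => [t _|]; first exact: ccl.
    exact/accessible_closed_set1/hausdorff_accessible.
  apply/seteqP; split=> t; rewrite /B /=.
    by move=> [At ct]; split=> //; rewrite clamp_id//; exact/AE.
  by move=> [At]; rewrite clamp_id//; exact/AE.
Qed.

End curves.

(** * Rest points of the fast and of the slow flow *)

Section equilibria.
Context {R : realType}.

(** Near its zero z, u is bounded by C |x - z|, so [rest_local] applies on short intervals around
    each time at which phi = z, and connectedness spreads the conclusion. *)
Lemma ode_equilibrium (u du phi : R -> R) (t0 : R) : continuous du ->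
  (forall x, is_derive x (1 : R) u (du x)) ->
  (forall t, is_derive t (1 : R) phi (u (phi t))) ->
  u (phi t0) = 0 -> forall t, phi t = phi t0.
Proof.
move=> duc ud phid uz t; set z := phi t0 in uz *.
have phic : continuous phi by move=> s; exact: is_derive_continuous (phid s).
pose C := `|du z| + 1.
have C0 : 0 < C by rewrite ltr_wpDl.
have [r r0 Hr] : exists2 r : R, 0 < r & forall x, `|x - z| < r -> `|u x| <= C * `|x - z|.
  have : \forall x \near z, `|du x| < C.
    have nc : {for z, continuous (fun x => `|du x|)}.
      by apply: continuous_comp; [exact: duc|exact: norm_continuous].
    by apply: (cvgr_lt _ nc); rewrite /C ltrDl.
  move=> /nbhs_ballP[r /= r0 Hr]; exists r => // x xr.
  have dub c : `|c - z| < r -> `|du c| <= C.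
    by move=> cz; apply/ltW/Hr; rewrite -ball_normE /ball_/= distrC.
  rewrite ltr_distl in xr.
  have [xz|zx|->] := ltgtP x z; last by rewrite uz subrr normr0 mulr0.
    have [c [/andP[c1 c2]]] := mvt xz (fun x _ => ud x).
    rewrite uz sub0r -normrN => ->; rewrite normrM (distrC x); apply: ler_wpM2r => //.
    by apply: dub; rewrite ltr_distl; lra.
  have [c [/andP[c1 c2]]] := mvt zx (fun x _ => ud x).
  rewrite uz subr0 => ->; rewrite normrM; apply: ler_wpM2r => //.
  by apply: dub; rewrite ltr_distl; lra.
pose a := Num.min t t0; pose b := Num.max t t0.
have tab : a <= t <= b by rewrite ge_min le_max lexx.
have t0ab : a <= t0 <= b by rewrite ge_min le_max lexx !orbT.
apply: (@locally_constant_segment R _ phi a b t0) => //.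
  exact: continuous_subspaceT.
move=> t1 t1ab t1z.
have : \forall s \near t1, `|phi s - z| < r.
  have /cvgrPdist_lt /(_ r r0) := phic t1.
  by rewrite t1z; apply: filterS => s; rewrite distrC.
move=> /nbhs_ballP[e /= e0 He].
(* The interval [t1 - f, t1 + f] has length at most 1/(2 C), which meets the smallness condition of
   [rest_local], and phi stays within r of z on it. *)
pose f := Num.min (e / 2) ((4 * C)^-1).
have f0 : 0 < f by rewrite lt_min divr_gt0//= invr_gt0 mulr_gt0.
have [fe fC] : f <= e / 2 /\ f <= (4 * C)^-1 by rewrite !ge_min !lexx orbT.
exists f => // s _ st; rewrite ltr_distl in st.
rewrite -t1z; apply: (@rest_local R phi (fun t => u (phi t)) (t1 - f) (t1 + f) t1 C) => //.
- lra.
- exact: ltW.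
- have : f * C <= 1 / 4.
    by rewrite -ler_pdivlMr// mul1r -invfM.
  by nra.
- exact: continuous_subspaceT.
- move=> v hv; rewrite t1z; apply: Hr; apply: He.
  by rewrite -ball_normE /ball_/= distrC ltr_distl; lra.
- lra.
Qed.

Record C1_plane (f fx fy : R * R -> R) : Prop := {
  C1_contx : continuous fx;
  C1_conty : continuous fy;
  C1_dx : forall x y, is_derive x (1 : R) (fun u => f (u, y)) (fx (x, y));
  C1_dy : forall x y, is_derive y (1 : R) (fun v => f (x, v)) (fy (x, y)) }.

Lemma segment_mvt (f df : R -> R) (a b : R) :
  (forall x, is_derive x (1 : R) f (df x)) ->
  exists2 c, Num.min a b <= c <= Num.max a b & f b - f a = df c * (b - a).
Proof.
move=> fd; have [ab|ba|->] := ltgtP a b.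
- have [c [/andP[c1 c2] E]] := mvt ab (fun x _ => fd x).
  by exists c => //; rewrite !ltW.
- have [c [/andP[c1 c2] E]] := mvt ba (fun x _ => fd x).
  by exists c; [rewrite !ltW|lra].
- by exists b; [rewrite lexx|rewrite !subrr mulr0].
Qed.

Lemma minmax_btw (a b x y c : R) : a <= x <= b -> a <= y <= b ->
  Num.min x y <= c <= Num.max x y -> a <= c <= b.
Proof.
move=> /andP[h1 h2] /andP[h3 h4]; rewrite ge_min le_max.
by move=> /andP[/orP[]h5 /orP[]h6]; lra.
Qed.

(** The increment is taken along the path q, (q.1, p.2), p, whose corner stays in any box containing
    p and q. *)
Lemma C1_increment f fx fy (p q : R * R) : C1_plane f fx fy ->
  exists c d, [/\ Num.min q.1 p.1 <= c <= Num.max q.1 p.1,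
    Num.min q.2 p.2 <= d <= Num.max q.2 p.2 &
    f p - f q = fx (c, p.2) * (p.1 - q.1) + fy (q.1, d) * (p.2 - q.2)].
Proof.
case: p q => p1 p2 [q1 q2] C /=.
have [c hc E1] := segment_mvt q1 p1 (fun x => C1_dx C x p2).
have [d hd E2] := segment_mvt q2 p2 (fun y => C1_dy C q1 y).
by exists c, d; split=> //; rewrite -E1 -E2; ring.
Qed.

Lemma bounded_on_rectangle (f : R * R -> R) (a b c d : R) : a <= b -> c <= d ->
  continuous f -> exists2 C, 0 < C &
    forall p, a <= p.1 <= b -> c <= p.2 <= d -> `|f p| <= C.
Proof.
move=> ab cd fc.
pose K : set (R * R) := `[a, b] `*` `[c, d].
have K0 : K !=set0.
  by exists (a, c); split; rewrite /= in_itv/= lexx.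
have cK : compact K.
  by apply: compact_setX; exact: segment_compact.
have [|m _ mmax] := compact_EVT_max (f := fun p => `|f p|) K0 cK.
  by apply: continuous_subspaceT => p;
    apply: continuous_comp; [exact: fc|exact: norm_continuous].
exists (`|f m| + 1); first by rewrite ltr_wpDl.
move=> p h1 h2; apply: (@le_trans _ _ `|f m|); last by rewrite lerDl.
by apply: mmax; rewrite inE; split; rewrite /= in_itv.
Qed.

Lemma C1_lipschitz f fx fy (a b c d : R) : C1_plane f fx fy -> a <= b -> c <= d ->
  exists2 C, 0 < C & forall p q, a <= p.1 <= b -> c <= p.2 <= d ->
    a <= q.1 <= b -> c <= q.2 <= d ->
    `|f p - f q| <= C * (`|p.1 - q.1| + `|p.2 - q.2|).
Proof.
move=> C ab cd.
have [A A0 HA] := bounded_on_rectangle ab cd (C1_contx C).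
have [B B0 HB] := bounded_on_rectangle ab cd (C1_conty C).
exists (A + B); first exact: addr_gt0.
move=> p q p1 p2 q1 q2.
have [s [t [hs ht ->]]] := C1_increment p q C.
have fA : `|fx (s, p.2)| <= A by apply: HA => //=; exact: minmax_btw hs.
have fB : `|fy (q.1, t)| <= B by apply: HB => //=; exact: minmax_btw ht.
apply: (le_trans (ler_normD _ _)); rewrite !normrM.
have := normr_ge0 (p.1 - q.1); have := normr_ge0 (p.2 - q.2).
by nra.
Qed.

(* Along the critical set dx is bounded by a multiple of dy where g_x <> 0, so
   the slow flow is a scalar Lipschitz equation near an equilibrium. *)
Lemma slow_rest_local g gx gy h hx hy (gamma : R -> R * R) (a b t0 : R) :
  C1_plane g gx gy -> C1_plane h hx hy -> {within `[a, b], continuous gamma} ->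
  (forall t, a <= t <= b -> g (gamma t) = 0) ->
  (forall t, a < t < b -> is_derive t (1 : R) (fun s => (gamma s).2) (h (gamma t))) ->
  a <= t0 <= b -> gx (gamma t0) < 0 -> h (gamma t0) = 0 ->
  exists2 e : R, 0 < e & forall t, a <= t <= b -> `|t - t0| < e -> gamma t = gamma t0.
Proof.
move=> Cg Ch gc g0 gd t0ab; case E : (gamma t0) => [x0 y0] gx0 h0.
have ab : a <= b by case/andP: t0ab; exact: le_trans.
have [r r0 Hr] : exists2 r : R, 0 < r & forall p, `|p - (x0, y0)| < r ->
    gx p < gx (x0, y0) / 2.
  have : \forall p \near (x0, y0), gx p < gx (x0, y0) / 2.
    by apply: (cvgr_lt _ (@C1_contx _ _ _ Cg _)); lra.
  move=> /nbhs_ballP[r /= r0 Hr]; exists r => // p pr.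
  by apply: Hr; rewrite -ball_normE /ball_/= distrC.
have rx : x0 - r <= x0 + r by lra.
have ry : y0 - r <= y0 + r by lra.
have [M M0 HM] := bounded_on_rectangle rx ry (C1_conty Cg).
have [D D0 HD] := C1_lipschitz Ch rx ry.
(* [m] bounds |gx| from below near the equilibrium, so g = 0 gives |x - x0| <= (M/m) |y - y0|. *)
pose m := - gx (x0, y0) / 2.
have m0 : 0 < m by rewrite /m; lra.
have key x y : `|(x, y) - (x0, y0)| < r -> g (x, y) = 0 ->
    `|x - x0| <= M / m * `|y - y0|.
  move=> xyr gxy.
  have [c [d [/= hc hd]]] := C1_increment (x, y) (x0, y0) Cg.
  have g00 : g (x0, y0) = 0 by rewrite -E; exact: g0.
  rewrite gxy g00 subrr => Eq.
  move: (xyr); rewrite norm_lt_pair/= !ltr_distl => -[hx' hy'].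
  have gc0 : gx (c, y) < - m.
    have -> : - m = gx (x0, y0) / 2 by rewrite /m; lra.
    apply: Hr; rewrite norm_lt_pair/= !ltr_distl hy'; split=> //.
    by move: hc; rewrite ge_min le_max => /andP[/orP[]h5 /orP[]h6];
      clear -hx' h5 h6 r0; lra.
  have gd0 : `|gy (x0, d)| <= M.
    by apply: HM => /=; [|apply: minmax_btw hd]; clear -hy' r0; lra.
  have : `|gx (c, y) * (x - x0)| = `|gy (x0, d) * (y - y0)|.
    by rewrite -normrN; congr (`| _ |); lra.
  rewrite !normrM (ltr0_norm (lt_trans gc0 _)) ?oppr_lt0// => Eqn.
  rewrite mulrAC ler_pdivlMr//.
  have := normr_ge0 (x - x0); have := normr_ge0 (y - y0).
  by nra.
(* A Lipschitz constant for h along the curve in terms of y alone: D from h, M/m from the change of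
   x, 1 from y itself. *)
pose C := D * (M / m + 1).
have C0 : 0 < C by rewrite mulr_gt0// addr_gt0// divr_gt0.
have gcl := continuous_comp_clamp ab gc.
have : \forall s \near t0, `|gamma (clamp a b s) - (x0, y0)| < r.
  have /cvgrPdist_lt /(_ r r0) := gcl t0.
  by rewrite clamp_id// E; apply: filterS => s; rewrite distrC.
move=> /nbhs_ballP[e /= e0 He].
pose f := Num.min (e / 2) ((4 * C)^-1).
have f0 : 0 < f by rewrite lt_min divr_gt0//= invr_gt0 mulr_gt0.
have [fe fC] : f <= e / 2 /\ f <= (4 * C)^-1 by rewrite !ge_min !lexx orbT.
pose a' := Num.max a (t0 - f); pose b' := Num.min b (t0 + f).
have [[ha1 ha2] [hb1 hb2]] : (a <= a' /\ t0 - f <= a') /\ (b' <= b /\ b' <= t0 + f).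
  by rewrite !le_max !ge_min !lexx !orbT.
have a't0 : a' <= t0 <= b'.
  by rewrite ge_max le_min; lra.
have inbox t : a' <= t <= b' -> `|gamma t - (x0, y0)| < r.
  move=> ht; rewrite -[t in gamma t](@clamp_id R a b); last by lra.
  by apply: He; rewrite -ball_normE /ball_/= distrC ltr_distl; lra.
have y_cst : forall t, a' <= t <= b' -> (gamma t).2 = (gamma t0).2.
  apply: (@rest_local R _ (fun t => h (gamma t)) a' b' t0 C) => //.
  - exact: ltW.
  - have : f * C <= 1 / 4.
      by rewrite -ler_pdivlMr// mul1r -invfM.
    by nra.
  - have gc' : {within `[a', b'], continuous gamma}.
      by apply: continuous_subspaceW gc => s; rewrite /= !in_itv/=; lra.
    by move=> t; apply: (@for_continuous_snd (subspace `[a', b'])); exact: gc'.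
  - by move=> t ht; apply: gd; lra.
  - move=> t ht; rewrite E/=.
    have ht' : a' <= t <= b' by rewrite !ltW; case/andP: ht.
    have := inbox t ht'; have := g0 t; case: (gamma t) => x y /= gxy xyr.
    have {}gxy : g (x, y) = 0 by apply: gxy; lra.
    have := key _ _ xyr gxy.
    move: (xyr); rewrite norm_lt_pair/= !ltr_distl => -[hx' hy'] kxy.
    have := HD (x, y) (x0, y0); rewrite /= h0 subr0 => HD'.
    apply: (le_trans (HD' _ _ _ _)); [clear -hx' hy' r0; lra..|].
    by rewrite /C -mulrA ler_pM2l//; clear -kxy; lra.
exists f => // t tab; rewrite ltr_distl => htf.
have ht : a' <= t <= b' by rewrite ge_max le_min; lra.
have := y_cst _ ht; have := inbox _ ht; have := g0 _ tab.
rewrite E; case: (gamma t) => x y /= gxy xyr yy; rewrite yy; congr pair.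
have := key _ _ xyr gxy; rewrite yy subrr normr0 mulr0 normr_le0 subr_eq0.
by move/eqP.
Qed.

(** The local statement is used only at times when the curve is at the equilibrium, so the sign of
    [gx] is asked for there alone. Consequently a curve that reaches a fold in finite time never
    meets an equilibrium with [gx] < 0. *)
Lemma slow_rest g gx gy h hx hy (gamma : R -> R * R) (a b t0 : R) :
  C1_plane g gx gy -> C1_plane h hx hy -> {within `[a, b], continuous gamma} ->
  (forall t, a <= t <= b -> g (gamma t) = 0) ->
  (forall t, a < t < b -> is_derive t (1 : R) (fun s => (gamma s).2) (h (gamma t))) ->
  a <= t0 <= b -> gx (gamma t0) < 0 -> h (gamma t0) = 0 ->
  forall t, a <= t <= b -> gamma t = gamma t0.
Proof.
move=> Cg Ch gc g0 gd t0ab gx0 h0.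
have hR : hausdorff_space (R * R)%type := @norm_hausdorff R (R * R)%type.
apply: (locally_constant_segment hR gc t0ab).
move=> t1 t1ab E1.
have [||e e0 He] := @slow_rest_local g gx gy h hx hy gamma a b t1 Cg Ch gc g0 gd t1ab.
- by rewrite E1.
- by rewrite E1.
- by exists e => // t tab tt1; rewrite He.
Qed.

End equilibria.

(** * Continuation of attracting branches *)

Section continuation.
Context {R : realType} {L : topologicalType}.
Implicit Types (G Gx Gy Gxx : (R * R) * L -> R) (p : R * R) (l : L).

(** The hypothesis [shrink] states how a radius valid at p serves a nearby p': it loses the
    distance. Halved local radii are thus valid on neighbourhoods, and compactness of [a, b] leaves
    a common one. *)
Lemma uniform_along_curve (gamma : R -> R * R) (a b : R) (l0 : L)
    (U : R -> R * R -> L -> Prop) : continuous gamma ->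
  (forall d d' p p' l, U d p l -> `|p' - p| + d' <= d -> U d' p' l) ->
  (forall t, a <= t <= b -> exists2 d, 0 < d & \forall l \near l0, U d (gamma t) l) ->
  exists2 d, 0 < d & \forall l \near l0, forall t, a <= t <= b -> U d (gamma t) l.
Proof.
move=> gc shrink loc.
have /compact_near_coveringP := @segment_compact R a b.
(* The radius is treated as a parameter tending to 0 from the right, so that near-covering
   compactness yields one radius together with a neighbourhood of [l0]. *)
pose F := filter_prod (nbhs (0 : R)^'+) (nbhs l0).
move=> /(_ (R * L)%type F (fun i t => U i.1 (gamma t) i.2) _).
have H : forall t, `[a, b]%classic t ->
    \forall t' \near t & i \near F, U i.1 (gamma t') i.2.
  move=> t; rewrite /= in_itv/= => /loc[d d0 Hd].
  have d20 : 0 < d / 2 by rewrite divr_gt0.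
  have N1 : \forall t' \near t, `|gamma t' - gamma t| < d / 2.
    have /cvgrPdist_lt /(_ _ d20) := gc t.
    by apply: filterS => s; rewrite distrC.
  have N2 : \forall e \near (0 : R)^'+, e <= d / 2 by exact: nbhs_right_le.
  exists ([set t' | `|gamma t' - gamma t| < d / 2],
    [set i : R * L | i.1 <= d / 2 /\ U d (gamma t) i.2]).
    split=> //=; exists ([set e | e <= d / 2], [set l | U d (gamma t) l]) => //.
  move=> [t' [e l]] [/= h1 [h2 h3]].
  by apply: shrink h3 _; lra.
move=> /(_ H) [[/= P Q] [P0 Ql0] PQ].
have [d [d0 Pd]] : exists d, 0 < d /\ P d.
  near (0 : R)^'+ => d; exists d; split; first by near: d; exact: nbhs_right_gt.
  by near: d.
exists d => //; apply: filterS Ql0 => l Ql t tab.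
by apply: (PQ (d, l)) => //; rewrite /= in_itv.
Unshelve. all: by end_near. Qed.

Lemma margin_along_curve (gamma : R -> R * R) (a b : R) (l0 : L)
    (P : (R * R) * L -> Prop) : continuous gamma ->
  (forall t, a <= t <= b -> \forall q \near (gamma t, l0), P q) ->
  exists2 d : R, 0 < d & \forall l \near l0, forall t p, a <= t <= b ->
    `|p - gamma t| < d -> P (p, l).
Proof.
move=> gc loc.
have [||d d0 Hd] := @uniform_along_curve gamma a b l0
    (fun d p l => forall p', `|p' - p| < d -> P (p', l)) gc.
- move=> d d' p p' l H hd p'' hp; apply: H.
  by have := ler_distD p' p'' p; lra.
- by move=> t /loc /nbhs_box.
by exists d => //; apply: filterS Hd => l H t p tab; exact: H.
Qed.

Lemma unique_along_curve G Gx Gy Gxx (gamma : R -> R * R) (a b : R) (l0 : L) :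
  C2_family G Gx Gy Gxx -> continuous gamma ->
  (forall t, a <= t <= b -> Gx (gamma t, l0) < 0 \/ Gxx (gamma t, l0) != 0) ->
  exists2 d : R, 0 < d & \forall l \near l0, forall t x1 x2 y, a <= t <= b ->
    `|x1 - (gamma t).1| < d -> `|x2 - (gamma t).1| < d -> `|y - (gamma t).2| < d ->
    G ((x1, y), l) = 0 -> G ((x2, y), l) = 0 ->
    Gx ((x1, y), l) < 0 -> Gx ((x2, y), l) < 0 -> x1 = x2.
Proof.
move=> C gc hyp.
have [||d d0 Hd] := @uniform_along_curve gamma a b l0
  (fun d p l => forall x1 x2 y, `|x1 - p.1| < d -> `|x2 - p.1| < d -> `|y - p.2| < d ->
    G ((x1, y), l) = 0 -> G ((x2, y), l) = 0 ->
    Gx ((x1, y), l) < 0 -> Gx ((x2, y), l) < 0 -> x1 = x2) gc.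
- move=> d d' p p' l H hd x1 x2 y h1 h2 h3; apply: H.
  + by have := ler_distD p'.1 x1 p.1; have : `|p'.1 - p.1| <= `|p' - p|;
      [rewrite prod_normE le_max lexx|lra].
  + by have := ler_distD p'.1 x2 p.1; have : `|p'.1 - p.1| <= `|p' - p|;
      [rewrite prod_normE le_max lexx|lra].
  + by have := ler_distD p'.2 y p.2; have : `|p'.2 - p.2| <= `|p' - p|;
      [rewrite prod_normE le_max lexx orbT|lra].
- by move=> t /hyp h; exact: attracting_zero_unique C h.
exists d => //; apply: filterS Hd => l H t x1 x2 y tab; exact: H.
Qed.

(** [attracting_zero_near] before the fold and [fold_branch] at it, made uniform along the curve. *)
Lemma branch_along_curve G Gx Gy Gxx (gamma : R -> R * R) (T e : R) (l0 : L) :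
  C2_family G Gx Gy Gxx -> continuous gamma -> 0 <= T -> 0 < e ->
  (forall t, 0 <= t <= T -> G (gamma t, l0) = 0) ->
  (forall t, 0 <= t < T -> Gx (gamma t, l0) < 0) ->
  Gx (gamma T, l0) = 0 -> Gxx (gamma T, l0) != 0 -> Gy (gamma T, l0) != 0 ->
  exists2 d : R, 0 < d & \forall l \near l0, forall t f y, 0 <= t <= T ->
    `|f - gamma T| < d -> `|y - (gamma t).2| < d -> G (f, l) = 0 -> Gx (f, l) = 0 ->
    Gxx (gamma T, l0) * (Gy (gamma T, l0) * (y - f.2)) < 0 ->
    exists x, [/\ `|x - (gamma t).1| < e, G ((x, y), l) = 0 & Gx ((x, y), l) < 0].
Proof.
move=> C gc T0 e0 g0 gx0 gxT gxxT gyT.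
have e20 : 0 < e / 2 by rewrite divr_gt0.
(* The bound is e - d and not e: passing to a base point at distance delta costs delta in |x - p.1|,
   which the smaller radius pays for. *)
have [||d d0 Hd] := @uniform_along_curve gamma 0 T l0
  (fun d p l => forall f y, `|f - gamma T| < d -> `|y - p.2| < d ->
     G (f, l) = 0 -> Gx (f, l) = 0 ->
     Gxx (gamma T, l0) * (Gy (gamma T, l0) * (y - f.2)) < 0 ->
     exists x, [/\ `|x - p.1| < e - d, G ((x, y), l) = 0 & Gx ((x, y), l) < 0]) gc.
- move=> d d' p p' l H hd f y h1 h2 h3 h4 h5.
  have [n1 n2] : `|p'.1 - p.1| <= `|p' - p| /\ `|p'.2 - p.2| <= `|p' - p|.
    by rewrite prod_normE !le_max !lexx orbT.
  have n0 := normr_ge0 (p' - p).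
  have [||x [x1 x2 x3]] := H f y _ _ h3 h4 h5.
  + by lra.
  + by have := ler_distD p'.2 y p.2; lra.
  exists x; split=> //; have := ler_distD p.1 x p'.1.
  by rewrite (distrC p.1); lra.
- move=> t /andP[t0]; rewrite le_eqVlt => /orP[/eqP->|tT].
    have GT : G (gamma T, l0) = 0 by apply: g0; rewrite T0 lexx.
    have [d d0 Hd] := fold_branch C GT gxT gxxT gyT e20.
    have mm : Num.min d (e / 2) <= d /\ Num.min d (e / 2) <= e / 2.
      by rewrite !ge_min !lexx orbT.
    exists (Num.min d (e / 2)); first by rewrite lt_min d0.
    apply: filterS Hd => l H f y hf hy h1 h2 h3.
    have [||x [x1 x2 x3]] := H f y _ _ h1 h2 h3; [lra|lra|].
    by exists x; split=> //; lra.
  have tT' : 0 <= t <= T by rewrite t0 ltW.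
  have tT'' : 0 <= t < T by rewrite t0.
  have /nbhs_box[d d0 Hd] := attracting_zero_near C (g0 _ tT') (gx0 _ tT'') e20.
  have mm : Num.min d (e / 2) <= d /\ Num.min d (e / 2) <= e / 2.
    by rewrite !ge_min !lexx orbT.
  exists (Num.min d (e / 2)); first by rewrite lt_min d0.
  apply: filterS Hd => l H f y hf hy h1 h2 h3.
  have [|x [x1 x2 x3]] := H y; first by lra.
  by exists x; split=> //; lra.
by exists d => //; apply: filterS Hd => l H t f y ht h1 h2 h3 h4 h5;
  have [x [x1 x2 x3]] := H t ht f y h1 h2 h3 h4 h5; exists x; split=> //; lra.
Qed.

End continuation.

Section curve_continuation.
Context {R : realType} {L : topologicalType}.
Implicit Types (G Gx Gy Gxx : (R * R) * L -> R) (p : R * R) (l : L).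

Lemma continuous_of_segment (V : normedModType R) (f : R -> V) (a b : R) : a <= b ->
  (forall t0, a <= t0 <= b -> forall e, 0 < e ->
    \forall t \near t0, a <= t <= b -> `|f t - f t0| < e) ->
  continuous (fun t => f (clamp a b t)).
Proof.
move=> ab H; apply: continuous_comp_clamp => //.
apply/subspace_continuousP => t tab.
apply/cvgrPdist_lt => e e0.
have tab' : a <= t <= b by move: tab; rewrite /= in_itv.
have := H t tab' e e0; apply: filterS => s h; rewrite /= in_itv/= distrC.
exact: h.
Qed.

(** The slow coordinate is prescribed first, as the affine image of that of gamma running from [s.2]
    to [f.2]; on each fibre x is then the attracting zero close to gamma, and its uniqueness makes
    the choice continuous. The last hypothesis says that the remaining fraction of the slow distance
    lies in ]0, 1], which keeps every fibre before T on the attracting side of the fold. *)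
Lemma curve_continuation G Gx Gy Gxx (gamma : R -> R * R) (T e : R) (l0 : L) :
  C2_family G Gx Gy Gxx -> continuous gamma -> 0 < T -> 0 < e ->
  (forall t, 0 <= t <= T -> G (gamma t, l0) = 0) ->
  (forall t, 0 <= t < T -> Gx (gamma t, l0) < 0) ->
  Gx (gamma T, l0) = 0 -> Gxx (gamma T, l0) != 0 -> Gy (gamma T, l0) != 0 ->
  (forall t, 0 <= t < T ->
     0 < ((gamma T).2 - (gamma t).2) / ((gamma T).2 - (gamma 0).2) <= 1) ->
  exists2 d : R, 0 < d & \forall l \near l0, forall s f,
    `|s - gamma 0| < d -> `|f - gamma T| < d ->
    G (s, l) = 0 -> Gx (s, l) < 0 -> G (f, l) = 0 -> Gx (f, l) = 0 ->
    exists (beta : R -> R * R) (c : R), [/\ continuous beta, beta 0 = s /\ beta T = f,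
      forall t, 0 <= t <= T -> `|beta t - gamma t| < e /\ G (beta t, l) = 0,
      forall t, 0 <= t < T -> Gx (beta t, l) < 0 &
      0 < c /\ forall t, 0 <= t <= T ->
        (beta t).2 = s.2 + c * ((gamma t).2 - (gamma 0).2)].
Proof.
move=> C gc T0 e0 g0 gx0 gxT gxxT gyT mono.
set k := Gxx (gamma T, l0) * Gy (gamma T, l0).
set c0 := (gamma T).2 - (gamma 0).2.
have T0' := ltW T0.
have c00 : c0 != 0.
  have := mono 0; rewrite lexx T0 => /(_ isT)/andP[+ _].
  by apply: contraTneq; rewrite -/c0 => ->; rewrite mul0r ltxx.
(* The side is read off at one time close to T, where [zero_side] applies; the hypothesis on the
   remaining fraction carries it to all of [0, T[. *)
have side t : 0 <= t < T -> k * ((gamma t).2 - (gamma T).2) < 0.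
  have GT : G (gamma T, l0) = 0 by apply: g0; rewrite lexx T0'.
  have [d d0 Hd] := zero_side C GT gxT gxxT gyT.
  have [t1 [t1T gt1]] : exists t1, 0 <= t1 < T /\ `|gamma t1 - gamma T| < d.
    have /cvgrPdist_lt /(_ _ d0) /nbhs_ballP[r /= r0 Hr] := gc T.
    have mm : Num.min (r / 2) T <= r / 2 /\ Num.min (r / 2) T <= T.
      by rewrite !ge_min !lexx orbT.
    have m0 : 0 < Num.min (r / 2) T by rewrite lt_min T0 divr_gt0.
    exists (T - Num.min (r / 2) T); split; first lra.
    rewrite distrC; apply: Hr; rewrite -ball_normE /ball_/= ltr_distl; lra.
  have sgn1 := mono _ t1T; move=> /mono sgn; rewrite -/c0 in sgn1 sgn.
  have t1T' : 0 <= t1 <= T by case/andP: t1T => -> /ltW ->.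
  have ne : (gamma t1).2 != (gamma T).2.
    by apply: contraTneq sgn1 => ->; rewrite subrr mul0r ltxx.
  have := Hd _ gt1 (g0 _ t1T') ne; rewrite mulrA -/k => K1.
  have E1 : (gamma t1).2 - (gamma T).2 = - (((gamma T).2 - (gamma t1).2) / c0) * c0.
    by rewrite mulNr divfK// opprB.
  have E : (gamma t).2 - (gamma T).2 = - (((gamma T).2 - (gamma t).2) / c0) * c0.
    by rewrite mulNr divfK// opprB.
  rewrite E1 in K1; rewrite E.
  move: sgn1 sgn K1; set u := _ / c0; set v := _ / c0 => /andP[u0 _] /andP[v0 _].
  have -> : k * (- u * c0) = - (u * (k * c0)) by ring.
  have -> : k * (- v * c0) = - (v * (k * c0)) by ring.
  by rewrite !oppr_lt0 (pmulr_rgt0 _ u0) (pmulr_rgt0 _ v0).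
have [du du0 Hu] : exists2 d : R, 0 < d & \forall l \near l0, forall t x1 x2 y,
    0 <= t <= T ->
    `|x1 - (gamma t).1| < d -> `|x2 - (gamma t).1| < d -> `|y - (gamma t).2| < d ->
    G ((x1, y), l) = 0 -> G ((x2, y), l) = 0 ->
    Gx ((x1, y), l) < 0 -> Gx ((x2, y), l) < 0 -> x1 = x2.
  apply: (unique_along_curve C gc) => t /andP[t0].
  rewrite le_eqVlt => /orP[/eqP->|tT]; [by right|left].
  by apply: gx0; rewrite t0.
(* At most du/2, so that the chosen zeros lie where uniqueness holds, with room for small moves in
   t. *)
have [e1 [e10 e1e e1u]] : exists e1, [/\ 0 < e1, e1 <= e & e1 <= du / 2].
  exists (Num.min e (du / 2)).
  by rewrite lt_min e0 divr_gt0//= !ge_min !lexx orbT.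
have [db db0 Hb] := branch_along_curve C gc T0' e10 g0 gx0 gxT gxxT gyT.
have [dn dn0 Hn] : exists2 d : R, 0 < d & \forall l \near l0, forall p,
    `|p - gamma T| < d -> Gxx (p, l) != 0 /\ Gy (p, l) != 0 /\ 0 < Gxx (p, l) * Gy (p, l) * k.
  apply: (@nbhs_box _ _ _ (fun q => Gxx q != 0 /\ Gy q != 0 /\ 0 < Gxx q * Gy q * k)).
  have : \forall q \near (gamma T, l0), 0 < Gxx q * Gy q * k.
    apply: near_pos.
      apply: continuousM; last exact: cvg_cst.
      by apply: continuousM; [exact: C2_contGxx C _|exact: C2_contGy C _].
    by rewrite -/k -expr2 exprn_even_gt0//= mulf_neq0.
  apply: filterS => q h; split; last split => //.
    by apply: contraTneq h => ->; rewrite !mul0r ltxx.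
  by apply: contraTneq h => ->; rewrite mulr0 mul0r ltxx.
(* With |c0| / 2 the two end points move by less than |c0| in total, so the scaling factor [c] stays
   positive. *)
pose d := Num.min (Num.min (Num.min e1 (du / 4)) (Num.min db dn)) (`|c0| / 2).
have [[[d1 d2] [d3 d4]] d5] : ((d <= e1 /\ d <= du / 4) /\ (d <= db /\ d <= dn)) /\ d <= `|c0| / 2.
  by rewrite /d !ge_min !lexx !orbT.
have d0 : 0 < d.
  by rewrite /d !lt_min e10 db0 dn0 !divr_gt0//= ?normr_gt0.
exists d => //.
near=> l => s f hs hf Gs Gxs Gf Gxf.
have Hul : forall t x1 x2 y, 0 <= t <= T ->
    `|x1 - (gamma t).1| < du -> `|x2 - (gamma t).1| < du -> `|y - (gamma t).2| < du ->
    G ((x1, y), l) = 0 -> G ((x2, y), l) = 0 ->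
    Gx ((x1, y), l) < 0 -> Gx ((x2, y), l) < 0 -> x1 = x2 by near: l.
have Hbl : forall t f y, 0 <= t <= T ->
    `|f - gamma T| < db -> `|y - (gamma t).2| < db -> G (f, l) = 0 -> Gx (f, l) = 0 ->
    Gxx (gamma T, l0) * (Gy (gamma T, l0) * (y - f.2)) < 0 ->
    exists x, [/\ `|x - (gamma t).1| < e1, G ((x, y), l) = 0 & Gx ((x, y), l) < 0].
  by near: l.
have Hnl : forall p, `|p - gamma T| < dn ->
    Gxx (p, l) != 0 /\ Gy (p, l) != 0 /\ 0 < Gxx (p, l) * Gy (p, l) * k by near: l.
have [s1 s2] : `|s.1 - (gamma 0).1| < d /\ `|s.2 - (gamma 0).2| < d by apply/norm_lt_pair.
have [f1 f2] : `|f.1 - (gamma T).1| < d /\ `|f.2 - (gamma T).2| < d by apply/norm_lt_pair.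
pose c := (f.2 - s.2) / c0.
have c_gt0 : 0 < c.
  have -> : c = 1 + (f.2 - (gamma T).2 - (s.2 - (gamma 0).2)) / c0.
    by rewrite /c /c0; field; rewrite -/c0.
  have : `|(f.2 - (gamma T).2 - (s.2 - (gamma 0).2)) / c0| < 1.
    rewrite normrM normfV ltr_pdivrMr ?normr_gt0// mul1r.
    by have := ler_normB (f.2 - (gamma T).2) (s.2 - (gamma 0).2);
      clear -s2 f2 d5; lra.
  by rewrite ltr_norml; clear; lra.
pose y (t : R) : R := s.2 + c * ((gamma t).2 - (gamma 0).2).
have yT : y T = f.2 by rewrite /y /c -/c0 divfK// addrC subrK.
have y0 : y 0 = s.2 by rewrite /y subrr mulr0 addr0.
have yc : continuous y.
  rewrite /y => t; apply: cvgD; first exact: cvg_cst.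
  apply: cvgM; first exact: cvg_cst.
  by apply: cvgB; [apply: for_continuous_snd; exact: gc|exact: cvg_cst].
(* With w the remaining fraction, the error in y at time t is the convex combination of the errors
   at the two ends, with weights w and 1 - w. *)
have yd t : 0 <= t <= T -> `|y t - (gamma t).2| < d.
  move=> /andP[t0]; rewrite le_eqVlt => /orP[/eqP->|tT]; first by rewrite yT.
  have /mono : 0 <= t < T by rewrite t0.
  rewrite -/c0; set w := _ / c0 => /andP[w0 w1].
  have -> : y t - (gamma t).2 = w * (s.2 - (gamma 0).2) + (1 - w) * (f.2 - (gamma T).2).
    by rewrite /y /w /c /c0; field; rewrite -/c0.
  clearbody w; apply: (le_lt_trans (ler_normD _ _)); rewrite !normrM (gtr0_norm w0).
  have w1' : 0 <= 1 - w by rewrite subr_ge0.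
  by rewrite (ger0_norm w1'); clear -w0 w1' s2 f2; nra.
have yside t : 0 <= t < T -> k * (y t - f.2) < 0.
  move=> /side h; have -> : y t - f.2 = c * ((gamma t).2 - (gamma T).2).
    by rewrite -yT /y; ring.
  by rewrite mulrCA pmulr_rlt0.
(* At T the value is prescribed, because the fold itself is not an attracting zero. *)
have exx t : exists x, 0 <= t <= T ->
    (t < T -> [/\ `|x - (gamma t).1| < e1, G ((x, y t), l) = 0 & Gx ((x, y t), l) < 0])
    /\ (t = T -> x = f.1).
  have [tT|tT] := pselect (0 <= t < T); last first.
    exists f.1 => /andP[t0 tT']; split=> // tT''.
    by exfalso; apply: tT; rewrite t0.
  have tT' : 0 <= t <= T by case/andP: tT => -> /ltW ->.
  have [|||x hx] := Hbl t f (y t) tT' _ _ Gf Gxf.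
  - exact: lt_le_trans d3.
  - by apply: lt_le_trans d3; exact: yd.
  - by rewrite mulrA; exact: yside.
  exists x => _; split=> // E; move: tT; rewrite E ltxx andbF //.
have [xs hxs] := choice exx.
pose b t := (xs t, y t).
have bT : b T = f.
  have [|_ h] := hxs T; first by rewrite lexx T0'.
  by rewrite /b yT h// -surjective_pairing.
have b0 : b 0 = s.
  have T00 : (0 : R) <= 0 <= T by rewrite lexx T0'.
  have [h _] := hxs 0 T00; have [h1 h2 h3] := h T0.
  rewrite /b y0; rewrite y0 in h2 h3.
  rewrite (Hul 0 (xs 0) s.1 s.2 T00) -?surjective_pairing//; clear -h1 e1u du0 s1 s2 d2; lra.
have bG t : 0 <= t <= T -> G (b t, l) = 0.
  move=> /[dup] tT /andP[t0]; rewrite le_eqVlt => /orP[/eqP->|tT']; first by rewrite bT.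
  by have [h _] := hxs t tT; have [] := h tT'.
have bGx t : 0 <= t < T -> Gx (b t, l) < 0.
  move=> /andP[t0 tT]; have tT' : 0 <= t <= T by rewrite t0 ltW.
  by have [h _] := hxs t tT'; have [] := h tT.
have bx t : 0 <= t <= T -> `|xs t - (gamma t).1| < e1.
  move=> /[dup] tT /andP[t0]; have [h1 h2] := hxs t tT.
  rewrite le_eqVlt => /orP[/eqP E|tT']; last by have [] := h1 tT'.
  by rewrite h2// E; exact: lt_le_trans d1.
have bnear t : 0 <= t <= T -> `|b t - gamma t| < e1.
  by move=> tT; rewrite norm_lt_pair/=; split;
    [exact: bx|exact: lt_le_trans (yd t tT) d1].
(* At t0 = T this is [fold_branch] once more, now based at the perturbed fold f. There [yside]
   refers to the unperturbed sign [k], and [Hnl] says that Gxx Gy has the same sign at f. *)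
have loc (t0 e2 : R) : 0 <= t0 <= T -> 0 < e2 -> \forall t \near t0, 0 <= t < T ->
    exists x, [/\ `|x - xs t0| < e2, G ((x, y t), l) = 0 & Gx ((x, y t), l) < 0].
  move=> t0T e20; case/andP: (t0T) => t00; rewrite le_eqVlt => /orP[/eqP E|t0T'].
    have [n1 [n2 n3]] : Gxx (f, l) != 0 /\ Gy (f, l) != 0 /\ 0 < Gxx (f, l) * Gy (f, l) * k.
      by apply: Hnl; exact: lt_le_trans d4.
    have [d6 d60 /nbhs_singleton H6] := fold_branch C Gf Gxf n1 n2 e20.
    have : \forall t \near t0, `|y t - f.2| < d6.
      have /cvgrPdist_lt /(_ _ d60) := yc t0.
      by rewrite E yT; apply: filterS => t; rewrite distrC.
    apply: filterS => t hy tT.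
    have xsf : xs t0 = f.1 by have [_] := hxs t0 t0T; apply.
    rewrite xsf; apply: (H6 f) => //; first by rewrite subrr normr0.
    have ys := yside t tT; rewrite mulrA.
    have k2 : 0 < k ^+ 2 by rewrite exprn_even_gt0//= mulf_neq0.
    move: n3; set m := Gxx (f, l) * Gy (f, l) => n3.
    have : (m * k) * (k * (y t - f.2)) < 0 by rewrite pmulr_rlt0.
    have -> : (m * k) * (k * (y t - f.2)) = k ^+ 2 * (m * (y t - f.2)) by ring.
    by rewrite pmulr_rlt0.
  have t0T'' : 0 <= t0 < T by rewrite t00.
  have N := attracting_zero_near C (bG _ t0T) (bGx _ t0T'') e20.
  have yq : {for t0, continuous (fun t : R => (y t, l))}.
    exact: (@for_continuous_pair R R L y (fun=> l) t0 (yc t0) (@for_continuous_cst R L l t0)).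
  have N' : \forall t \near t0, exists x,
    [/\ `|x - xs t0| < e2, G ((x, y t), l) = 0 & Gx ((x, y t), l) < 0] := yq _ N.
  by apply: filterS N' => t [x hx] _; exists x.
(* By uniqueness in the tube, the value chosen at t is the zero that [loc] finds close to [xs t0].
   [N3] confines the exceptional time t = T to the case t0 = T. *)
have bc : continuous (fun t => b (clamp 0 T t)).
  apply: (@continuous_of_segment (R * R)%type b 0 T T0') => /= t0 t0T e2 e20.
  pose e3 := Num.min e2 (du / 8).
  have [e3e e3u] : e3 <= e2 /\ e3 <= du / 8 by rewrite !ge_min !lexx orbT.
  have e30 : 0 < e3 by rewrite lt_min e20 divr_gt0.
  have du8 : 0 < du / 8 by rewrite divr_gt0.
  have N1 : \forall t \near t0, `|gamma t - gamma t0| < du / 8.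
    have /cvgrPdist_lt /(_ _ du8) := gc t0.
    by apply: filterS => t; rewrite distrC.
  have N2 : \forall t \near t0, `|y t - y t0| < e2.
    have /cvgrPdist_lt /(_ _ e20) := yc t0.
    by apply: filterS => t; rewrite distrC.
  have N3 : \forall t \near t0, t = T -> t0 = T.
    have [->|ne] := eqVneq t0 T; first by near=> t.
    have t0T' : t0 < T by rewrite lt_neqAle ne; case/andP: t0T.
    have : \forall t \near t0, t < T by exact: lt_nbhsl.
    by apply: filterS => t tT E; rewrite E ltxx in tT.
  have N4 := loc _ _ t0T e30.
  near=> t => tT; rewrite norm_lt_pair/=; split; last by near: t.
  have h3 : t = T -> t0 = T by near: t.
  have [E|nE] := eqVneq t T; first by rewrite E (h3 E) subrr normr0.
  have tT' : 0 <= t < T by rewrite lt_neqAle nE.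
  have : 0 <= t < T -> exists x, [/\ `|x - xs t0| < e3, G ((x, y t), l) = 0 & Gx ((x, y t), l) < 0].
    by near: t.
  move=> /(_ tT')[x [x1 x2 x3]].
  suff -> : xs t = x by exact: lt_le_trans e3e.
  have h1 : `|gamma t - gamma t0| < du / 8 by near: t.
  have [h11 _] := iffLR (norm_lt_pair _ _ _) h1.
  apply: (Hul t _ _ (y t) tT) => //.
  - by have := bx t tT; clear -e1u du0; lra.
  - have b1 := bx t0 t0T; rewrite distrC in h11.
    have t1 := ler_distD (xs t0) x (gamma t).1.
    have t2 := ler_distD (gamma t0).1 (xs t0) (gamma t).1.
    by clear -b1 t1 t2 h11 x1 e1u e3u du0; lra.
  - by have := yd t tT; clear -d2 du0; lra.
  - exact: bG.
  - exact: bGx.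
exists (fun t => b (clamp 0 T t)), c; split=> //.
- by rewrite !clamp_id ?lexx ?T0'.
- move=> t tT; rewrite clamp_id//; split; last exact: bG.
  by apply: lt_le_trans e1e; exact: bnear.
- by move=> t /[dup] tT /andP[t0 /ltW tT']; rewrite clamp_id ?t0//; exact: bGx.
- by split=> // t tT; rewrite clamp_id.
Unshelve. all: by end_near. Qed.

End curve_continuation.

(** * Slices of smooth families *)

Section smooth_slices.
Context {R : realType}.

(** Since i sends the line through p in direction w to the line through i(p) in direction v, the two
    difference quotients are the same function of h. *)
Lemma derive_slice (U V W : normedModType R) (F : V -> W) (i : U -> V) (p w : U) (v : V) :
  (forall h : R, i (h *: w + p) = h *: v + i p) -> derivable F (i p) v ->
  is_derive p w (F \o i) ('D_v F (i p)).
Proof.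
move=> ih dF.
have E : (fun h : R => h^-1 *: ((((F \o i) \o shift p) (h *: w)) - (F \o i) p)) =
         (fun h : R => h^-1 *: ((F \o shift (i p)) (h *: v) - F (i p))).
  by apply/funext => h /=; rewrite ih.
split; first by rewrite /derivable E.
by rewrite /derive E.
Qed.

Lemma smooth_derive (V W : normedModType R) (f : V -> W) v :
  smooth f -> smooth (fun x => 'D_v f x).
Proof. by move=> sf k; have [_] := sf k.+1; exact. Qed.

Lemma smooth_continuous (V W : normedModType R) (f : V -> W) : smooth f -> continuous f.
Proof. by move=> /(_ 0%N). Qed.

Lemma smooth_derivable (V W : normedModType R) (f : V -> W) x v :
  smooth f -> derivable f x v.
Proof. by move=> /(_ 1%N)[df _]; exact: diff_derivable. Qed.

Section families.
Context {r : nat}.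
Let ex : (R * R) * 'rV[R]_r := ((1, 0), 0).
Let ey : (R * R) * 'rV[R]_r := ((0, 1), 0).

Lemma smooth_slice_x (F : (R * R) * 'rV[R]_r -> R) x y l : smooth F ->
  is_derive x (1 : R) (fun u => F ((u, y), l)) ('D_ex F ((x, y), l)).
Proof.
move=> sF; apply: (@derive_slice R _ _ F (fun u => ((u, y), l))).
  by move=> h; congr (_, _, _); rewrite /= ?scaler0 ?add0r.
exact: smooth_derivable.
Qed.

Lemma smooth_slice_y (F : (R * R) * 'rV[R]_r -> R) x y l : smooth F ->
  is_derive y (1 : R) (fun u => F ((x, u), l)) ('D_ey F ((x, y), l)).
Proof.
move=> sF; apply: (@derive_slice R _ _ F (fun u => ((x, u), l))).
  by move=> h; congr (_, _, _); rewrite /= ?scaler0 ?add0r.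
exact: smooth_derivable.
Qed.

Lemma partial_x_family (F : (R * R) * 'rV[R]_r -> R) p l : smooth F ->
  partial_x (fun q => F (q, l)) p = 'D_ex F (p, l).
Proof.
move=> sF; have [||_ <-] := @derive_slice (R * R)%type _ _ F (fun q => (q, l)) p (1, 0) ex.
- by move=> h; congr (_, _); rewrite /= scaler0 add0r.
- exact: smooth_derivable.
by [].
Qed.

Lemma partial_y_family (F : (R * R) * 'rV[R]_r -> R) p l : smooth F ->
  partial_y (fun q => F (q, l)) p = 'D_ey F (p, l).
Proof.
move=> sF; have [||_ <-] := @derive_slice (R * R)%type _ _ F (fun q => (q, l)) p (0, 1) ey.
- by move=> h; congr (_, _); rewrite /= scaler0 add0r.
- exact: smooth_derivable.
by [].
Qed.

Lemma partial_xx_family (F : (R * R) * 'rV[R]_r -> R) p l : smooth F ->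
  partial_x (partial_x (fun q => F (q, l))) p = 'D_ex (fun q => 'D_ex F q) (p, l).
Proof.
move=> sF; rewrite -(partial_x_family p l (smooth_derive ex sF)).
by congr (partial_x _ p); apply/funext => q; exact: partial_x_family.
Qed.

Lemma smooth_C2_family (F : (R * R) * 'rV[R]_r -> R) : smooth F ->
  C2_family F (fun q => 'D_ex F q) (fun q => 'D_ey F q) (fun q => 'D_ex (fun q => 'D_ex F q) q).
Proof.
move=> sF; have sx := smooth_derive ex sF.
split.
- exact: smooth_continuous.
- exact: smooth_continuous.
- exact/smooth_continuous/smooth_derive.
- exact/smooth_continuous/smooth_derive.
- by move=> x y l; exact: smooth_slice_x.
- by move=> x y l; exact: smooth_slice_y.
- by move=> x y l; exact: smooth_slice_x.
Qed.

End families.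

Lemma smooth_C1_plane (f : R * R -> R) : smooth f ->
  C1_plane f (partial_x f) (partial_y f).
Proof.
move=> sf; split.
- exact/smooth_continuous/smooth_derive.
- exact/smooth_continuous/smooth_derive.
- move=> x y; apply: (@derive_slice _ _ _ f (fun u => (u, y))); last exact: smooth_derivable.
  by move=> h; congr (_, _); rewrite /= ?scaler0 ?add0r.
- move=> x y; apply: (@derive_slice _ _ _ f (fun u => (x, u))); last exact: smooth_derivable.
  by move=> h; congr (_, _); rewrite /= ?scaler0 ?add0r.
Qed.

End smooth_slices.

(** * Continuation of a whole slow segment *)

Section slow_segments.
Context {R : realType} (K : window R).

(** The interior of the window: unlike [rect], an open condition, hence stable under
    perturbation. *)
Definition rect_inside (p : R * R) : Prop :=
  xlo K < p.1 < xhi K /\ ylo K < p.2 < yhi K.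

Lemma rect_inside_rect p : rect_inside p -> rect K p.
Proof. by move=> [/andP[a b] /andP[c d]]; split; apply/andP; split; exact: ltW. Qed.

Lemma near_rect_inside (T : topologicalType) (p : R * R) (l : T) : rect_inside p ->
  \forall q \near (p, l), rect_inside q.1.
Proof.
move=> [/andP[a b] /andP[c d]].
have c1 : {for (p, l), continuous (fun q : (R * R) * T => q.1.1)}.
  by apply: for_continuous_fst; apply: for_continuous_fst; exact: for_continuous_id.
have c2 : {for (p, l), continuous (fun q : (R * R) * T => q.1.2)}.
  by apply: for_continuous_snd; apply: for_continuous_fst; exact: for_continuous_id.
have A : \forall q \near (p, l), xlo K < q.1.1 by exact: (cvgr_gt _ c1 _ a).
have B : \forall q \near (p, l), q.1.1 < xhi K by exact: (cvgr_lt _ c1 _ b).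
have C : \forall q \near (p, l), ylo K < q.1.2 by exact: (cvgr_gt _ c2 _ c).
have D : \forall q \near (p, l), q.1.2 < yhi K by exact: (cvgr_lt _ c2 _ d).
by near=> q; split; apply/andP; split; near: q.
Unshelve. all: by end_near. Qed.

Lemma traversed_in_slow_segment g h (s : R -> R * R) tau :
  traversed_in K g h s tau -> slow_segment K g h s.
Proof.
move=> [tau0 [sigma [gamma [[sc smono] [s0 s1] [gc gcrit gd] sE]]]].
have srange th : 0 <= th <= 1 -> 0 <= sigma th <= tau.
  by move=> /andP[t0 t1]; rewrite -{1}s0 -s1 !smono ?lexx ?ler01.
have cl : continuous (fun t => gamma (clamp 0 tau t)).
  exact: continuous_comp_clamp (ltW tau0) gc.
have scl : continuous (fun t => sigma (clamp 0 1 t)).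
  exact: continuous_comp_clamp ler01 sc.
split.
- have : {within `[0, 1], continuous (fun t => gamma (clamp 0 tau (sigma (clamp 0 1 t))))}.
    by apply: continuous_subspaceT => t; exact: continuous_of_for cl (scl t).
  apply: (@subspace_eq_continuous _ _ _
    (fun t => gamma (clamp 0 tau (sigma (clamp 0 1 t)))) s) => t.
  rewrite inE/= in_itv/= => t01.
  by rewrite /from_subspace (clamp_id t01) clamp_id ?srange// sE.
- by move=> th th01; rewrite sE//; have [] := gcrit (sigma th) _; rewrite //= in_itv/= srange.
exists sigma, gamma.
have sub : sigma @` `]0, 1[ `<=` `[0, tau].
  move=> _ [th /=] + <-; rewrite !in_itv/= => /andP[a b].
  by apply: srange; rewrite !ltW.
split.
- by apply: continuous_subspaceW sc; apply: subset_itvScc; rewrite bnd_simp.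
- by move=> a b a0 ab b1; apply: smono => //; exact: ltW.
- split.
  + exact: continuous_subspaceW gc.
  + by move=> t /sub; exact: gcrit.
  + by move=> t ht; apply: gd; exact: interiorS ht.
- by move=> th /andP[a b]; apply: sE; rewrite !ltW.
Qed.

Section persistence.
Context {L : topologicalType}.
Implicit Types (G Gx Gy Gxx H : (R * R) * L -> R).

(** [H] <> 0 along the segment makes y strictly monotone in slow time, as [curve_continuation]
    requires. The continued curve is still run through in the old slow time, and has to be given its
    own before it is a trajectory of the perturbed system. *)
Lemma segment_persists G Gx Gy Gxx H (A : R -> R * R) (tau e : R) (l0 : L) :
  C2_family G Gx Gy Gxx -> continuous H -> 0 < e ->
  traversed_in K (fun p => G (p, l0)) (fun p => H (p, l0)) A tau ->
  (forall th, 0 <= th < 1 -> Gx (A th, l0) < 0) ->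
  Gx (A 1, l0) = 0 -> Gxx (A 1, l0) != 0 -> Gy (A 1, l0) != 0 ->
  (forall th, 0 <= th <= 1 -> rect_inside (A th) /\ H (A th, l0) != 0) ->
  exists2 d : R, 0 < d & \forall l \near l0, forall s f,
    `|s - A 0| < d -> `|f - A 1| < d ->
    G (s, l) = 0 -> Gx (s, l) < 0 -> G (f, l) = 0 -> Gx (f, l) = 0 ->
    exists (B : R -> R * R) (tau' : R),
    [/\ traversed_in K (fun p => G (p, l)) (fun p => H (p, l)) B tau',
        B 0 = s, B 1 = f,
        forall th, 0 <= th <= 1 -> `|B th - A th| < e /\ critical_set K (fun p => G (p, l)) (B th)
      & forall th, 0 <= th < 1 -> Gx (B th, l) < 0].
Proof.
move=> C Hc e0 [tau0 [sigma [gamma0 [[sc smono] [s0 s1] [gc gcrit gd] sE]]]] Agx A1x A1xx A1y Ain.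
pose gamma t := gamma0 (clamp 0 tau t).
have gac : continuous gamma by exact: continuous_comp_clamp (ltW tau0) gc.
have gE t : 0 <= t <= tau -> gamma t = gamma0 t by move=> h; rewrite /gamma clamp_id.
have srange th : 0 <= th <= 1 -> 0 <= sigma th <= tau.
  by move=> /andP[t0 t1]; rewrite -{1}s0 -s1 !smono ?lexx ?ler01.
have AE th : 0 <= th <= 1 -> A th = gamma (sigma th).
  by move=> h; rewrite sE// gE// srange.
have z01 : (0 : R) <= 0 <= (1 : R) by apply/andP; split.
have o01 : (0 : R) <= 1 <= (1 : R) by apply/andP; split.
have A0E : A 0 = gamma 0 by rewrite AE// s0.
have A1E : A 1 = gamma tau by rewrite AE// s1.
have surj t : 0 <= t <= tau -> exists2 th, 0 <= th <= 1 & sigma th = t.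
  move=> /andP[t0 t1]; have [|th] := @IVT R sigma 0 1 t ler01 sc.
    by rewrite s0 s1 min_l ?max_r ?(ltW tau0)// t0.
  by rewrite /= in_itv/= => h E; exists th.
have slt th : 0 <= th < 1 -> sigma th < tau.
  move=> /[dup] h /andP[h0 h1]; have h' : 0 <= th <= 1 by rewrite h0 ltW.
  rewrite lt_neqAle; case/andP: (srange _ h') => _ ->; rewrite andbT.
  by apply/eqP => E; have := Agx _ h; rewrite AE// E -A1E A1x ltxx.
have g0 t : 0 <= t <= tau -> G (gamma t, l0) = 0.
  move=> h; rewrite gE//; have [] := gcrit t; last by [].
  by rewrite /= in_itv.
have gx0 t : 0 <= t < tau -> Gx (gamma t, l0) < 0.
  move=> /andP[t0 tt]; have [|th /andP[h0 h1] E] := surj t; first by rewrite t0 ltW.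
  rewrite -E -AE ?h0//; apply: Agx; rewrite h0 lt_neqAle h1 andbT.
  by apply/eqP => E1; move: tt; rewrite -E E1 s1 ltxx.
have gin t : 0 <= t <= tau -> rect_inside (gamma t) /\ H (gamma t, l0) != 0.
  by move=> /surj[th h <-]; rewrite -AE//; exact: Ain.
have t00 : (0 : R) <= 0 <= tau by apply/andP; split=> //; exact: ltW.
have ttt : (0 : R) <= tau <= tau by apply/andP; split=> //; exact: ltW.
pose v t := H (gamma t, l0).
have vc : continuous v.
  move=> t; apply: (@continuous_of_for _ _ _ H (fun t => (gamma t, l0))) => //.
  exact: (@for_continuous_pair _ _ _ gamma (fun=> l0) t (gac t) (@for_continuous_cst _ _ l0 t)).
(* Nonvanishing and continuity fix the sign of [v]; multiplying by [v 0] treats both signs at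
   once. *)
have vsign t : 0 <= t <= tau -> 0 < v 0 * v t.
  move=> /[dup] ht /andP[t0 tt].
  have [_ v0] := gin _ t00; have [_ vt] := gin _ ht.
  rewrite lt_neqAle eq_sym mulf_neq0//= leNgt; apply/negP => neg.
  have [t0'|t0'] := eqVneq t 0; first by move: neg; rewrite t0' -expr2 ltNge sqr_ge0.
  have tpos : 0 < t by rewrite lt_neqAle eq_sym t0'.
  have cc : continuous (fun t => v 0 * v t).
    by move=> z; apply: cvgM; [exact: cvg_cst|exact: vc].
  have pos0 : 0 < v 0 * v 0 by rewrite -expr2 exprn_even_gt0.
  have [z [/andP[z0 zt]]] := ivt_decr tpos cc pos0 neg.
  move=> /eqP; rewrite mulf_eq0 (negbTE v0)/= => /eqP vz.
  have [|_] := gin z; first by rewrite (ltW z0) (le_trans (ltW zt)).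
  by rewrite -/(v z) vz eqxx.
have yd t : 0 < t < tau -> is_derive t (1 : R) (fun u => (gamma0 u).2) (v t).
  move=> ht; rewrite /v gE; last by rewrite !ltW; case/andP: ht.
  by apply: gd; rewrite interior_itv/= in_itv.
have ymvt a b : 0 <= a -> a < b -> b <= tau -> exists2 c, 0 <= c <= tau &
    (gamma b).2 - (gamma a).2 = v c * (b - a).
  move=> a0 ab bt.
  have [||c] := @MVT R (fun u => (gamma0 u).2) v a b ab.
  - by move=> z; rewrite in_itv/= => /andP[az zb]; apply: yd; rewrite (le_lt_trans a0 az) (lt_le_trans zb).
  - have gc' : {within `[a, b], continuous gamma0}.
      apply: continuous_subspaceW gc => z; rewrite /= !in_itv/= => /andP[az zb].
      by rewrite (le_trans a0 az) (le_trans zb).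
    by move=> t; apply: (@for_continuous_snd (subspace `[a, b])); exact: gc'.
  rewrite in_itv/= => /andP[ac cb] E; exists c.
    by rewrite (le_trans a0 (ltW ac)) (le_trans (ltW cb)).
  by rewrite !gE ?a0 ?bt ?(le_trans a0 (ltW ab)) ?(le_trans (ltW ab) bt).
have mono t : 0 <= t < tau ->
    0 < ((gamma tau).2 - (gamma t).2) / ((gamma tau).2 - (gamma 0).2) <= 1.
  move=> /andP[t0 tt].
  have [c1 /vsign h1 E1] := ymvt t tau t0 tt (lexx _).
  have [c2 /vsign h2 E2] := ymvt 0 tau (lexx _) tau0 (lexx _).
  have h3 : 0 <= v 0 * ((gamma t).2 - (gamma 0).2).
    move: t0; rewrite le_eqVlt => /orP[/eqP <-|t0]; first by rewrite subrr mulr0.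
    have [c3 /vsign h3 ->] := ymvt 0 t (lexx _) t0 (ltW tt).
    by rewrite mulrA mulr_ge0 ?subr_ge0 ?ltW.
  have {}h1 : 0 < v 0 * ((gamma tau).2 - (gamma t).2).
    by rewrite E1 mulrA mulr_gt0// subr_gt0.
  have {}h2 : 0 < v 0 * ((gamma tau).2 - (gamma 0).2).
    by rewrite E2 mulrA mulr_gt0// subr0.
  have v0 : v 0 != 0 by have [] := gin _ t00.
  have -> : ((gamma tau).2 - (gamma t).2) / ((gamma tau).2 - (gamma 0).2) =
      (v 0 * ((gamma tau).2 - (gamma t).2)) / (v 0 * ((gamma tau).2 - (gamma 0).2)).
    have ne : (gamma tau).2 - (gamma 0).2 != 0.
      by apply: contraTneq h2 => ->; rewrite mulr0 ltxx.
    by field; rewrite ne v0.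
  rewrite divr_gt0// ler_pdivrMr// mul1r; clear -h3; lra.
have [dm dm0 Hm] : exists2 d : R, 0 < d & \forall l \near l0, forall t p, 0 <= t <= tau ->
    `|p - gamma t| < d -> rect_inside p /\ 0 < v 0 * H (p, l).
  apply: (margin_along_curve (P := fun q => rect_inside q.1 /\ 0 < v 0 * H q) gac) => t ht.
  have [i1 _] := gin _ ht.
  have N1 := near_rect_inside l0 i1.
  have N2 : \forall q \near (gamma t, l0), 0 < v 0 * H q.
    apply: near_pos; last exact: vsign ht.
    by apply: continuousM; [exact: cvg_cst|exact: Hc].
  exact: filterI N1 N2.
pose e' := Num.min e dm.
have e'0 : 0 < e' by rewrite lt_min e0.
have A1x' : Gx (gamma tau, l0) = 0 by rewrite -A1E.
have A1xx' : Gxx (gamma tau, l0) != 0 by rewrite -A1E.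
have A1y' : Gy (gamma tau, l0) != 0 by rewrite -A1E.
have [d d0 Hd] := curve_continuation C gac tau0 e'0 g0 gx0 A1x' A1xx' A1y' mono.
exists d => //; near=> l => s f; rewrite A0E A1E => hs hf Gs Gxs Gf Gxf.
have Hdl : forall s f,
    `|s - gamma 0| < d -> `|f - gamma tau| < d ->
    G (s, l) = 0 -> Gx (s, l) < 0 -> G (f, l) = 0 -> Gx (f, l) = 0 ->
    exists (beta : R -> R * R) (c : R), [/\ continuous beta, beta 0 = s /\ beta tau = f,
      forall t, 0 <= t <= tau -> `|beta t - gamma t| < e' /\ G (beta t, l) = 0,
      forall t, 0 <= t < tau -> Gx (beta t, l) < 0 &
      0 < c /\ forall t, 0 <= t <= tau ->
        (beta t).2 = s.2 + c * ((gamma t).2 - (gamma 0).2)] by near: l.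
have Hml : forall t p, 0 <= t <= tau ->
    `|p - gamma t| < dm -> rect_inside p /\ 0 < v 0 * H (p, l) by near: l.
have [beta [c [bc [b0 b1] bnear bgx [c_gt0 by_]]]] := Hdl s f hs hf Gs Gxs Gf Gxf.
have be t : 0 <= t <= tau -> `|beta t - gamma t| < e.
  by move=> /bnear[+ _]; rewrite lt_min => /andP[].
have bm t : 0 <= t <= tau -> rect_inside (beta t) /\ 0 < v 0 * H (beta t, l).
  by move=> /[dup] ht /bnear[+ _]; rewrite lt_min => /andP[_]; exact: Hml.
(* time change turning the parameter of beta into slow time of the perturbed system *)
pose k t := H (beta (clamp 0 tau t), l) / (c * v (clamp 0 tau t)).
have clt t := clamp_btw t (ltW tau0).
have vcl0 t : v (clamp 0 tau t) != 0 by have [] := gin _ (clt t).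
have k0 t : 0 < k t.
  have [_ h1] := bm _ (clt t); have h2 := vsign _ (clt t).
  have v0 : v 0 != 0 by have [] := gin _ t00.
  have -> : k t = (v 0 * H (beta (clamp 0 tau t), l)) / (c * (v 0 * v (clamp 0 tau t))).
    by rewrite /k; field; rewrite v0 vcl0 gt_eqF.
  by rewrite divr_gt0// mulr_gt0.
have kc : continuous k.
  move=> t; apply: cvgM.
    apply: (@continuous_of_for _ _ _ H (fun t => (beta (clamp 0 tau t), l))) => //.
    apply: (@for_continuous_pair _ _ _ _ (fun=> l) t) (@for_continuous_cst _ _ l t).
    by apply: (@continuous_of_for _ _ _ beta (clamp 0 tau)) => //; exact: continuous_clamp.
  apply: cvgV; first by rewrite mulf_neq0// gt_eqF.
  apply: cvgM; first exact: cvg_cst.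
  by apply: (@continuous_of_for _ _ _ v (clamp 0 tau)) => //; exact: continuous_clamp.
have [m _ mmax] := @EVT_max R k 0 tau (ltW tau0) (continuous_subspaceT kc).
(* [k] sees t only through the clamp, so its maximum over [0, tau] bounds it on the whole line, as
   [ode_line] needs. *)
have kcl t : k (clamp 0 tau t) = k t.
  by rewrite /k (clamp_id (clt t)).
have [|sg [r [sgd rc sgr rsg [sgmono sg0]]]] := @ode_line R k (k m) 0 kc.
  move=> t; rewrite k0 -(kcl t); apply: mmax; by rewrite in_itv/=.
have sgle a b : a <= b -> sg a <= sg b.
  by rewrite le_eqVlt => /orP[/eqP->//|/sgmono/ltW].
have rle a b : a <= b -> r a <= r b.
  by move=> ab; rewrite leNgt; apply/negP => /sgmono; rewrite !rsg ltNge ab.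
have sgc : continuous sg by move=> t; exact: is_derive_continuous (sgd t).
have r0 : r 0 = 0 by rewrite -{1}sg0 sgr.
have rtau0 : 0 < r tau.
  rewrite ltNge; apply/negP => /sgle; rewrite rsg sg0 leNgt tau0 //.
have sgrange t : 0 <= t <= r tau -> 0 <= sg t <= tau.
  by move=> /andP[a b]; apply/andP; split; [rewrite -sg0|rewrite -(rsg tau)]; exact: sgle.
(* [sg] maps new slow time to old and [r] is its inverse, so the curve parameter is sent to new time
   by [r \o sigma], and the new duration is [r tau]. *)
exists (fun th => beta (sigma th)), (r tau); split.
- split=> //; exists (r \o sigma), (beta \o sg); split.
  + split.
      exact: (fun t => cvg_comp _ _ (sc t) (rc (sigma t))).
    by move=> th1 th2 h1 h12 h2; apply: rle; exact: smono.
  + by rewrite /= s0 s1.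
  + split.
    * apply: continuous_subspaceT => t.
      exact: (@continuous_of_for _ _ _ beta sg t bc (sgc t)).
    * move=> t; rewrite /= in_itv/= => /sgrange ht.
      have [h1 _] := bm _ ht; have [_ h2] := bnear _ ht.
      by split=> //; exact: rect_inside_rect.
    * move=> t; rewrite interior_itv/= in_itv/= => /andP[t0 tt].
      have sgt : 0 < sg t < tau.
        by apply/andP; split; [rewrite -sg0|rewrite -(rsg tau)]; exact: sgmono.
      have sgt' : 0 <= sg t <= tau by rewrite !ltW; case/andP: sgt.
      (* In old time the slow coordinate of [beta] has speed c v; the factor k, which is the speed
         of [sg], turns it into [H]. *)
      have -> : H (beta (sg t), l) = c * (v (sg t) * k (sg t)).
        have vn : v (sg t) != 0 by have [] := gin _ sgt'.
        by rewrite /k clamp_id//; field; rewrite vn gt_eqF.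
      have D1 : is_derive t (1 : R) ((fun u => (gamma0 u).2) \o sg) (v (sg t) * k (sg t)).
        by apply: is_derive1_comp (sgd t); exact: yd.
      have D2 : is_derive t (1 : R) (fun u => s.2 + c * ((gamma0 (sg u)).2 - (gamma 0).2))
          (c * (v (sg t) * k (sg t))).
        have D3 := is_deriveB D1 (is_derive_cst ((gamma 0).2) t (1 : R)).
        have D4 := is_deriveD (is_derive_cst (s.2) t (1 : R)) (is_deriveZ c D3).
        by rewrite add0r subr0 in D4.
      apply: near_eq_is_derive D2.
      have near0 : \forall u \near t, 0 < u by exact: lt_nbhsr.
      have near1 : \forall u \near t, u < r tau by exact: lt_nbhsl.
      near=> u; have u0 : 0 < u by near: u.
      have u1 : u < r tau by near: u.
      have hu : 0 <= sg u <= tau by apply: sgrange; rewrite !ltW.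
      by rewrite /= (by_ _ hu) (gE _ hu).
  + by move=> th th01 /=; rewrite rsg.
- by rewrite s0.
- by rewrite s1.
- move=> th th01; have ht := srange _ th01; split; first by rewrite AE//; exact: be.
  have [h1 _] := bm _ ht; have [_ h2] := bnear _ ht.
  by split=> //; exact: rect_inside_rect.
- move=> th /[dup] th01 /andP[h0 h1]; apply: bgx; rewrite slt// andbT.
  by have /andP[] : 0 <= sigma th <= tau by apply: srange; rewrite h0 ltW.
Unshelve. all: by end_near. Qed.

End persistence.
End slow_segments.

(** * Jumps *)

Section jumps.
Context {R : realType}.

(** Without zeros between a and b the sign of u is constant there, and it is positive just before b,
    where u falls to 0. With b a landing point, this turns the existence of a jump orbit into a sign
    of g on the fibre. *)
Let sign_between_incr (u du : R -> R) (a b : R) : a < b -> continuous du ->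
  (forall x, is_derive x (1 : R) u (du x)) -> u b = 0 -> du b < 0 ->
  (forall z, a < z < b -> u z != 0) -> forall z, a < z < b -> 0 < u z.
Proof.
move=> ab duc ud ub dub nz z /[dup] zab /andP[az zb].
have uc : continuous u by move=> x; exact: is_derive_continuous (ud x).
rewrite lt_neqAle eq_sym nz//= leNgt; apply/negP => uz.
have : \forall x \near b, du x < 0 by apply: near_neg => //; exact: duc.
move=> /nbhs_ballP[r /= r0 Hr].
pose w := Num.max z (b - r / 2).
have [w1 w2] : z <= w /\ b - r / 2 <= w by rewrite !le_max !lexx orbT.
have wb : w < b by rewrite gt_max zb/=; lra.
have [c [/andP[wc cb]]] := mvt wb (fun x _ => ud x).
have duc0 : du c < 0.
  by apply: Hr; rewrite -ball_normE /ball_/= ltr_distl; lra.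
rewrite ub => E; have uw : 0 < u w by clear -E duc0 wb; nra.
have zw : z < w.
  by rewrite lt_neqAle w1 andbT; apply: contraTneq uw => <-; rewrite -leNgt ltW.
have nuc : continuous (fun x => - u x) by move=> x; apply: cvgN; exact: uc.
have [|| x [/andP[zx xw] /eqP]] := ivt_decr zw nuc.
- by rewrite oppr_gt0.
- by rewrite oppr_lt0.
by rewrite oppr_eq0; apply/negP; apply: nz; rewrite (lt_trans az)//= (lt_trans xw).
Qed.

Lemma sign_between (u du : R -> R) (a b : R) : a != b -> continuous du ->
  (forall x, is_derive x (1 : R) u (du x)) -> u b = 0 -> du b < 0 ->
  (forall z, (z - a) * (z - b) < 0 -> u z != 0) ->
  forall z, (z - a) * (z - b) < 0 -> 0 < (b - a) * u z.
Proof.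
rewrite neq_lt => /orP[ab|ba] duc ud ub dub nz z hz.
  rewrite pmulr_rgt0 ?subr_gt0//; apply: (sign_between_incr ab duc ud ub dub).
    by move=> x /andP[ax xb]; apply: nz; rewrite nmulr_llt0 ?subr_gt0 ?subr_lt0.
  by apply/andP; split; rewrite ltNge; apply/negP => h; clear -h hz ab; nra.
rewrite nmulr_rgt0 ?subr_lt0// -oppr_gt0.
have := @sign_between_incr (fun x => - u (- x)) (du \o -%R) (- a) (- b).
move=> /(_ _ _ _ _ _ _ (- z)); rewrite /= !opprK; apply.
- by rewrite ltrN2.
- by move=> x; apply: continuous_comp; [exact: oppr_continuous|exact: duc].
- move=> x /=; rewrite -[du (- x)]opprK; apply: is_deriveN.
  exact: is_derive_compN.
- by rewrite ub oppr0.
- by [].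
- move=> x /andP[ax xb]; rewrite oppr_eq0; apply: nz; clear -ax xb; nra.
- by rewrite !ltrN2; apply/andP; split; rewrite ltNge; apply/negP => h; clear -h hz ba; nra.
Qed.

(* An orbit of a scalar Lipschitz equation does not cross an equilibrium. *)
Lemma heteroclinic_neq0 (u du psi : R -> R) (a b : R) : continuous du ->
  (forall x, is_derive x (1 : R) u (du x)) ->
  (forall t, is_derive t (1 : R) psi (u (psi t))) ->
  psi t @[t --> -oo] --> a -> psi t @[t --> +oo] --> b ->
  forall z, (z - a) * (z - b) < 0 -> u z != 0.
Proof.
move=> duc ud psid pa pb z hz; apply/eqP => uz.
have psic : continuous psi by move=> x; exact: is_derive_continuous (psid x).
have za : z != a by apply: contraTneq hz => ->; rewrite subrr mul0r ltxx.
have e0 : 0 < `|z - a| by rewrite normr_gt0 subr_eq0.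
have zb : z != b by apply: contraTneq hz => ->; rewrite subrr mulr0 ltxx.
have f0 : 0 < `|z - b| by rewrite normr_gt0 subr_eq0.
have [t1 h1] : exists t, `|a - psi t| < `|z - a|.
  have /cvgrPdist_lt /(_ _ e0) := pa.
  by move=> [M [_ HM]]; exists (M - 1); apply: HM; rewrite ltrBlDr ltrDl.
have [t2 h2] : exists t, `|b - psi t| < `|z - b|.
  have /cvgrPdist_lt /(_ _ f0) := pb.
  by move=> [M [_ HM]]; exists (M + 1); apply: HM; rewrite ltrDl.
(* An early value of psi is closer to a than z is, a late one closer to b, so they lie on opposite
   sides of z. Hence psi takes the value z, and is then constant. *)
have sgn : (psi t1 - z) * (psi t2 - z) < 0.
  move: h1 h2; rewrite !ltr_distl.
  have [az|az] := ltP 0 (z - a).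
    rewrite (gtr0_norm az) => h1.
    have bz : z - b < 0 by clear -az hz; nra.
    rewrite (ltr0_norm bz) => h2; clear -h1 h2; nra.
  have az' : z - a < 0 by rewrite lt_neqAle az subr_eq0 za.
  rewrite (ltr0_norm az') => h1.
  have bz : 0 < z - b by clear -az' hz; nra.
  rewrite (gtr0_norm bz) => h2; clear -h1 h2; nra.
have [t tz] : exists t, psi t = z.
  have [|||t _ tz] := @IVT R psi (Num.min t1 t2) (Num.max t1 t2) z; last by exists t.
  - by rewrite ge_min le_max lexx.
  - exact: continuous_subspaceT.
  have H x y : (x - z) * (y - z) < 0 -> Num.min x y <= z <= Num.max x y.
    move=> hxy; rewrite ge_min le_max; apply/andP; split; apply/orP.
      have [xz|xz] := leP x z; first by left.
      by right; clear -hxy xz; nra.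
    have [xz|xz] := leP z x; first by left.
    by right; clear -hxy xz; nra.
  by have [_|_] := leP t1 t2; apply: H; rewrite // mulrC.
have cst := ode_equilibrium duc ud psid (t0 := t).
rewrite tz in cst; move: h1; rewrite (cst uz t1).
by rewrite distrC ltxx.
Qed.

Context {L : topologicalType} (K : window R).
Implicit Types (G Gx Gy Gxx : (R * R) * L -> R).

(** The landing point is sought on the fibre of the perturbed fold, whose height varies with l; the
    sign of [G] between the two then yields the orbit through [heteroclinic]. Nondegeneracy of the
    new fold and its uniqueness on the fibre are recorded because the new oscillation must again be
    simple. *)
Lemma jump_persists G Gx Gy Gxx (p0 q0 : R * R) (l0 : L) (e : R) :
  C2_family G Gx Gy Gxx -> 0 < e -> rect_inside K p0 -> rect_inside K q0 ->
  G (p0, l0) = 0 -> Gx (p0, l0) = 0 -> Gxx (p0, l0) != 0 -> Gy (p0, l0) != 0 ->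
  (forall x, fast_range K x -> G ((x, p0.2), l0) = 0 -> Gx ((x, p0.2), l0) = 0 -> x = p0.1) ->
  q0.2 = p0.2 -> G (q0, l0) = 0 -> Gx (q0, l0) < 0 ->
  (forall x, (x - p0.1) * (x - q0.1) < 0 -> 0 < (q0.1 - p0.1) * G ((x, p0.2), l0)) ->
  \forall l \near l0, exists f s,
    [/\ `|f - p0| < e /\ `|s - q0| < e,
        [/\ rect_inside K f, G (f, l) = 0, Gx (f, l) = 0, Gxx (f, l) != 0 & Gy (f, l) != 0],
        forall x, fast_range K x -> G ((x, f.2), l) = 0 -> Gx ((x, f.2), l) = 0 -> x = f.1,
        [/\ rect_inside K s, G (s, l) = 0 & Gx (s, l) < 0] &
        exists phi : R -> R * R,
          [/\ fast_trajectory K (fun p => G (p, l)) phi,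
            phi t @[t --> -oo] --> f & phi t @[t --> +oo] --> s]].
Proof.
move=> C e0 ip iq Gp Gxp Gxxp Gyp uniq qp Gq Gxq btw.
have pq : p0.1 != q0.1.
  apply: contraTneq Gxq => E; rewrite -leNgt.
  by rewrite [q0]surjective_pairing -E qp -surjective_pairing Gxp.
have Gxq' : Gx ((q0.1, p0.2), l0) < 0 by rewrite -qp -surjective_pairing.
have [d1 d10 H1] := jump_sign C pq Gp Gxp Gxxp Gxq' btw.
have [d2 d20 H2] := fold_fibre_unique C Gxxp uniq.
have [d3 d30 H3] : exists2 d : R, 0 < d & \forall l \near l0, forall p, `|p - p0| < d ->
    rect_inside K p /\ Gxx (p, l) != 0 /\ Gy (p, l) != 0.
  apply: (@nbhs_box _ _ _ (fun q => rect_inside K q.1 /\ Gxx q != 0 /\ Gy q != 0)).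
  have N1 := near_rect_inside l0 ip.
  have ne (F : (R * R) * L -> R) : continuous F -> F (p0, l0) != 0 ->
      \forall q \near (p0, l0), F q != 0.
    move=> Fc; rewrite neq_lt => /orP[h|h].
      have : \forall q \near (p0, l0), F q < 0 by apply: near_neg => //; exact: Fc.
      by apply: filterS => q /lt_eqF ->.
    have : \forall q \near (p0, l0), 0 < F q by apply: near_pos => //; exact: Fc.
    by apply: filterS => q /gt_eqF ->.
  have N2 := ne _ (C2_contGxx C) Gxxp; have N3 := ne _ (C2_contGy C) Gyp.
  exact: filterI N1 (filterI N2 N3).
have [d4 d40 H4] := nbhs_box (near_rect_inside l0 iq).
pose e1 := Num.min (Num.min e d1) d4.
have e10 : 0 < e1 by rewrite !lt_min e0 d10.
have /nbhs_box[d5 d50 H5] := attracting_zero_near C Gq Gxq e10.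
pose d := Num.min (Num.min (Num.min e d1) (Num.min d2 d3)) (Num.min d4 d5).
have d0 : 0 < d by rewrite !lt_min e0 d10 d20 d30 d40.
pose d' := Num.min d e1.
have d'0 : 0 < d' by rewrite lt_min d0.
have H6 := fold_near C Gp Gxp Gxxp Gyp d'0.
near=> l.
have [f [hf Gf Gxf]] : exists p, [/\ `|p - p0| < d', G (p, l) = 0 & Gx (p, l) = 0].
  by near: l.
have H1l : forall f x1', `|f - p0| < d1 ->
    `|x1' - q0.1| < d1 -> G (f, l) = 0 -> Gx (f, l) = 0 -> G ((x1', f.2), l) = 0 ->
    f.1 != x1' /\
    forall x, (x - f.1) * (x - x1') < 0 -> 0 < (x1' - f.1) * G ((x, f.2), l) by near: l.
have H2l : forall f x, `|f - p0| < d2 ->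
    xlo K <= x <= xhi K -> G (f, l) = 0 -> Gx (f, l) = 0 ->
    G ((x, f.2), l) = 0 -> Gx ((x, f.2), l) = 0 -> x = f.1 by near: l.
have H3l : forall p, `|p - p0| < d3 ->
    rect_inside K p /\ Gxx (p, l) != 0 /\ Gy (p, l) != 0 by near: l.
have H4l : forall p, `|p - q0| < d4 -> rect_inside K p by near: l.
have H5l : forall y, `|y - q0.2| < d5 -> exists x,
    [/\ `|x - q0.1| < e1, G ((x, y), l) = 0 & Gx ((x, y), l) < 0] by near: l.
move: hf; rewrite !lt_min -!andbA => /and3P[fe fd1 /and3P[fd2 fd3 /and3P[fd4 fd5 /and3P[_ _ _]]]].
have [if_ [Gxxf Gyf]] := H3l _ fd3.
have f2 r : `|f - p0| < r -> `|f.2 - q0.2| < r by rewrite qp => /norm_lt_pair[].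
have [x [xe Gs Gxs]] := H5l _ (f2 _ fd5).
move: xe; rewrite !lt_min -!andbA => /and3P[xe xd1 xd4].
pose s := (x, f.2).
have is_ : rect_inside K s.
  by apply: H4l; rewrite norm_lt_pair/=; split=> //; exact: f2.
have [fx pos] := H1l _ _ fd1 xd1 Gf Gxf Gs.
have [phi [phid phib pa pb]] := @heteroclinic R (fun x => G ((x, f.2), l))
  (fun x => Gx ((x, f.2), l)) f.1 x fx (C2_along_x (C2_contGx C))
  (fun z => C2_dx C z f.2 l) (etrans (congr1 (fun p => G (p, l)) (esym (surjective_pairing f))) Gf) Gs pos.
exists f, s; split.
- by split=> //; rewrite norm_lt_pair/=; split=> //; exact: f2.
- by split.
- by move=> z hz h1 h2; exact: H2l fd2 hz Gf Gxf h1 h2.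
- by split.
exists (fun t => (phi t, f.2)); split.
- move=> t; split.
  + apply: rect_inside_rect; split => /=; last by case: if_.
    have [/andP[a1 a2] _] := if_; have [/andP[b1 b2] _] := is_.
    have h := phib t; rewrite /= in b1 b2; apply/andP; split; rewrite ltNge; apply/negP => hh.
      by clear -a1 b1 h hh; nra.
    by clear -a2 b2 h hh; nra.
  + exact: phid.
  + exact: is_derive_cst.
- have : (phi t, f.2) @[t --> -oo] --> (f.1, f.2) by exact: cvg_pair pa (cvg_cst _).
  by rewrite -surjective_pairing.
- exact: cvg_pair pb (cvg_cst _).
Unshelve. all: by end_near. Qed.

End jumps.

(** * Nonvanishing of h at folds *)

Section smoothness.
Context {R : realType}.

Lemma Ck_leq (V W : normedModType R) k (f : V -> W) : Ck k.+1 f -> Ck k f.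
Proof.
elim: k f => [|k IH] f [df Df].
  by move=> x; exact: differentiable_continuous.
by split=> // v; apply: IH; exact: Df.
Qed.

Lemma Ck_cst (V W : normedModType R) k (c : W) : Ck k (fun _ : V => c).
Proof.
elim: k c => [|k IH] c /=; first by move=> x; exact: cvg_cst.
split=> [x|v]; first exact: differentiable_cst.
have -> : (fun x : V => 'D_v (fun _ : V => c) x) = (fun=> 0).
  by apply/funext => x; exact: derive_cst.
exact: IH.
Qed.

Lemma Ck_add (V W : normedModType R) k (f g : V -> W) :
  Ck k f -> Ck k g -> Ck k (fun x => f x + g x).
Proof.
elim: k f g => [|k IH] f g.
  by move=> cf cg x; apply: cvgD; [exact: cf|exact: cg].
move=> [df Df] [dg Dg]; split=> [x|v].
  by apply: (@differentiableD _ _ _ f g).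
have -> : (fun x : V => 'D_v (fun x => f x + g x) x) = (fun x => 'D_v f x + 'D_v g x).
  by apply/funext => x; apply: deriveD; exact: diff_derivable.
exact: (IH _ _ (Df v) (Dg v)).
Qed.

Lemma Ck_mul (V : normedModType R) k (f g : V -> R) :
  Ck k f -> Ck k g -> Ck k (fun x => f x * g x).
Proof.
elim: k f g => [|k IH] f g.
  by move=> cf cg x; apply: cvgM; [exact: cf|exact: cg].
move=> Cf Cg; have [df Df] := Cf; have [dg Dg] := Cg; split=> [x|v].
  by apply: (@differentiableM _ _ f g).
have -> : (fun x : V => 'D_v (fun x => f x * g x) x) =
    (fun x => f x * 'D_v g x + g x * 'D_v f x).
  by apply/funext => x; apply: (@deriveM _ _ f g); exact: diff_derivable.
exact: Ck_add (IH _ _ (Ck_leq Cf) (Dg v)) (IH _ _ (Ck_leq Cg) (Df v)).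
Qed.

Lemma Ck_opp (V : normedModType R) k (f : V -> R) : Ck k f -> Ck k (fun x => - f x).
Proof.
move=> Cf; have -> : (fun x => - f x) = (fun x => (-1) * f x).
  by apply/funext => x; rewrite mulN1r.
by apply: Ck_mul => //; exact: Ck_cst.
Qed.

Lemma Ck_comp_linear (U V W : normedModType R) k (i : {linear U -> V}) (f : V -> W) :
  continuous i -> Ck k f -> Ck k (fun x => f (i x)).
Proof.
move=> ic; elim: k f => [|k IH] f.
  by move=> cf x; apply: continuous_comp; [exact: ic|exact: cf].
move=> [df Df]; split=> [x|v].
  apply: (@differentiable_comp _ _ _ _ i f) => //.
  exact: linear_differentiable.
have -> : (fun x : U => 'D_v (fun x => f (i x)) x) = (fun x => 'D_(i v) f (i x)).
  apply/funext => x.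
  have [||_ <-] := @derive_slice R _ _ _ f i x v (i v); last by [].
    by move=> h; rewrite linearP.
  exact: diff_derivable.
exact: IH (Df (i v)).
Qed.

Lemma Ck_linear (V W : normedModType R) k (i : {linear V -> W}) : continuous i -> Ck k i.
Proof.
move=> ic; case: k => [//|k]; split=> [x|v]; first exact: linear_differentiable.
have -> : (fun x : V => 'D_v i x) = (fun=> i v).
  apply/funext => x; rewrite deriveE; last exact: linear_differentiable.
  by rewrite diff_lin.
exact: Ck_cst.
Qed.

Lemma Ck_coord k n (j : 'I_n) : Ck k (fun l : 'rV[R]_n => l 0 j).
Proof.
have lin : linear (fun l : 'rV[R]_n => l 0 j : R^o).
  by move=> a u v; rewrite !mxE.
pose i : {linear 'rV[R]_n -> R^o} :=
  HB.pack (fun l : 'rV[R]_n => l 0 j : R^o) (GRing.isLinear.Build _ _ _ _ _ lin).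
exact: (@Ck_linear _ _ k i (@coord_continuous R 1 n 0 j)).
Qed.

Lemma Ck_fst (U V W : normedModType R) k (f : U -> W) :
  Ck k f -> Ck k (fun x : U * V => f x.1).
Proof.
apply: (@Ck_comp_linear _ _ _ k (@fst U V : {linear _ -> _})).
by move=> x; exact: cvg_fst.
Qed.

Lemma Ck_snd (U V W : normedModType R) k (f : V -> W) :
  Ck k f -> Ck k (fun x : U * V => f x.2).
Proof.
apply: (@Ck_comp_linear _ _ _ k (@snd U V : {linear _ -> _})).
by move=> x; exact: cvg_snd.
Qed.

Lemma Ck_proj1 (U V : normedModType R) k : Ck k (fun x : U * V => x.1).
Proof.
by apply: (@Ck_linear _ _ k (@fst U V : {linear _ -> _})) => x; exact: cvg_fst.
Qed.

End smoothness.

(** * Folds under global singular equivalence *)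

Section transport.
Context {R : realType} (K : window R).

Lemma V_f_x_interior (g : R * R -> R) p : V_f K g -> rect K p -> g p = 0 ->
  xlo K < p.1 < xhi K.
Proof.
case: p => x y [_ bx _] [/= /andP[x1 x2] hy] g0.
have nb : ~ [set xlo K; xhi K] x.
  by move=> xb; have := bx x y xb hy; rewrite g0 mul0r ltxx.
by rewrite !lt_neqAle x1 x2 !andbT; apply/andP; split; apply/eqP => E;
  apply: nb; [left|right].
Qed.

Lemma smooth_slice_fst (Phi : R * R -> R * R) x y : smooth Phi ->
  derivable (fun u => (Phi (u, y)).1) x 1.
Proof.
move=> sPhi; apply/derivable1_diffP.
apply: (@differentiable_comp _ _ _ _ (fun u => Phi (u, y)) fst).
  apply/derivable1_diffP.
  have [||] // := @derive_slice R _ _ _ Phi (fun u => (u, y)) x 1 (1, 0).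
    by move=> s; congr (_, _); rewrite /= ?scaler0 ?add0r.
  exact: smooth_derivable.
by apply: (@linear_differentiable _ _ _ (@fst R R : {linear _ -> _})) => z; exact: cvg_fst.
Qed.

(** Differentiating gt = S (g o Phi) in x at a fold kills the term containing g and leaves S g_x X_x
    = 0. Here S > 0, and X_x <> 0 because Phi is invertible and its second component depends on y
    only. *)
Lemma equivalence_fold_zero (g h gt ht : R * R -> R) q :
  globally_singularly_equivalent K g h gt ht -> fold_set K gt q -> ht q = 0 ->
  exists p, [/\ rect K p, g p = 0, partial_x g p = 0 & h p = 0].
Proof.
move=> [[Vg Vh] [Vgt _] [X [Y [S [T []]]]]].
move=> [Psi [[Phi [sPhi PhiE]] [Psi' [sPsi PsiE]] DPhi PsiK]] [[S' [sS S'E]] S0] [_ T0] gE hE.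
case: q => x y [[qK gq] gxq] hq.
have [pK _] := DPhi _ qK; rewrite /= in pK; set p := (X (x, y), Y y) in pK *.
have gp : g p = 0.
  move/eqP: gq; rewrite gE//= mulf_eq0 gt_eqF/=; last exact: S0.
  by move/eqP.
exists p; split=> //; last first.
  have qc : critical_set K gt (x, y) by [].
  move/eqP: hq; rewrite hE//= mulf_eq0 gt_eqF/=; last exact: T0.
  by move/eqP.
have sg : smooth g by case: Vg.
have sgt : smooth gt by case: Vgt.
have /= /andP[xl xh] := V_f_x_interior Vgt qK gq.
(* The point is off the vertical sides, so identities valid on the window can be differentiated in x
   from both sides. *)
have inK : \forall u \near x, rect K (u, y).
  have N1 : \forall u \near x, xlo K < u by exact: lt_nbhsr.
  have N2 : \forall u \near x, u < xhi K by exact: lt_nbhsl.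
  near=> u; split; last by case: qK.
  by apply/andP; split; apply: ltW; near: u.
pose c (u : R) : R := (Phi (u, y)).1.
have cx : c x = p.1 by rewrite /c PhiE.
have cD := derivableP (@smooth_slice_fst Phi x y sPhi); rewrite -/c in cD.
(* Differentiate Psi(X(u, y), Y(y)).1 = u: as [Y y] is constant in u, the chain rule gives a single
   product equal to 1. *)
have dc0 : 'D_1 c x != 0.
  have fD := derivableP (@smooth_slice_fst Psi' (c x) (Y y) sPsi).
  have D1 := @is_derive1_comp R _ c x _ _ fD cD.
  have D2 : is_derive x (1 : R) id ('D_1 (fun u => (Psi' (u, Y y)).1) (c x) * 'D_1 c x).
    apply: near_eq_is_derive D1; near=> u; have uK : rect K (u, y) by near: u.
    have [uK' _] := DPhi _ uK; have [Psiu _] := PsiK _ uK.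
    by rewrite /= /c PhiE//= PsiE// Psiu.
  have [_] := D2; rewrite derive_id => E; apply/eqP => Z.
  by move/eqP: E; rewrite Z mulr0 oner_eq0.
have gD := C1_dx (smooth_C1_plane sg) p.1 p.2; rewrite -cx in gD.
have SD := C1_dx (smooth_C1_plane sS) x y.
have mD := is_deriveM SD (@is_derive1_comp R (fun u => g (u, p.2)) c x _ _ gD cD).
have gtD : is_derive x (1 : R) (fun u => gt (u, y)) (S (x, y) * (partial_x g p * 'D_1 c x)).
  apply: near_eq_is_derive (is_derive_eq mD _).
    near=> u; have uK : rect K (u, y) by near: u.
    by have -> : gt (u, y) = S' (u, y) * g (c u, p.2) by rewrite gE// S'E// /c PhiE.
  by rewrite /= cx -surjective_pairing gp scale0r addr0 S'E.
have [_ E] := gtD; have := C1_dx (smooth_C1_plane sgt) x y; rewrite gxq => -[_ E'].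
move/eqP: E; rewrite E' eq_sym !mulf_eq0 (negbTE dc0) orbF gt_eqF/=; last exact: S0.
by move/eqP.
Unshelve. all: by end_near. Qed.

End transport.

Section nonvanishing.
Context {R : realType} (K : window R).

(* Pigeonhole: the m^3 points of a grid of mesh e/m would have preimages in distinct
   cells of an (n+1) x (n+1) subdivision of the window, with n of order m. *)
Lemma lipschitz_misses (f0 f1 f2 : R * R -> R) (C e : R) : 0 < C -> 0 < e ->
  (forall p q, rect K p -> rect K q ->
     [/\ `|f0 p - f0 q| <= C * (`|p.1 - q.1| + `|p.2 - q.2|),
         `|f1 p - f1 q| <= C * (`|p.1 - q.1| + `|p.2 - q.2|) &
         `|f2 p - f2 q| <= C * (`|p.1 - q.1| + `|p.2 - q.2|)]) ->
  exists a b c, [/\ 0 <= a < e, 0 <= b < e, 0 <= c < e &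
    forall p, rect K p -> ~ [/\ f0 p = a, f1 p = b & f2 p = c]].
Proof.
move=> C0 e0 lip; apply: contrapT => none.
have {}none (a b c : R) : 0 <= a < e -> 0 <= b < e -> 0 <= c < e ->
    exists p, rect K p /\ [/\ f0 p = a, f1 p = b & f2 p = c].
  move=> ha hb hc; apply: contrapT => np; apply: none; exists a, b, c; split=> // p pK fp.
  by apply: np; exists p.
pose W1 := xhi K - xlo K; pose W2 := yhi K - ylo K.
have W10 : 0 < W1 by rewrite subr_gt0 xlo_lt_xhi.
have W20 : 0 < W2 by rewrite subr_gt0 ylo_lt_yhi.
have [m [n [m_gt0 n_gt0 fine_ many]]] : exists m n, [/\ (0 < m)%N, (0 < n)%N,
    C * ((W1 + W2) / n%:R) < e / m%:R & (n.+1 * n.+1 < m * m * m)%N].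
  have := truncnS_gt (C * (W1 + W2) / e); set N := _.+1 => N0.
  have N1 : (0 < N)%N by [].
  (* With N > C (W1 + W2) / e, m = 4 N^2 + 1 and n = N m, the mesh bound reads C (W1 + W2) / N < e,
     and (n + 1)^2 <= (2 n)^2 = 4 N^2 m^2 < m^3. *)
  clearbody N; exists (4 * N ^ 2).+1%N, (N * (4 * N ^ 2).+1)%N.
  set m := (4 * N ^ 2).+1.
  have mE : m = (4 * (N * N) + 1)%N by rewrite /m addn1 mulnn.
  have m0 : (0 < m)%N by [].
  clearbody m; split=> //.
  - by rewrite muln_gt0 N1.
  - have Npos : 0 < N%:R :> R by rewrite ltr0n.
    have mpos : 0 < m%:R :> R by rewrite ltr0n.
    have -> : C * ((W1 + W2) / (N * m)%:R) = (C * (W1 + W2) / N%:R) / m%:R.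
      by rewrite natrM; field; rewrite !gt_eqF.
    by rewrite ltr_pM2r ?invr_gt0// ltr_pdivrMr// [e * _]mulrC -ltr_pdivrMr.
  - have h1 : ((N * m).+1 <= 2 * (N * m))%N by rewrite mul2n -addnn -addn1 leq_add2l muln_gt0 N1.
    have h2 : ((N * m).+1 * (N * m).+1 <= 4 * (N * N) * (m * m))%N
      by have := leq_mul h1 h1; rewrite mulnACA [(N * m * _)%N]mulnACA mulnA.
    by apply: (leq_ltn_trans h2); rewrite [(4 * (N * N) * _)%N]mulnC ltn_pmul2l ?muln_gt0 ?m0// mE addn1.
have m0 : 0 < m%:R :> R by rewrite ltr0n.
have n0 : 0 < n%:R :> R by rewrite ltr0n.
pose v (i : 'I_m) : R := e * i%:R / m%:R.
have vb i : 0 <= v i < e.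
  by rewrite /v divr_ge0 ?mulr_ge0 ?(ltW e0)//= ltr_pdivrMr// ltr_pM2l// ltr_nat.
have ex (t : 'I_m * 'I_m * 'I_m) : exists p, rect K p /\
    [/\ f0 p = v t.1.1, f1 p = v t.1.2 & f2 p = v t.2] by exact: none.
have [P HP] := choice ex.
(* The far end of each side of the window has index n, whence n + 1 cells in each direction. *)
pose cell (p : R * R) : 'I_n.+1 * 'I_n.+1 :=
  (inord (Num.truncn ((p.1 - xlo K) / W1 * n%:R)),
   inord (Num.truncn ((p.2 - ylo K) / W2 * n%:R))).
have cellP (w z z' : R) : 0 < w -> 0 <= z <= w -> 0 <= z' <= w ->
    inord (Num.truncn (z / w * n%:R)) = inord (Num.truncn (z' / w * n%:R)) :> 'I_n.+1 ->
    `|z - z'| < w / n%:R.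
  move=> w0 /andP[z0 zw] /andP[z0' zw'] /(congr1 val) /=.
  have le y : 0 <= y -> y <= w -> 0 <= y / w * n%:R /\ (Num.truncn (y / w * n%:R) < n.+1)%N.
    move=> y0 yw; split; first by rewrite mulr_ge0// divr_ge0 ?(ltW w0).
    rewrite ltnS truncn_le_nat; apply: (@le_lt_trans _ _ n%:R); last by rewrite ltr_nat.
    by rewrite ler_piMl// ler_pdivrMr// mul1r.
  have [h1 h2] := le _ z0 zw; have [h1' h2'] := le _ z0' zw'.
  rewrite !inordK// => E.
  have := truncn_itv h1; have := truncn_itv h1'; rewrite E => /andP[a b] /andP[c d].
  have : `|z / w * n%:R - z' / w * n%:R| < 1.
    rewrite ltr_distl; rewrite -natr1 in b; rewrite -natr1 in d; clear -a b c d; lra.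
  rewrite -mulrBl -mulrBl !normrM normfV (gtr0_norm w0) (gtr0_norm n0) => h.
  rewrite ltr_pdivlMr//; move: h; rewrite -(ltr_pM2r w0) mul1r mulrAC.
  by rewrite divfK// gt_eqF.
have inj : injective (cell \o P).
  move=> s t /= [E1 E2].
  have [[/= x1 y1] [a0 a1 a2]] := HP s; have [[/= x2 y2] [b0 b1 b2]] := HP t.
  have D1 : `|(P s).1 - (P t).1| < W1 / n%:R.
    have -> : (P s).1 - (P t).1 = ((P s).1 - xlo K) - ((P t).1 - xlo K) by ring.
    apply: cellP => //.
      by move: x1 => /andP[u w]; rewrite subr_ge0 u/= lerD2r.
    by move: x2 => /andP[u w]; rewrite subr_ge0 u/= lerD2r.
  have D2 : `|(P s).2 - (P t).2| < W2 / n%:R.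
    have -> : (P s).2 - (P t).2 = ((P s).2 - ylo K) - ((P t).2 - ylo K) by ring.
    apply: cellP => //.
      by move: y1 => /andP[u w]; rewrite subr_ge0 u/= lerD2r.
    by move: y2 => /andP[u w]; rewrite subr_ge0 u/= lerD2r.
  have [L0 L1 L2] := lip (P s) (P t) (HP s).1 (HP t).1.
  have bound : C * (`|(P s).1 - (P t).1| + `|(P s).2 - (P t).2|) < e / m%:R.
    apply: (@lt_trans _ _ (C * ((W1 + W2) / n%:R))).
      by rewrite ltr_pM2l// mulrDl ltrD.
    exact: fine_.
  (* Distinct grid values differ by at least e/m. *)
  have close i j : `|v i - v j| < e / m%:R -> i = j.
    rewrite /v -mulrBl -mulrBr !normrM (gtr0_norm e0) normfV (gtr0_norm m0).
    rewrite ltr_pM2r ?invr_gt0// -[X in _ < X]mulr1 ltr_pM2l// => h.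
    move: h; rewrite ltr_distl => /andP[u w].
    apply/val_inj/eqP; rewrite /= eqn_leq; apply/andP; split;
      rewrite -ltnS -(ltr_nat R) -natr1; clear -u w; lra.
  move: s t {E1 E2 D1 D2 x1 y1 x2 y2} a0 a1 a2 b0 b1 b2 L0 L1 L2 bound
    => [[s0 s1] s2] [[t0 t1] t2] /= -> -> -> -> -> -> L0 L1 L2 bound.
  congr (_, _, _); apply: close.
  - exact: le_lt_trans bound.
  - exact: le_lt_trans bound.
  - exact: le_lt_trans bound.
by have := leq_card _ inj; rewrite !card_prod !card_ord leqNgt many.
Qed.

Lemma fold_unfolding_smooth (g h : R * R -> R) : smooth g -> smooth h ->
  unfolding g h
    (fun q : (R * R) * 'rV[R]_3 => g q.1 + - (q.2 0 0 + q.2 0 1 * q.1.1))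
    (fun q => h q.1 + - q.2 0 2).
Proof.
move=> sg sh; split.
- move=> k; apply: Ck_add; first exact: Ck_fst (sg k).
  apply: Ck_opp; apply: Ck_add; first exact: Ck_snd (Ck_coord k _).
  apply: Ck_mul; first exact: Ck_snd (Ck_coord k _).
  by apply: (@Ck_fst _ _ _ _ k (fun p : R * R => p.1)); exact: Ck_proj1.
- move=> k; apply: Ck_add; first exact: Ck_fst (sh k).
  by apply: Ck_opp; exact: Ck_snd (Ck_coord k _).
- by split=> p /=; rewrite !mxE ?mul0r ?addr0 oppr0 addr0.
Qed.

Lemma persistent_fold_neq0 (g h : R * R -> R) q :
  V_f K g -> V_s K h -> persistent_system K g h -> fold_set K g q -> h q != 0.
Proof.
move=> [sg _ _] [sh _] pers fq; apply/eqP => hq.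
have := pers _ _ _ (fold_unfolding_smooth sg sh).
move=> /nbhs_ballP[e /= e0 He].
have sgx : smooth (partial_x g) by exact: smooth_derive.
have Cg := smooth_C1_plane sg; have Cgx := smooth_C1_plane sgx; have Ch := smooth_C1_plane sh.
have xK := ltW (xlo_lt_xhi K); have yK := ltW (ylo_lt_yhi K).
have [A A0 HA] := C1_lipschitz Cg xK yK.
have [B B0 HB] := C1_lipschitz Cgx xK yK.
have [D D0 HD] := C1_lipschitz Ch xK yK.
have [M M0 HM] := bounded_on_rectangle xK yK (smooth_continuous sgx).
pose X := `|xlo K| + `|xhi K|.
have X0 : 0 <= X by rewrite addr_ge0.
have HX p : rect K p -> `|p.1| <= X.
  move=> [/= /andP[x1 x2] _]; rewrite ler_norml /X.
  have := ler_norm (xhi K); have := ler_norm (- xlo K); rewrite normrN.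
  have := normr_ge0 (xhi K); have := normr_ge0 (xlo K); clear -x1 x2 => *; lra.
(* One constant for all three functions. For g - x g_x the part A + M + B X serves, since the
   increment from p' to p is dg - dx g_x(p) - x' dg_x, with x' the abscissa of p'. *)
pose C := A + B * X + M + B + D.
have BX : 0 <= B * X by rewrite mulr_ge0// ltW.
have C0 : 0 < C by rewrite /C; clear -A0 B0 D0 M0 BX; lra.
have [|a [b [c [ha hb hc none]]]] := @lipschitz_misses
    (fun p => g p - p.1 * partial_x g p) (partial_x g) h C e C0 e0.
- move=> p p' pK pK'.
  have {HA}hA := HA p p' pK.1 pK.2 pK'.1 pK'.2.
  have {HB}hB := HB p p' pK.1 pK.2 pK'.1 pK'.2.
  have {HD}hD := HD p p' pK.1 pK.2 pK'.1 pK'.2.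
  have hM := HM p pK.1 pK.2; have hX := HX _ pK'.
  have n1 := normr_ge0 (p.1 - p'.1); have n2 := normr_ge0 (p.2 - p'.2).
  set S := `|p.1 - p'.1| + `|p.2 - p'.2| in hA hB hD *.
  have S0 : 0 <= S by rewrite addr_ge0.
  split.
  + have -> : g p - p.1 * partial_x g p - (g p' - p'.1 * partial_x g p') =
      (g p - g p') - (p.1 - p'.1) * partial_x g p - p'.1 * (partial_x g p - partial_x g p').
      by ring.
    apply: (le_trans (ler_normB _ _)).
    apply: (@le_trans _ _ (A * S + S * M + X * (B * S))).
      apply: lerD; last by rewrite normrM ler_pM.
      apply: (le_trans (ler_normB _ _)); apply: lerD => //.
      by rewrite normrM ler_pM// lerDl.
    have -> : A * S + S * M + X * (B * S) = (A + M + B * X) * S by ring.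
    by apply: ler_wpM2r => //; rewrite /C; clear -B0 D0; lra.
  + by apply: le_trans hB _; apply: ler_wpM2r => //; rewrite /C; clear -A0 M0 D0 BX; lra.
  + by apply: le_trans hD _; apply: ler_wpM2r => //; rewrite /C; clear -A0 M0 B0 BX; lra.
pose l : 'rV[R]_3 := \row_j (if j == 0 then a else if j == 1 then b else c).
have l0 : l 0 0 = a by rewrite mxE.
have l1 : l 0 1 = b by rewrite mxE.
have l2 : l 0 2 = c by rewrite mxE.
have lb : ball (0 : 'rV[R]_3) e l.
  split=> // i j; rewrite -ball_normE /ball_/= !mxE sub0r normrN.
  move: ha hb hc => /andP[a0 ae] /andP[b0 be] /andP[c0 ce].
  by case: ifP => _; [|case: ifP => _]; rewrite ger0_norm.
have := He _ lb => eq.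
have [p [pK gp gxp hp]] := equivalence_fold_zero eq fq hq.
apply: (none p pK); move: gp hp gxp => /=; rewrite l0 l1 l2 => gp hp gxp.
(* For G = g - a - b x and H = h - c, the equations G = G_x = H = 0 amount to g_x = b, g - x g_x = a
   and h = c: exactly the missed value. *)
have gxE : partial_x g p = b.
  have gD := C1_dx Cg p.1 p.2.
  have aD : is_derive p.1 (1 : R) (fun u => a + b * u) (b * 1).
    by rewrite -[b * 1]add0r; apply: is_deriveD.
  have [_ E] := is_deriveB gD aD; rewrite mulr1 -surjective_pairing in E.
  have sG : smooth (fun q => g q + - (a + b * q.1)).
    move=> k; apply: Ck_add; first exact: sg.
    apply: Ck_opp; apply: Ck_add; first exact: Ck_cst.
    by apply: Ck_mul; [exact: Ck_cst|exact: Ck_proj1].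
  have [_ E'] := C1_dx (smooth_C1_plane sG) p.1 p.2.
  rewrite -surjective_pairing gxp in E'.
  by apply/eqP; rewrite -subr_eq0 -E; apply/eqP; exact: E'.
split=> //; last by apply/eqP; rewrite -subr_eq0 hp.
by rewrite gxE; clear -gp; lra.
Qed.

End nonvanishing.

(** * Persistence of oscillations *)

Section oscillations.
Context {R : realType} (K : window R).
Implicit Types (g h : R * R -> R) (p q : R * R).

Lemma two_points_card p q (S : set (R * R)) : S p -> S q -> p != q -> (`I_2 #<= S)%card.
Proof.
move=> Sp Sq pq; pose f (n : nat) := if n == 0%N then p else q.
have fI : {in `I_2 &, injective f}.
  move=> i j; rewrite !inE /= => hi hj.
  case: i hi => [|[|i]] // _; case: j hj => [|[|j]] // _; rewrite /f/= => E.
    by rewrite E eqxx in pq.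
  by rewrite E eqxx in pq.
apply: (@card_le_trans _ _ _ (f @` `I_2)).
  by have := inj_card_eq fI; rewrite card_eq_sym => /card_eqPle[].
apply: subset_card_le => z [n _ <-].
by case: n => [|n]; [exact: Sp|exact: Sq].
Qed.

Lemma singleton_card p (S : set (R * R)) : S `<=` [set p] -> ~ (`I_2 #<= S)%card.
Proof.
move=> Sp S2; have := card_le_trans S2 (subset_card_le Sp).
have /card_eqPle[h _] := @card_set1 _ p.
by move=> /card_le_trans/(_ h); rewrite card_le_II.
Qed.

Lemma critical_inside g p : V_f K g -> rect K p -> g p = 0 -> ylo K < p.2 < yhi K ->
  rect_inside K p.
Proof. by move=> Vg pK gp py; split=> //; exact: V_f_x_interior Vg pK gp. Qed.

Lemma fold_inside g p : V_f K g -> fold_set K g p -> rect_inside K p.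
Proof.
move=> Vg [[pK gp] gxp]; apply: (critical_inside Vg pK gp).
case: Vg => _ _ by_; case: p pK gp gxp => x y [/= xK /andP[y1 y2]] gp gxp.
have nb : ~ [set ylo K; yhi K] y.
  by move=> yb; have := by_ x y xK yb gp; rewrite gxp eqxx.
by rewrite !lt_neqAle y1 y2 !andbT; apply/andP; split; apply/eqP => E;
  apply: nb; [left|right].
Qed.

(** A constant reparametrisation makes the time set {0}, whose interior is empty; the differential
    equation is then vacuous and any critical point qualifies, at rest or not. *)
Lemma constant_slow_segment g h p : critical_set K g p -> slow_segment K g h (fun=> p).
Proof.
move=> pc; split.
- by apply: continuous_subspaceT => t; exact: cvg_cst.
- by move=> *; case: pc.
exists (fun=> 0), (fun=> p); split=> //.
- by apply: continuous_subspaceT => t; exact: cvg_cst.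
split.
- by apply: continuous_subspaceT => t; exact: cvg_cst.
- by [].
- move=> t tI; exfalso.
  have sub : (fun _ : R => 0 : R) @` `]0, 1[ `<=` [set 0] by move=> _ [? _ <-].
  by have := interiorS sub tI; rewrite interior_set1.
Qed.

Lemma constant_oscillation g h p : critical_att K g p ->
  simple_oscillation K g h (fun (_ : 'I_1) (_ : R) => p).
Proof.
move=> pa; have pc : critical_set K g p by case: pa.
split.
- split=> //; first by move=> _; exact: constant_slow_segment.
  by left; split=> // _; split=> // th _; exact: subset_closure.
(* At an equilibrium the constant segment is traversed in some positive time, so its duration is not
   0; the period is finite in both cases. *)
- have [[tau tr]|ntr] := pselect (exists tau, traversed_in K g h (fun=> p) tau).
    exists (\sum_(k < 1) tau%:E)%E; split; last by rewrite big_ord1.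
    by exists (fun=> tau%:E); split=> // _; left; exists tau.
  exists (\sum_(k < 1) 0%:E)%E; split; last by rewrite big_ord1.
  exists (fun=> 0%:E); split=> // _; right; split; first by move=> tau tr; apply: ntr; exists tau.
  by left.
- by [].
- by right.
Qed.

(** A finite sum of extended reals has finite terms, which excludes infinite durations. *)
Lemma finite_period_duration g h (d : nat) (A : 'I_d -> R -> R * R) :
  (exists P : \bar R, slow_period K g h A P /\ P \is a fin_num) ->
  forall k, (exists tau, traversed_in K g h (A k) tau) \/ trivial_segment (A k).
Proof.
move=> [P [[T [TA ->]] /sum_fin_numP fin]] k.
have := fin k (mem_index_enum _) isT.
by have [[tau [tr _]]|[_ [[tr _]|[_ ->]]]] := TA k => //= _; [left; exists tau|right].
Qed.

(* y returns to its initial value, so h vanishes somewhere on the curve; by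
   uniqueness the curve rests at that point. *)
Lemma closed_segment_constant g h (s : R -> R * R) :
  smooth g -> smooth h ->
  (exists tau, traversed_in K g h s tau) \/ trivial_segment s ->
  (forall th, 0 <= th < 1 -> critical_att K g (s th)) -> s 1 = s 0 ->
  forall th, 0 <= th <= 1 -> s th = s 0.
Proof.
move=> sg sh [[tau [tau0 [sigma [gamma [[sc smono] [s0 s1] [gc gcrit gd] sE]]]]]|//] satt s10.
have satt' th : 0 <= th <= 1 -> critical_att K g (s th).
  move=> /andP[t0]; rewrite le_eqVlt => /orP[/eqP->|t1]; last by apply: satt; rewrite t0.
  by rewrite s10; apply: satt; rewrite lexx ltr01.
have srange th : 0 <= th <= 1 -> 0 <= sigma th <= tau.
  by move=> /andP[t0 t1]; rewrite -{1}s0 -s1 !smono ?lexx ?ler01.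
have z01 : (0 : R) <= 0 <= (1 : R) by apply/andP; split.
have o01 : (0 : R) <= 1 <= (1 : R) by apply/andP; split.
have g0 t : 0 <= t <= tau -> g (gamma t) = 0.
  by move=> ht; have [] := gcrit t _; rewrite //= in_itv.
have gd' t : 0 < t < tau -> is_derive t (1 : R) (fun u => (gamma u).2) (h (gamma t)).
  by move=> ht; apply: gd; rewrite interior_itv/= in_itv.
have yc : {within `[0, tau], continuous (fun u => (gamma u).2)}.
  by move=> t; apply: (@for_continuous_snd (subspace `[0, tau])); exact: gc.
have gd'' t : t \in `]0, tau[%R -> is_derive t (1 : R) (fun u => (gamma u).2) (h (gamma t)).
  by rewrite in_itv/=; exact: gd'.
have [c] := MVT tau0 gd'' yc.
rewrite in_itv/= => /andP[c0 ct].
have -> : gamma tau = gamma 0 by rewrite -s1 -s0 -!sE.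
rewrite subrr subr0 => /esym/eqP; rewrite mulf_eq0 (gt_eqF tau0) orbF => /eqP hc.
have ct' : 0 <= c <= tau by rewrite !ltW.
have gxc : partial_x g (gamma c) < 0.
  have [|th] := @IVT R sigma 0 1 c ler01 sc.
    by rewrite s0 s1 min_l ?max_r ?(ltW tau0).
  by rewrite /= in_itv/= => h01 <-; rewrite -sE//; have [] := satt' _ h01.
have cst := slow_rest (smooth_C1_plane sg) (smooth_C1_plane sh) gc g0 gd' ct' gxc hc.
by move=> th h01; rewrite !sE// !cst ?srange.
Qed.

Lemma constant_persists g h (A : 'I_1 -> R -> R * R) :
  V_f K g -> V_s K h -> simple_oscillation K g h A ->
  (forall k, A k 1 = A k 0) -> persistent_oscillation K g h A.
Proof.
move=> Vg [sh _] [_ fin Aatt _] A10 r G H [sG sH [G0 H0]] e e0.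
have gE : g = (fun p => G (p, 0)) by apply/funext => p; rewrite G0.
have sg : smooth g by case: Vg.
have C := smooth_C2_family sG.
have Acst th : 0 <= th <= 1 -> A ord0 th = A ord0 0.
  exact: closed_segment_constant sg sh (finite_period_duration fin ord0) (Aatt ord0) (A10 ord0) th.
have [[pK gp] gxp] : critical_att K g (A ord0 0).
  by apply: Aatt; rewrite lexx ltr01.
set p := A ord0 0 in pK gp gxp Acst.
have /andP[xl xh] := V_f_x_interior Vg pK gp.
have gp' : G (p, 0) = 0 by rewrite G0.
have gxp' : 'D_((1, 0), 0) G (p, 0) < 0.
  by rewrite -(partial_x_family p 0 sG) -gE.
(* The distances of p to the vertical sides keep the new zero inside the window. *)
pose e1 := Num.min e (Num.min (p.1 - xlo K) (xhi K - p.1)).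
have e10 : 0 < e1 by rewrite !lt_min e0 !subr_gt0 xl xh.
have /nbhs_box[d d0 Hd] := attracting_zero_near C gp' gxp' e10.
near=> l.
have Hl : forall y, `|y - p.2| < d -> exists x, [/\ `|x - p.1| < e1,
    G ((x, y), l) = 0 & 'D_((1, 0), 0) G ((x, y), l) < 0] by near: l.
have [|x [xe Gx0 Gxx0]] := Hl p.2; first by rewrite subrr normr0.
move: xe; rewrite !lt_min => /and3P[xe x1 x2].
exists (fun _ _ => (x, p.2)); split.
  apply: constant_oscillation; split; last by rewrite partial_x_family.
  split=> //; split; last by case: pK.
  rewrite ltr_distl in x1; rewrite ltr_distl in x2.
  by rewrite /fast_range /=; clear -x1 x2; lra.
move=> k th hth; rewrite (ord1 k) Acst// norm_lt_pair/= subrr normr0; split=> //.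
Unshelve. all: by end_near. Qed.

End oscillations.

(** * Oscillations with jumps at folds *)

Section fold_case.
Context {R : realType} (K : window R).

(** The cardinality clause is turned into uniqueness on the fibre, the form that [fold_fibre_unique]
    carries over to perturbed systems. *)
Lemma nondegenerate_fold (g : R * R -> R) p :
  (fold_set K g `\` degenerate_folds K g) p <->
  [/\ fold_set K g p, partial_x (partial_x g) p != 0, partial_y g p != 0 &
    forall x, fast_range K x -> g (x, p.2) = 0 -> partial_x g (x, p.2) = 0 -> x = p.1].
Proof.
split=> [[fp nd]|[fp gxx gy uniq]].
  split=> //.
  - by apply/eqP => E; apply: nd; split=> //; exact: Or32.
  - by apply/eqP => E; apply: nd; split=> //; exact: Or31.
  - move=> x xK gx0 gxx0; apply: contrapT => /eqP ne; apply: nd; split=> //; apply: Or33.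
    apply: (@two_points_card _ (x, p.2) p).
    + by split=> //; split=> //; split=> //; split=> //; case: fp => [[[]]].
    + by split.
    + by apply: contra ne => /eqP <-.
split=> // -[_ [E|E|E]].
- by rewrite E eqxx in gy.
- by rewrite E eqxx in gxx.
apply: (@singleton_card _ p _ _ E) => -[x y] [[[[xK yK] gq] gxq] /= yp].
by rewrite yp in gq gxq *; rewrite (uniq x) -?surjective_pairing.
Qed.

Lemma jump_same_fibre (g : R * R -> R) (phi : R -> R * R) (p q : R * R) :
  fast_trajectory K g phi -> phi t @[t --> -oo] --> p -> phi t @[t --> +oo] --> q ->
  forall t, (phi t).2 = p.2 /\ (phi t).2 = q.2.
Proof.
move=> tr pa pb t.
have cst s : (phi s).2 = (phi t).2.
  by apply: (@is_derive_0_is_cst R (fun u => (phi u).2)) => u; case: (tr u).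
have ca : (phi s).2 @[s --> -oo] --> p.2.
  by apply: (cvg_comp _ _ pa); exact: cvg_snd.
have cb : (phi s).2 @[s --> +oo] --> q.2.
  by apply: (cvg_comp _ _ pb); exact: cvg_snd.
have E : (fun s => (phi s).2) = (fun=> (phi t).2) by apply/funext.
rewrite E in ca cb; split.
  exact: (cvg_unique _ (@cvg_cst _ _ _ _ _) ca).
exact: (cvg_unique _ (@cvg_cst _ _ _ _ _) cb).
Qed.

(* At the window's y-boundary y would be extremal along the segment, so h would vanish. *)
Lemma segment_inside (g h : R * R -> R) (s : R -> R * R) tau :
  V_f K g -> traversed_in K g h s tau -> (forall th, 0 <= th <= 1 -> h (s th) != 0) ->
  rect_inside K (s 0) -> rect_inside K (s 1) ->
  forall th, 0 <= th <= 1 -> rect_inside K (s th).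
Proof.
move=> Vg [tau0 [sigma [gamma [[sc smono] [s0 s1] [gc gcrit gd] sE]]]] hn i0 i1 th h01.
have srange u : 0 <= u <= 1 -> 0 <= sigma u <= tau.
  by move=> /andP[t0 t1]; rewrite -{1}s0 -s1 !smono ?lexx ?ler01.
have z01 : (0 : R) <= 0 <= (1 : R) by apply/andP; split.
have o01 : (0 : R) <= 1 <= (1 : R) by apply/andP; split.
have hng t : 0 <= t <= tau -> h (gamma t) != 0.
  move=> ht; have [|u] := @IVT R sigma 0 1 t ler01 sc.
    by rewrite s0 s1 min_l ?max_r ?(ltW tau0).
  by rewrite /= in_itv/= => u01 <-; rewrite -sE//; exact: hn.
have st := srange _ h01; rewrite sE//; set t := sigma th in st *.
have tI : `[0, tau]%classic t by rewrite /= in_itv.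
have [tK gt0] := gcrit _ tI.
apply: (critical_inside Vg tK gt0).
have [t0|t0] := eqVneq t 0.
  by rewrite t0 -s0 -sE//; case: i0.
have [t1|t1] := eqVneq t tau.
  by rewrite t1 -s1 -sE//; case: i1.
have tint : t \in `]0, tau[%R.
  by rewrite in_itv/= !lt_neqAle eq_sym t0 t1.
have rng z : z \in `]0, tau[%R -> ylo K <= (gamma z).2 <= yhi K.
  rewrite in_itv/= => /andP[z0 z1]; have [|[_ //]] := gcrit z.
  by rewrite /= in_itv/= !ltW.
have dr z : z \in `]0, tau[%R -> derivable (fun u => (gamma u).2) z 1.
  by move=> hz; have [|d _] := gd z; first by rewrite interior_itv.
have gdt : is_derive t (1 : R) (fun u => (gamma u).2) (h (gamma t)).
  by apply: gd; rewrite interior_itv.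
have /andP[y1 y2] := rng _ tint.
have nz : ~ is_derive t (1 : R) (fun u => (gamma u).2) 0.
  move=> [_ E]; have := hng _ st; case: gdt => _ <-.
  by rewrite E eqxx.
rewrite !lt_neqAle y1 y2 !andbT; apply/andP; split; apply/eqP => E; apply: nz.
- apply: (derive1_at_min (ltW tau0) dr tint) => z /rng/andP[zl _].
  by rewrite -E.
- apply: (derive1_at_max (ltW tau0) dr tint) => z /rng/andP[_ zh].
  by rewrite E.
Qed.

Lemma smooth_family_partials r (G : (R * R) * 'rV[R]_r -> R) : smooth G ->
  exists Gx Gy Gxx, [/\ C2_family G Gx Gy Gxx,
    forall p l, partial_x (fun p => G (p, l)) p = Gx (p, l),
    forall p l, partial_y (fun p => G (p, l)) p = Gy (p, l) &
    forall p l, partial_x (partial_x (fun p => G (p, l))) p = Gxx (p, l)].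
Proof.
move=> sG; do 3 eexists; split; first exact: smooth_C2_family sG.
- by move=> p l; exact: partial_x_family.
- by move=> p l; exact: partial_y_family.
- by move=> p l; exact: partial_xx_family.
Qed.

(** The ends of a segment come from two jumps: segment k starts where jump k - 1 lands and ends at
    the fold of jump k. Jumps are therefore perturbed on their own, and each segment is then
    continued between the end points that they prescribe. *)
Lemma fold_oscillation_persists (g h : R * R -> R) (d : nat) (A : 'I_d -> R -> R * R) :
  V_f K g -> V_s K h -> simple_oscillation K g h A ->
  (forall p, fold_set K g p -> h p != 0) ->
  (forall k, (fold_set K g `\` degenerate_folds K g) (A k 1)) ->
  persistent_oscillation K g h A.
Proof.
move=> Vg Vh [[d0 _ relax] fin Aatt _] hfold Afold r G H [sG sH [G0 H0]] e e0.
have gE : g = (fun p => G (p, 0)) by apply/funext => p; rewrite G0.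
have hE : h = (fun p => H (p, 0)) by apply/funext => p; rewrite H0.
have sg : smooth g by case: Vg.
have sh : smooth h by case: Vh.
have Hc := smooth_continuous sH.
have [Gx [Gy [Gxx [C GxE GyE GxxE]]]] := smooth_family_partials sG.
have gxE p : partial_x g p = Gx (p, 0) by rewrite -GxE -gE.
have gyE p : partial_y g p = Gy (p, 0) by rewrite -GyE -gE.
have gxxE p : partial_x (partial_x g) p = Gxx (p, 0) by rewrite -GxxE -gE.
have z01 : (0 : R) <= 0 < (1 : R) by apply/andP; split.
have z01' : (0 : R) <= 0 <= (1 : R) by apply/andP; split.
have o01 : (0 : R) <= 1 <= (1 : R) by apply/andP; split.
have att0 k : G (A k 0, 0) = 0 /\ Gx (A k 0, 0) < 0.
  by have [[_ a] b] := Aatt k 0 z01; rewrite G0 -gxE.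
have fold1 k : [/\ G (A k 1, 0) = 0, Gx (A k 1, 0) = 0, Gxx (A k 1, 0) != 0 & Gy (A k 1, 0) != 0].
  have [[[_ a] b] c f _] := iffLR (nondegenerate_fold _ _) (Afold k).
  by rewrite G0 -gxE -gxxE -gyE.
have foldu k x : fast_range K x -> G ((x, (A k 1).2), 0) = 0 ->
    Gx ((x, (A k 1).2), 0) = 0 -> x = (A k 1).1.
  have [_ _ _ u] := iffLR (nondegenerate_fold _ _) (Afold k).
  by rewrite G0 -gxE; exact: u.
(* In the loop alternative the end of a segment would be both a fold and an attracting point. *)
have jump k : exists phi, [/\ fast_trajectory K g phi,
    phi t @[t --> -oo] --> A k 1 & phi t @[t --> +oo] --> A (ordS k) 0].
  case: relax => [[_ /(_ k)[A10 _]]|/(_ k)[_ //]].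
  have [_ gx0 _ _] := fold1 k; have [_ neg] := att0 k.
  by rewrite -A10 gx0 ltxx in neg.
have in1 k : rect_inside K (A k 1).
  by apply: (fold_inside Vg); case: (Afold k).
have same k : (A (ordS k) 0).2 = (A k 1).2.
  have [phi [tr pa pb]] := jump k.
  by have [<- <-] := jump_same_fibre tr pa pb 0.
have in0S k : rect_inside K (A (ordS k) 0).
  have [[rK gA] _] := Aatt (ordS k) 0 z01.
  by apply: (critical_inside Vg rK gA); rewrite same; case: (in1 k).
have in0 k : rect_inside K (A k 0) by rewrite -(ord_predK k).
(* The given orbit excludes zeros of g strictly between fold and landing point; attraction of the
   landing point then fixes the sign. *)
have btw k x : (x - (A k 1).1) * (x - (A (ordS k) 0).1) < 0 ->
    0 < ((A (ordS k) 0).1 - (A k 1).1) * G ((x, (A k 1).2), 0).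
  have [phi [tr pa pb]] := jump k.
  have phi2 t : phi t = ((phi t).1, (A k 1).2).
    by have [<- _] := jump_same_fibre tr pa pb t; rewrite -surjective_pairing.
  have pa1 : (phi t).1 @[t --> -oo] --> (A k 1).1.
    by apply: (cvg_comp _ _ pa); exact: cvg_fst.
  have pb1 : (phi t).1 @[t --> +oo] --> (A (ordS k) 0).1.
    by apply: (cvg_comp _ _ pb); exact: cvg_fst.
  have duc := @C2_along_x _ _ Gx (A k 1).2 0 (C2_contGx C).
  have ud z := C2_dx C z (A k 1).2 0.
  have psid t : is_derive t (1 : R) (fun s => (phi s).1) (G (((phi t).1, (A k 1).2), 0)).
    by rewrite -phi2 G0; case: (tr t).
  have [Ga Gxa] := att0 (ordS k); have [Gf Gxf _ _] := fold1 k.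
  have AS : A (ordS k) 0 = ((A (ordS k) 0).1, (A k 1).2).
    by rewrite -same -surjective_pairing.
  have ne : (A k 1).1 != (A (ordS k) 0).1.
    apply: contraTneq Gxa => E; rewrite -leNgt AS -E -surjective_pairing.
    by rewrite Gxf.
  move: x; apply: (sign_between ne duc ud); rewrite -?AS//.
  exact: (heteroclinic_neq0 duc ud psid pa1 pb1).
(* A trivial segment would start at its own fold, but it starts at an attracting point. *)
have trav k : exists tau, traversed_in K g h (A k) tau.
  have [//|triv] := finite_period_duration fin k.
  have [_ gx0 _ _] := fold1 k; have [_ neg] := att0 k.
  by rewrite -(triv 1 o01) gx0 ltxx in neg.
(* Before the fold, a zero of h would by [slow_rest] hold the whole segment at an attracting point,
   whereas its end is a fold. *)
have hA k th : 0 <= th <= 1 -> h (A k th) != 0.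
  move=> /andP[t0]; rewrite le_eqVlt => /orP[/eqP->|t1].
    by apply: hfold; case: (Afold k).
  apply/eqP => hz.
  have [tau [tau0 [sigma [gamma [[sc smono] [s0 s1] [gc gcrit gd] sE]]]]] := trav k.
  have srange u : 0 <= u <= 1 -> 0 <= sigma u <= tau.
    by move=> /andP[u0 u1]; rewrite -{1}s0 -s1 !smono ?lexx ?ler01.
  have th01 : 0 <= th <= 1 by rewrite t0 ltW.
  have thl : 0 <= th < 1 by rewrite t0.
  have g0 t : 0 <= t <= tau -> g (gamma t) = 0.
    by move=> ht; have [] := gcrit t _; rewrite //= in_itv.
  have gd' t : 0 < t < tau -> is_derive t (1 : R) (fun u => (gamma u).2) (h (gamma t)).
    by move=> ht; apply: gd; rewrite interior_itv/= in_itv.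
  have gxt : partial_x g (gamma (sigma th)) < 0 by rewrite -sE//; case: (Aatt k th thl).
  have hzt : h (gamma (sigma th)) = 0 by rewrite -sE.
  have cst := slow_rest (smooth_C1_plane sg) (smooth_C1_plane sh) gc g0 gd'
    (srange _ th01) gxt hzt.
  have [_ gx0 _ _] := fold1 k.
  by move: gxt; rewrite -(cst _ (srange 1 o01)) -sE// gxE gx0 ltxx.
pose segP (d : R) k (l : 'rV[R]_r) := forall s f,
    `|s - A k 0| < d -> `|f - A k 1| < d ->
    G (s, l) = 0 -> Gx (s, l) < 0 -> G (f, l) = 0 -> Gx (f, l) = 0 ->
    exists (B : R -> R * R) (tau' : R),
    [/\ traversed_in K (fun p => G (p, l)) (fun p => H (p, l)) B tau',
        B 0 = s, B 1 = f,
        forall th, 0 <= th <= 1 -> `|B th - A k th| < e /\ critical_set K (fun p => G (p, l)) (B th)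
      & forall th, 0 <= th < 1 -> Gx (B th, l) < 0].
have seg k : exists d : R, 0 < d /\ \forall l \near (0 : 'rV[R]_r), segP d k l.
  have [tau tr] := trav k; have tr' := tr; rewrite gE hE in tr'.
  have [Gf Gxf Gxxf Gyf] := fold1 k.
  have [||dk dk0 Hk] := segment_persists C Hc e0 tr' _ Gxf Gxxf Gyf _; last by exists dk.
    by move=> th hth; rewrite -gxE; case: (Aatt k th hth).
  move=> th hth; rewrite H0; split; last exact: hA.
  exact: segment_inside Vg tr (hA k) (in0 k) (in1 k) th hth.
have [ds hds] := choice seg.
have near_seg : \forall l \near (0 : 'rV[R]_r), forall k, segP (ds k) k l.
  apply: (@filter_forall _ _ (fun k => [set l | segP (ds k) k l])
    (nbhs (0 : 'rV[R]_r)) _) => k.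
  by case: (hds k).
(* Jump k must be accurate enough for both segments that it joins. *)
pose ej k := Num.min (ds k) (ds (ordS k)).
have ej0 k : 0 < ej k.
  by rewrite lt_min; case: (hds k) => -> _; case: (hds (ordS k)) => -> _.
pose jumpP k (l : 'rV[R]_r) (f s : R * R) := [/\ `|f - A k 1| < ej k /\ `|s - A (ordS k) 0| < ej k,
        [/\ rect_inside K f, G (f, l) = 0, Gx (f, l) = 0, Gxx (f, l) != 0 & Gy (f, l) != 0],
        forall x, fast_range K x -> G ((x, f.2), l) = 0 -> Gx ((x, f.2), l) = 0 -> x = f.1,
        [/\ rect_inside K s, G (s, l) = 0 & Gx (s, l) < 0] &
        exists phi : R -> R * R,
          [/\ fast_trajectory K (fun p => G (p, l)) phi,
            phi t @[t --> -oo] --> f & phi t @[t --> +oo] --> s]].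
have near_jump : \forall l \near (0 : 'rV[R]_r), forall k, exists f s, jumpP k l f s.
  apply: (@filter_forall _ _ (fun k => [set l | exists f s, jumpP k l f s])
    (nbhs (0 : 'rV[R]_r)) _) => k.
  have [Gf Gxf Gxxf Gyf] := fold1 k; have [Ga Gxa] := att0 (ordS k).
  exact: (jump_persists C (ej0 k) (in1 k) (in0S k) Gf Gxf Gxxf Gyf (foldu k) (same k) Ga Gxa (btw k)).
near=> l.
have segs : forall k, segP (ds k) k l by near: l.
have jumps : forall k, exists f s, jumpP k l f s by near: l.
have [f hf] := choice jumps; have [s hs] := choice hf.
have exB k : exists (Bt : (R -> R * R) * R),
    [/\ traversed_in K (fun p => G (p, l)) (fun p => H (p, l)) Bt.1 Bt.2,
        Bt.1 0 = s (ord_pred k), Bt.1 1 = f k,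
        forall th, 0 <= th <= 1 -> `|Bt.1 th - A k th| < e /\
          critical_set K (fun p => G (p, l)) (Bt.1 th)
      & forall th, 0 <= th < 1 -> Gx (Bt.1 th, l) < 0].
  have [[_ n1] _ _ [_ Gs Gxs] _] := hs (ord_pred k).
  have [[n2 _] [_ Gf Gxf _ _] _ _ _] := hs k.
  rewrite ord_predK lt_min ord_predK in n1; case/andP: n1 => _ n1.
  move: n2; rewrite lt_min => /andP[n2 _].
  have [B [tau' hB]] := segs k _ _ n1 n2 Gs Gxs Gf Gxf.
  by exists (B, tau').
have [Bt hBt] := choice exB.
exists (fun k => (Bt k).1); split; last first.
  by move=> k th hth; have [_ _ _ /(_ th hth)[]] := hBt k.
have Batt k th : 0 <= th < 1 -> critical_att K (fun p => G (p, l)) ((Bt k).1 th).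
  move=> hth; have [_ _ _ b1 b2] := hBt k; split; last by rewrite GxE; exact: b2.
  by have [|_] := b1 th; first by case/andP: hth => -> /ltW ->.
split.
- split=> //.
    by move=> k; have [tr _ _ _ _] := hBt k; exact: traversed_in_slow_segment tr.
  right=> k; split.
    move=> th /andP[h0 h1]; apply: subset_closure; apply: Batt.
    by rewrite h1 ltW.
  have [_ _ _ _ [phi [tr pa pb]]] := hs k; exists phi.
  have [_ _ -> _ _] := hBt k; have [_ -> _ _ _] := hBt (ordS k).
  by rewrite ordSK; split.
- exists (\sum_(k < d) (Bt k).2%:E)%E; split.
    exists (fun k => (Bt k).2%:E); split=> // k; left; exists (Bt k).2; split=> //.
    by have [tr _ _ _ _] := hBt k.
  by apply/sum_fin_numP.
- exact: Batt.
left=> k; have [_ _ -> _ _] := hBt k; apply/nondegenerate_fold.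
have [_ [inf Gf Gxf Gxxf Gyf] uf _ _] := hs k.
split.
- by split; [split=> //; exact: rect_inside_rect|rewrite GxE].
- by rewrite GxxE.
- by rewrite GyE.
- by move=> x xK; rewrite GxE; exact: uf.
Unshelve. all: by end_near. Qed.

End fold_case.

Theorem proposition4 (R : realType) (K : window R) (g h : R * R -> R)
    (d : nat) (A : 'I_d -> R -> R * R) :
  V_f K g -> V_s K h ->
  simple_oscillation K g h A ->
  persistent_system K g h ->
  persistent_oscillation K g h A.
Proof.
move=> Vg Vh simple pers.
have [_ _ _ [folds|[d1 A10]]] := simple.
  apply: fold_oscillation_persists => // p.
  exact: persistent_fold_neq0 Vg Vh pers.
by subst d; exact: constant_persists.
Qed.
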